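(* Let $r\ge 1$ be an integer and let $\alpha_1,\ldots,\alpha_r,a_1,\ldots,a_r,b$ be positive real numbers such that $c:=b-\frac12(a_1\alpha_1+\cdots+a_r\alpha_r)\neq 0$. Put $\beta=\alpha_1+\cdots+\alpha_r$ and $c_r=(a_1^{\alpha_1}\cdots a_r^{\alpha_r})^{-1}$. For $\mathrm{Re}(s)>\beta$ define the multiple hyperbolic sinh-moment function \[S_{\alpha,a}(s;b)=\sum_{n_1,\ldots,n_r=0}^{\infty}\frac{\binom{n_1+\alpha_1-1}{n_1}\cdots\binom{n_r+\alpha_r-1}{n_r}}{(a_1n_1+\cdots+a_rn_r+b)^s}.\] Let $X_1,\ldots,X_r$ be independent random variables with $X_j\stackrel{d}{=}\frac12\hat S_{\alpha_j}$, where $\hat S_t$ denotes a random variable with characteristic function $E(e^{i\theta\hat S_t})=(\theta/\sinh\theta)^t$, $\theta\in\mathbb{R}$, and let $Y_r=a_1X_1+\cdots+a_rX_r$ with distribution function $F_{Y_r}$. Then \[S_{\alpha,a}(s;b)=c_r\frac{\Gamma(s-\beta)}{\Gamma(s)}\int_{\mathbb{R}}\frac{1}{(c+iy)^{s-\beta}}\,dF_{Y_r}(y)=c_r\frac{\Gamma(s-\beta)}{\Gamma(s)}E\big\{(c+iY_r)^{-s+\beta}\big\},\quad \mathrm{Re}(s)>\beta.\] Moreover: (a) $S_{\alpha,a}(s;b)$ extends (via this representation) to a meromorphic function of $s\in\mathbb{C}$, all of whose poles are simple. (b) If $\beta$ is a positive integer, then $S_{\alpha,a}(s;b)$ is analytic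 in $s\in\mathbb{C}$ except at $s=1,2,\ldots,\beta$, and precisely \[S_{\alpha,a}(s;b)=\frac{c_r}{(s-1)\cdots(s-\beta)}\int_{\mathbb{R}}\frac{1}{(c+iy)^{s-\beta}}\,dF_{Y_r}(y),\quad s\neq 1,2,\ldots,\beta.\] (c) If $\beta>0$ is not an integer, then $S_{\alpha,a}(s;b)$ has (trivial) zeros at $s=0,-1,-2,\ldots$, and: (i) for each non-negative integer $n<\beta$, the point $\beta-n$ is a simple pole with residue \[\lim_{s\to\beta-n}(s-\beta+n)S_{\alpha,a}(s;b)=\frac{(-1)^nc_rE\big((c+iY_r)^{n}\big)}{n!\,\Gamma(\beta-n)};\] (ii) for each positive integer $n>\beta$, the point $\beta-n$ is a simple pole with residue \[\lim_{s\to\beta-n}(s-\beta+n)S_{\alpha,a}(s;b)=\frac{(-1)^nc_rE\big((c+iY_r)^{n}\big)}{n!\,d_{\beta,n}},\quad d_{\beta,n}=\frac{(-1)^{[n-\beta]+1}\Gamma(\beta-n+1+[n-\beta])}{(n-\beta)(n-\beta-1)\cdots(n-\beta-[n-\beta])},\] where $[x]$ denotes the greatest integer $\le x$.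
   Context: For real $\gamma$, $\binom{\gamma}{0}=1$ and $\binom{\gamma}{n}=\gamma(\gamma-1)\cdots(\gamma-n+1)/n!$ for $n\in\mathbb{N}$. Complex powers are principal: $(c+ix)^s=\exp(s\,\mathrm{Log}(c+ix))$. $\Gamma$ is the Euler gamma function. The random variable $\hat S_t$ ($t>0$) exists, is symmetric about $0$, and has finite moments of all orders.
   Formalization: The integral/expectation formulas (main display, via representation in (a), closed formula in (b)) are stated only for c>0, as they fail for c<0; in (c) the point β-n is claimed to be a pole only if its residue is nonzero (E((c+iY_r)^n) can vanish), the limit formula being unconditional. *)

(* Defs.v *)
From HB Require Import structures.
From mathcomp Require Import all_boot all_order all_algebra.
From mathcomp Require Import finmap.
From mathcomp Require Import all_classical all_reals all_analysis.
From mathcomp Require summability.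
Import Order.TTheory GRing.Theory Num.Theory.
Import numFieldNormedType.Exports.
(* Last, so that Re and Im are the projections of R[i]. *)
From mathcomp Require Import complex.

Set Implicit Arguments.
Unset Strict Implicit.
Unset Printing Implicit Defensive.

Local Open Scope classical_set_scope.
Local Open Scope ring_scope.
Local Open Scope complex_scope.

Section ComplexAnalysis.
Variable K : numFieldType.
Implicit Types (f : K -> K) (z : K).

Definition holomorphic_at f z := \forall w \near z, derivable f w 1.

Definition pole_of_order f z (k : nat) := (0 < k)%N /\
  exists g : K -> K, [/\ holomorphic_at g z, g z != 0 &
    \forall w \near z^', f w = g w / (w - z) ^+ k].

(* The value of f at a pole is irrelevant; everywhere else f must be analytic, *)
(* so removable singularities are required to be filled in.                    *)
Definition meromorphic f :=
  forall z, holomorphic_at f z \/ exists k, pole_of_order f z k.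

(* lim_{w -> z} (w - z) f w = res.  When res = 0 the singularity is removable, *)
(* and only when res != 0 is z an actual pole.                                 *)
Definition is_simple_pole_with_residue f z (res : K) :=
  (fun w => (w - z) * f w) @ z^' --> res /\
  (res != 0 -> pole_of_order f z 1).

Definition unordered_summable (I : choiceType) (x : I -> K) :=
  cvg (summability.partial_sum x @ summability.totally).

Definition unordered_sum (I : choiceType) (x : I -> K) : K :=
  summability.sum x.

End ComplexAnalysis.

Section ComplexFunctions.
Variable R : realType.
Implicit Types (z w : R[i]).

Definition Cexp z : R[i] :=
  (expR (Re z) * cos (Im z)) +i* (expR (Re z) * sin (Im z)).

(* Principal argument, with values in ]-pi, pi].                               *)
Definition Carg z : R :=
  let t := acos (Re z / Re `|z|) in if 0 <= Im z then t else - t.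

Definition Clog z : R[i] := ln (Re `|z|) +i* Carg z.

(* Principal power; only ever used with z != 0.                                *)
Definition Cpower z w : R[i] := Cexp (w * Clog z).

Definition Cintegrable d (T : measurableType d)
    (mu : {measure set T -> \bar R}) (D : set T) (f : T -> R[i]) :=
  mu.-integrable D (fun x => (Re (f x))%:E) /\
  mu.-integrable D (fun x => (Im (f x))%:E).

Definition Cintegral d (T : measurableType d)
    (mu : {measure set T -> \bar R}) (D : set T) (f : T -> R[i]) : R[i] :=
  (\int[mu]_(x in D) Re (f x)) +i* (\int[mu]_(x in D) Im (f x)).

Definition Gamma_Euler z : R[i] :=
  Cintegral lebesgue_measure `]0, +oo[
    (fun x : R => Cpower x%:C (z - 1) * (expR (- x))%:C).

(* Euler's integral for 0 < Re z, continued to Re z <= 0 by the functional     *)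
(* equation Gamma z = Gamma (z + k) / (z (z + 1) ... (z + k - 1)), k being the *)
(* least integer such that 0 < Re (z + k).  At the poles 0, -1, -2, ... this   *)
(* reads u / 0 = 0, hence (Gamma z)^-1 = 0 there, which is the correct value   *)
(* of the entire function 1 / Gamma.                                           *)
Definition Gamma z : R[i] :=
  let k := if 0 < Re z then 0%N else (Num.truncn (- Re z)).+1 in
  Gamma_Euler (z + k%:R) / \prod_(i < k) (z + i%:R).

End ComplexFunctions.

Section RealFunctions.
Variable R : realType.

Definition gbinom (g : R) (n : nat) : R :=
  (\prod_(i < n) (g - i%:R)) / n`!%:R.

Definition sinh (x : R) : R := (expR x - expR (- x)) / 2.

(* (x / sinh x) ^ t, with its limit 1 at x = 0, where the quotient is 0 / 0.   *)
Definition hatS_char (t x : R) : R :=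
  if x == 0 then 1 else (x / sinh x) `^ t.

End RealFunctions.

Section Probability.
Variable R : realType.
Context d (T : measurableType d) (P : probability T R).

Definition charfun (X : {RV P >-> R}) (x : R) : R[i] :=
  Cintegral P setT (fun u => Cexp (0 +i* (x * X u))).

(* X is a version of the variable \hat S_t, a variable with all moments finite *)
(* whose characteristic function is (x / sinh x) ^ t.                          *)
Definition is_hatS (t : R) (X : {RV P >-> R}) :=
  (forall x, charfun X x = (hatS_char t x)%:C) /\
  (forall n : nat, P.-integrable setT (fun u => (X u ^+ n)%:E)).

Definition mutually_independent (r : nat) (X : 'I_r -> {RV P >-> R}) :=
  forall (J : {set 'I_r}) (A : 'I_r -> set R),
    (forall j, measurable (A j)) ->
    P (\bigcap_(j in [set` J]) (X j @^-1` A j)) =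
    (\prod_(j in J) P (X j @^-1` A j))%E.

(* Distribution function, as a real-valued function.                           *)
Definition distr_fun (X : {RV P >-> R}) (x : R) : R := fine (cdf X x).

Section Stieltjes.
Variable X : {RV P >-> R}.

Let distr_fun_nd : nondecreasing (distr_fun X).
Proof.
by move=> x y xy; rewrite fine_le ?fin_num_measure// cdf_nondecreasing.
Qed.

Let distr_fun_rc : right_continuous (distr_fun X).
Proof.
move=> x; apply: fine_cvg.
by rewrite fineK ?fin_num_measure//; exact: cdf_right_continuous.
Qed.

HB.instance Definition _ :=
  isCumulative.Build R _ R (distr_fun X) distr_fun_nd distr_fun_rc.

End Stieltjes.

(* The Lebesgue-Stieltjes measure dF_X.                                        *)
Definition dF (X : {RV P >-> R}) := lebesgue_stieltjes_measure (distr_fun X).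

End Probability.

Definition eq_in_law (R : realType) d (T : measurableType d)
    (P : probability T R) d' (T' : measurableType d') (Q : probability T' R)
    (X : T -> R) (Y : T' -> R) :=
  forall A : set R, measurable A -> P (X @^-1` A) = Q (Y @^-1` A).

Section SinhMoment.
Variables (R : realType) (r : nat) (alpha a : 'I_r -> R) (b : R).

Definition Smoment_term (s : R[i]) (n : {ffun 'I_r -> nat}) : R[i] :=
  (\prod_(j < r) gbinom ((n j)%:R + alpha j - 1) (n j))%:C
  / Cpower (\sum_(j < r) a j * (n j)%:R + b)%:C s.

Definition Smoment (s : R[i]) : R[i] := unordered_sum (Smoment_term s).

End SinhMoment.

(* [n - beta] is taken as a natural number: it is only used for beta < n.      *)
Definition d_coef (R : realType) (beta : R) (n : nat) : R[i] :=
  let m := `|Num.floor (n%:R - beta)|%N in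
  (-1) ^+ m.+1 * Gamma (beta - n%:R + 1 + m%:R)%:C
  / (\prod_(i < m.+1) (n%:R - beta - i%:R))%:C.

(* Main.v *)
(** Put w = c + i Y_r and G(x) = E e^(-x w). The product formula for the characteristic function
of Y_r gives G(x) = c_r^-1 x^beta e^(-b x) prod_j (1 - e^(-a_j x))^(-alpha_j) for x > 0, so by the
binomial series Gamma(s) S(s) is c_r times the Mellin transform of G at s - beta. Replacing G on
]0, 1] by G(x) - sum_(n < N) (-1)^n E(w^n) x^n / n! continues this transform to the half-plane
Re z > -N, up to the explicit terms (-1)^n E(w^n) / (n! (z + n)); dividing by Gamma gives the
continuation of S and its residues, whatever the sign of c. For c > 0, Fubini's theorem applied to
Gamma(z) w^(-z) = int_0^oo x^(z-1) e^(-x w) dx, continued in z by the same subtraction, turns the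
Mellin transform of G into Gamma(z) E w^(-z). *)
Require Import Defs.
From HB Require Import structures.
From mathcomp Require Import all_boot all_order all_algebra.
From mathcomp Require Import finmap.
From mathcomp Require Import all_classical all_reals all_analysis.
From mathcomp Require Import measurable_realfun.
Import Order.TTheory GRing.Theory Num.Theory.
Import numFieldNormedType.Exports.
From mathcomp Require Import complex.
From mathcomp Require Import ring lra.
Set Implicit Arguments.
Unset Strict Implicit.
Unset Printing Implicit Defensive.
Local Open Scope classical_set_scope.
Local Open Scope ring_scope.
Local Open Scope complex_scope.

(** For c < 0 each e^(-x w) grows like e^(-c x), yet its mean G decays, the closed form being e^(-b
    x) up to powers of x at infinity. Hence the continuation is built from the closed form on x > 0,
    while the Taylor data at 0 come from the expectation, all moments being finite. The interchange
    that produces E w^(-z) needs decay for every single outcome, which is where c > 0 enters. A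
    second difficulty sits in the division by Gamma: when beta - n is a non-positive integer, the
    pole at s = beta - n meets a zero of 1 / Gamma(s), and the correct value has to be filled in
    there, since a continuation must be right at removable points too. The facts about Gamma come
    from the same Mellin calculus: the power w^(-z) by differentiating along a curve, analyticity
    from a second-order remainder bound, absence of zeros from a variance estimate, the binomial
    series from the exponential series under the gamma integral. *)

Notation cabs := Normc.normc.

(** * Complex numbers and the exponential *)

Section ComplexAlgebra.
Variable R : realType.
Implicit Types (z w u : R[i]) (x y : R).

Lemma ReD z w : Re (z + w) = Re z + Re w. Proof. by case: z; case: w. Qed.
Lemma ImD z w : Im (z + w) = Im z + Im w. Proof. by case: z; case: w. Qed.
Lemma ReN z : Re (- z) = - Re z. Proof. by case: z. Qed.
Lemma ImN z : Im (- z) = - Im z. Proof. by case: z. Qed.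
Lemma ReB z w : Re (z - w) = Re z - Re w. Proof. by rewrite ReD ReN. Qed.
Lemma ImB z w : Im (z - w) = Im z - Im w. Proof. by rewrite ImD ImN. Qed.
Lemma ReM z w : Re (z * w) = Re z * Re w - Im z * Im w.
Proof. by case: z; case: w. Qed.
Lemma ImM z w : Im (z * w) = Re z * Im w + Im z * Re w.
Proof. by case: z; case: w. Qed.
Lemma Re1 : Re (1 : R[i]) = 1. Proof. by []. Qed.

Lemma natcE n : (n%:R : R[i]) = n%:R%:C.
Proof. by rewrite rmorph_nat. Qed.

Lemma Re_nat n : Re (n%:R : R[i]) = n%:R. Proof. by rewrite natcE. Qed.
Lemma Im_nat n : Im (n%:R : R[i]) = 0. Proof. by rewrite natcE. Qed.

Lemma Re_mulR x z : Re (x%:C * z) = x * Re z.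
Proof. by rewrite ReM /= mul0r subr0. Qed.
Lemma Im_mulR x z : Im (x%:C * z) = x * Im z.
Proof. by rewrite ImM /= mul0r addr0. Qed.

Lemma Re_sum I (r : seq I) (P : pred I) (F : I -> R[i]) :
  Re (\sum_(i <- r | P i) F i) = \sum_(i <- r | P i) Re (F i).
Proof. exact: (big_morph _ ReD erefl). Qed.
Lemma Im_sum I (r : seq I) (P : pred I) (F : I -> R[i]) :
  Im (\sum_(i <- r | P i) F i) = \sum_(i <- r | P i) Im (F i).
Proof. exact: (big_morph _ ImD erefl). Qed.

Lemma eqc z w : Re z = Re w -> Im z = Im w -> z = w.
Proof. by case: z => ? ?; case: w => ? ? /= -> ->. Qed.

Lemma cabsE z : `|z| = (cabs z)%:C. Proof. by case: z. Qed.

Lemma cabs_ge0 z : 0 <= cabs z. Proof. by case: z => a b; exact: sqrtr_ge0. Qed.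

Lemma cabs0 : cabs (0 : R[i]) = 0.
Proof. by rewrite /= expr0n addr0 sqrtr0. Qed.

Lemma cabsM z w : cabs (z * w) = cabs z * cabs w.
Proof. exact: Normc.normcM. Qed.

Lemma ler_cabsD z w : cabs (z + w) <= cabs z + cabs w.
Proof. by rewrite -lecR rmorphD /= -!cabsE; exact: ler_normD. Qed.

Lemma cabsN z : cabs (- z) = cabs z.
Proof. by case: z => a b /=; rewrite !sqrrN. Qed.

Lemma cabsB z w : cabs (z - w) = cabs (w - z).
Proof. by rewrite -cabsN opprB. Qed.

Lemma cabsR x : cabs x%:C = `|x|.
Proof. by rewrite /= expr0n addr0 sqrtr_sqr. Qed.

Lemma cabsX z n : cabs (z ^+ n) = cabs z ^+ n.
Proof.
elim: n => [|n ih]; first by rewrite !expr0 -[1]/(1%:C) cabsR normr1.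
by rewrite !exprS cabsM ih.
Qed.

Lemma cabs_eq0 z : (cabs z == 0) = (z == 0).
Proof.
apply/eqP/eqP => [/Normc.eq0_normc //|->]; exact: cabs0.
Qed.

Lemma cabs_gt0 z : (0 < cabs z) = (z != 0).
Proof. by rewrite lt_neqAle cabs_ge0 andbT eq_sym cabs_eq0. Qed.

Lemma Re_le_cabs z : `|Re z| <= cabs z.
Proof.
by case: z => a b /=; rewrite -(sqrtr_sqr a) ler_sqrt ?addr_ge0 ?sqr_ge0// lerDl sqr_ge0.
Qed.

Lemma Im_le_cabs z : `|Im z| <= cabs z.
Proof.
by case: z => a b /=; rewrite -(sqrtr_sqr b) ler_sqrt ?addr_ge0 ?sqr_ge0// lerDr sqr_ge0.
Qed.

Lemma cabs_le_ReIm z : cabs z <= `|Re z| + `|Im z|.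
Proof.
rewrite {1}[z]complexE (le_trans (ler_cabsD _ _))// cabsR lerD2l cabsM cabsR.
by rewrite /= expr0n expr1n add0r sqrtr1 mul1r.
Qed.

Lemma cabs_prod I (r : seq I) (P : pred I) (F : I -> R[i]) :
  cabs (\prod_(i <- r | P i) F i) = \prod_(i <- r | P i) cabs (F i).
Proof.
apply: (big_morph _ cabsM); by rewrite -[1]/(1%:C) cabsR normr1.
Qed.

End ComplexAlgebra.

Section ComplexExp.
Variable R : realType.
Implicit Types (z w u : R[i]) (x y : R).

Lemma Cexp0 : Cexp (0 : R[i]) = 1.
Proof. by rewrite /Cexp /= expR0 cos0 sin0 mulr1 mulr0. Qed.

Lemma CexpD z w : Cexp (z + w) = Cexp z * Cexp w.
Proof.
apply: eqc; rewrite /Cexp ?ReM ?ImM /= ReD ImD expRD ?cosD ?sinD; ring.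
Qed.

Lemma CexpNr z : Cexp z * Cexp (- z) = 1.
Proof. by rewrite -CexpD subrr Cexp0. Qed.

Lemma Cexp_neq0 z : Cexp z != 0.
Proof.
apply/eqP => E; have := CexpNr z; rewrite E mul0r => /esym/eqP.
by rewrite oner_eq0.
Qed.

Lemma CexpN z : Cexp (- z) = (Cexp z)^-1.
Proof. by apply: (mulfI (Cexp_neq0 z)); rewrite CexpNr mulfV ?Cexp_neq0. Qed.

Lemma CexpR x : Cexp x%:C = (expR x)%:C.
Proof. by rewrite /Cexp /= cos0 sin0 mulr1 mulr0. Qed.

Lemma CexpMn z n : Cexp (n%:R * z) = Cexp z ^+ n.
Proof.
elim: n => [|n ih]; first by rewrite mul0r Cexp0 expr0.
by rewrite -natr1 mulrDl mul1r CexpD ih exprSr.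
Qed.

Lemma Cexp_sum I (r : seq I) (P : pred I) (F : I -> R[i]) :
  Cexp (\sum_(i <- r | P i) F i) = \prod_(i <- r | P i) Cexp (F i).
Proof. exact: (big_morph _ CexpD Cexp0). Qed.

Lemma cabs_Cexp z : cabs (Cexp z) = expR (Re z).
Proof.
rewrite /= !exprMn -mulrDr cos2Dsin2 mulr1 sqrtr_sqr ger0_norm// expR_ge0.
Qed.

Lemma is_derive_fM (f g : R -> R) x a b : is_derive x 1 f a -> is_derive x 1 g b ->
  is_derive x 1 (fun t => f t * g t) (f x * b + g x * a).
Proof. exact: is_deriveM. Qed.

(** Derivative in a real variable, taken componentwise so that the real mean value theorem,
    fundamental theorem of calculus and differentiation under the integral apply. Differentiation in
    a complex variable is [cdiff]. *)
Definition cderiv (f : R -> R[i]) x (l : R[i]) :=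
  is_derive x 1 (fun t => Re (f t)) (Re l) /\
  is_derive x 1 (fun t => Im (f t)) (Im l).

Lemma cderiv_eq f x l l' : cderiv f x l -> l = l' -> cderiv f x l'.
Proof. by move=> ? <-. Qed.

Lemma cderiv_ext f g x l : f =1 g -> cderiv f x l -> cderiv g x l.
Proof. by move=> /funext ->. Qed.

Lemma cderiv_cst (a : R[i]) x : cderiv (fun=> a) x 0.
Proof. by split; exact: is_derive_cst. Qed.

Lemma cderivD f g x l m : cderiv f x l -> cderiv g x m ->
  cderiv (fun t => f t + g t) x (l + m).
Proof.
move=> [f1 f2] [g1 g2]; split.
- under eq_fun do rewrite ReD; rewrite ReD; exact: is_deriveD.
- under eq_fun do rewrite ImD; rewrite ImD; exact: is_deriveD.
Qed.

Lemma cderivM f g x l m : cderiv f x l -> cderiv g x m ->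
  cderiv (fun t => f t * g t) x (f x * m + g x * l).
Proof.
move=> [f1 f2] [g1 g2]; split.
- under eq_fun do rewrite ReM.
  apply: is_derive_eq.
  rewrite /GRing.scale /= ReD !ReM; ring.
- under eq_fun do rewrite ImM.
  apply: is_derive_eq.
  rewrite /GRing.scale /= ImD !ImM; ring.
Qed.

Lemma cderivZ (a : R[i]) f x l : cderiv f x l -> cderiv (fun t => a * f t) x (a * l).
Proof.
by move=> /(cderivM (cderiv_cst a x)) h; apply: (cderiv_eq h); rewrite mulr0 addr0.
Qed.

Lemma cderivN f x l : cderiv f x l -> cderiv (fun t => - f t) x (- l).
Proof.
move=> /(cderivZ (-1)) h; rewrite mulN1r in h; apply: cderiv_ext h => t.
by rewrite mulN1r.
Qed.

Lemma cderivB f g x l m : cderiv f x l -> cderiv g x m ->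
  cderiv (fun t => f t - g t) x (l - m).
Proof. by move=> hf hg; apply: cderivD => //; exact: cderivN. Qed.

Lemma cderivR (f : R -> R) x l : is_derive x 1 f l -> cderiv (fun t => (f t)%:C) x l%:C.
Proof. by move=> h; split => //=; exact: is_derive_cst. Qed.

Lemma cderiv_Cexp f x l : cderiv f x l ->
  cderiv (fun t => Cexp (f t)) x (l * Cexp (f x)).
Proof.
move=> [f1 f2].
have e1 : is_derive x 1 (expR \o (fun t => Re (f t))) (expR (Re (f x)) * Re l)
  by exact: is_derive1_comp.
have e2 : is_derive x 1 (cos \o (fun t => Im (f t))) (- sin (Im (f x)) * Im l)
  by exact: is_derive1_comp.
have e3 : is_derive x 1 (sin \o (fun t => Im (f t))) (cos (Im (f x)) * Im l)
  by exact: is_derive1_comp.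
split.
- have h := is_derive_fM e1 e2.
  by apply: (is_derive_eq h); rewrite ReM /=; ring.
- have h := is_derive_fM e1 e3.
  by apply: (is_derive_eq h); rewrite ImM /=; ring.
Qed.

Definition exp_sum N u : R[i] := \sum_(n < N) u ^+ n / n`!%:R.
Definition exp_rem N u : R[i] := Cexp u - exp_sum N u.

Lemma exp_sumS N u : exp_sum N.+1 u = exp_sum N u + u ^+ N / N`!%:R.
Proof. by rewrite /exp_sum big_ord_recr. Qed.

Lemma cderiv_lin u x : cderiv (fun t => t%:C * u) x u.
Proof.
apply: (@cderiv_eq _ _ (x%:C * 0 + u * 1%:C)); last by rewrite mulr0 add0r rmorph1 mulr1.
by apply: cderivM; [apply: cderivR; exact: is_derive_id | exact: cderiv_cst].
Qed.

Lemma cderivX f x l n : cderiv f x l ->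
  cderiv (fun t => f t ^+ n) x (n%:R * f x ^+ n.-1 * l).
Proof.
move=> h; elim: n => [|n ih].
  by rewrite mul0r mul0r; exact: cderiv_cst.
apply: (@cderiv_ext (fun t => f t * f t ^+ n)); first by move=> t; rewrite exprS.
apply: cderiv_eq (cderivM h ih) _ => /=.
case: n {ih} => [|n] /=; first by rewrite expr0; ring.
rewrite -[n.+2%:R]natr1 !exprS; ring.
Qed.

Lemma cderiv_exp_sum N f x l : cderiv f x l ->
  cderiv (fun t => exp_sum N.+1 (f t)) x (l * exp_sum N (f x)).
Proof.
move=> h; elim: N => [|N ih].
  rewrite /exp_sum big_ord0 mulr0.
  apply: cderiv_ext (cderiv_cst 1 x) => t.
  by rewrite big_ord_recr big_ord0 /= add0r expr0 fact0 divr1.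
apply: (@cderiv_ext (fun t => exp_sum N.+1 (f t) + (N.+1`!%:R)^-1 * f t ^+ N.+1)).
  by move=> t; rewrite [RHS]exp_sumS (mulrC (_^-1)).
apply: cderiv_eq (cderivD ih (cderivZ _ (cderivX N.+1 h))) _.
rewrite exp_sumS mulrDr; congr (_ + _).
have h1 : (N`!%:R : R[i]) != 0 by rewrite pnatr_eq0 -lt0n fact_gt0.
have h2 : (N.+1%:R : R[i]) != 0 by rewrite pnatr_eq0.
by rewrite factS natrM /= invfM mulrACA !mulrA mulVf// mul1r mulrC mulrA.
Qed.

Lemma cderiv_exp_rem N f x l : cderiv f x l ->
  cderiv (fun t => exp_rem N.+1 (f t)) x (l * exp_rem N (f x)).
Proof.
move=> h; apply: cderiv_eq (cderivB (cderiv_Cexp h) (cderiv_exp_sum N h)) _.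
by rewrite mulrBr.
Qed.

Lemma exp_rem0 N : exp_rem N.+1 (0 : R[i]) = 0.
Proof.
rewrite /exp_rem Cexp0 /exp_sum big_ord_recl /= expr0 fact0 divr1 big1 ?addr0 ?subrr//.
by move=> i _; rewrite expr0n /= mul0r.
Qed.

(** Induction on N: [exp_rem N.+1 (t * u)] vanishes at t = 0 and has t-derivative
    [u * exp_rem N (t * u)]. The mean value theorem bounds its real and imaginary parts separately,
    and adding the two bounds costs one factor 2 per step. *)
Lemma le_exp_rem N u : cabs (exp_rem N u) <= 2 ^+ N * cabs u ^+ N * expR `|Re u|.
Proof.
elim: N u => [|N ih] u.
  rewrite /exp_rem /exp_sum big_ord0 subr0 cabs_Cexp !expr0 !mul1r ler_expR.
  exact: ler_norm.
set B := 2 ^+ N * cabs u ^+ N.+1 * expR `|Re u|.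
have bnd t : t \in `]0, 1[ -> cabs (u * exp_rem N (t%:C * u)) <= B.
  rewrite in_itv /= => /andP[t0 t1].
  rewrite cabsM (le_trans (ler_wpM2l (cabs_ge0 _) (ih _)))// /B exprS.
  rewrite !mulrA (mulrC (cabs u)) -!mulrA ler_wpM2l ?exprn_ge0// ler_wpM2l ?cabs_ge0//.
  rewrite ler_pM ?exprn_ge0 ?cabs_ge0 ?expR_ge0//.
    rewrite lerXn2r ?nnegrE ?cabs_ge0// cabsM cabsR gtr0_norm// ler_piMl ?cabs_ge0//.
    exact: ltW.
  by rewrite ler_expR Re_mulR normrM gtr0_norm// ler_piMl// ltW.
have der t : cderiv (fun t => exp_rem N.+1 (t%:C * u)) t (u * exp_rem N (t%:C * u)).
  by apply: cderiv_exp_rem; exact: cderiv_lin.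
have mv (p : R[i] -> R) : p = @Re R \/ p = @Im R -> `|p (exp_rem N.+1 u)| <= B.
  move=> hp.
  have d1 (t : R) : is_derive t 1 (fun t => p (exp_rem N.+1 (t%:C * u)))
    (p (u * exp_rem N (t%:C * u))).
    by case: hp => ->; [exact: (der t).1 | exact: (der t).2].
  have cont : {within `[0, 1], continuous (fun t => p (exp_rem N.+1 (t%:C * u)))}.
    by apply: derivable_within_continuous => t _; case: (d1 t).
  have [t t01] := MVT (@ltr01 R) (fun t _ => d1 t) cont.
  rewrite mul0r exp_rem0 mul1r subr0 mulr1.
  have -> : p 0 = 0 by case: hp => ->.
  rewrite subr0 => ->; apply: le_trans (bnd _ t01).
  by case: hp => ->; [exact: Re_le_cabs | exact: Im_le_cabs].
have mR := mv _ (or_introl erefl); have mI := mv _ (or_intror erefl).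
apply: le_trans (cabs_le_ReIm _) _; apply: le_trans (lerD mR mI) _.
by rewrite -mulr2n -[_ *+ 2]mulr_natl /B !mulrA -exprS.
Qed.

End ComplexExp.

(** * Integrals of complex functions *)

Section ComplexMeasurable.
Context {R : realType} d (T : measurableType d).
Implicit Types (f g : T -> R[i]) (D : set T).

Definition cmeas D f :=
  measurable_fun D (fun x => Re (f x)) /\ measurable_fun D (fun x => Im (f x)).

Lemma cmeas_cst D (a : R[i]) : cmeas D (fun=> a).
Proof. by split; exact: measurable_cst. Qed.

Lemma cmeasR D (f : T -> R) : measurable_fun D f -> cmeas D (fun x => (f x)%:C).
Proof. by move=> mf; split => //=; exact: measurable_cst. Qed.

Lemma cmeas_mk D (f g : T -> R) : measurable_fun D f -> measurable_fun D g ->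
  cmeas D (fun x => f x +i* g x).
Proof. by []. Qed.

Lemma cmeasD D f g : cmeas D f -> cmeas D g -> cmeas D (fun x => f x + g x).
Proof.
move=> [f1 f2] [g1 g2]; split.
- under eq_fun do rewrite ReD; exact: measurable_funD.
- under eq_fun do rewrite ImD; exact: measurable_funD.
Qed.

Lemma cmeasM D f g : cmeas D f -> cmeas D g -> cmeas D (fun x => f x * g x).
Proof.
move=> [f1 f2] [g1 g2]; split.
- under eq_fun do rewrite ReM; apply: measurable_funB; exact: measurable_funM.
- under eq_fun do rewrite ImM; apply: measurable_funD; exact: measurable_funM.
Qed.

Lemma cmeasN D f : cmeas D f -> cmeas D (fun x => - f x).
Proof.
move=> hf; have := cmeasM (cmeas_cst D (-1)) hf.
by under eq_fun do rewrite mulN1r.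
Qed.

Lemma cmeasB D f g : cmeas D f -> cmeas D g -> cmeas D (fun x => f x - g x).
Proof. by move=> hf hg; apply: cmeasD => //; exact: cmeasN. Qed.

Lemma cmeasX D f n : cmeas D f -> cmeas D (fun x => f x ^+ n).
Proof.
move=> hf; elim: n => [|n ih]; first by under eq_fun do rewrite expr0; exact: cmeas_cst.
by under eq_fun do rewrite exprS; exact: cmeasM.
Qed.

Lemma cmeas_sum D I (r : seq I) (F : I -> T -> R[i]) :
  (forall i, cmeas D (F i)) -> cmeas D (fun x => \sum_(i <- r) F i x).
Proof.
move=> h; elim: r => [|i r ih].
  by under eq_fun do rewrite big_nil; exact: cmeas_cst.
by under eq_fun do rewrite big_cons; exact: cmeasD.
Qed.

Lemma cmeas_prod D I (r : seq I) (F : I -> T -> R[i]) :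
  (forall i, cmeas D (F i)) -> cmeas D (fun x => \prod_(i <- r) F i x).
Proof.
move=> h; elim: r => [|i r ih].
  by under eq_fun do rewrite big_nil; exact: cmeas_cst.
by under eq_fun do rewrite big_cons; exact: cmeasM.
Qed.

Lemma cmeas_Cexp D f : cmeas D f -> cmeas D (fun x => Cexp (f x)).
Proof.
move=> [f1 f2]; split => /=.
- apply: measurable_funM; first exact: measurableT_comp.
  by apply: measurableT_comp => //; apply: continuous_measurable_fun => x; exact: continuous_cos.
- apply: measurable_funM; first exact: measurableT_comp.
  by apply: measurableT_comp => //; apply: continuous_measurable_fun => x; exact: continuous_sin.
Qed.

Lemma cmeas_exp_sum D N f : cmeas D f -> cmeas D (fun x => exp_sum N (f x)).
Proof.
move=> hf; apply: cmeas_sum => i; apply: cmeasM; [exact: cmeasX | exact: cmeas_cst].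
Qed.

Lemma cmeas_exp_rem D N f : cmeas D f -> cmeas D (fun x => exp_rem N (f x)).
Proof.
by move=> hf; apply: cmeasB; [exact: cmeas_Cexp | exact: cmeas_exp_sum].
Qed.

Lemma cmeasS D E f : measurable E -> D `<=` E -> cmeas E f -> cmeas D f.
Proof. by move=> mE DE [f1 f2]; split; apply: measurable_funS; eassumption. Qed.

End ComplexMeasurable.

Lemma cmeas_comp {R : realType} d1 d2 (T1 : measurableType d1) (T2 : measurableType d2)
  (f : T2 -> R[i]) (h : T1 -> T2) : measurable_fun setT h -> cmeas setT f ->
  cmeas setT (fun x => f (h x)).
Proof. by move=> mh [f1 f2]; split;
  [exact: (measurableT_comp f1 mh)|exact: (measurableT_comp f2 mh)]. Qed.

Section ComplexIntegral.
Context {R : realType} d (T : measurableType d) (mu : {measure set T -> \bar R}).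
Variables (D : set T) (mD : measurable D).
Implicit Types (f g : T -> R[i]) (h : T -> R).

Definition rintegrable h := mu.-integrable D (EFin \o h).

Lemma Cintegrable_cmeas f : Cintegrable mu D f -> cmeas D f.
Proof.
by move=> [/integrableP[/measurable_EFinP f1 _] /integrableP[/measurable_EFinP f2 _]].
Qed.

Lemma eq_Cintegral f g : {in D, f =1 g} -> Cintegral mu D f = Cintegral mu D g.
Proof.
move=> fg; rewrite /Cintegral; congr (_ +i* _); apply: eq_Rintegral => x xD;
  by rewrite fg.
Qed.

Lemma eq_Cintegrable f g : {in D, f =1 g} -> Cintegrable mu D f -> Cintegrable mu D g.
Proof.
move=> fg [f1 f2]; split; [apply: eq_integrable f1|apply: eq_integrable f2] => // x xD;
  by rewrite fg.
Qed.

Lemma le_rintegrable h k : measurable_fun D h -> (forall x, D x -> `|h x| <= k x) ->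
  rintegrable k -> rintegrable h.
Proof.
move=> mh hk ik; apply: le_integrable ik => //; first exact/measurable_EFinP.
by move=> x Dx /=; rewrite lee_fin (le_trans (hk _ Dx))// ler_norm.
Qed.

Lemma rintegrableD h k : rintegrable h -> rintegrable k -> rintegrable (fun x => h x + k x).
Proof. by move=> ih ik; exact: (integrableD mD ih ik). Qed.

Lemma rintegrableZ (a : R) h : rintegrable h -> rintegrable (fun x => a * h x).
Proof. by move=> ih; exact: (integrableZl mD a ih). Qed.

Lemma Cintegrable_le f h : cmeas D f -> (forall x, D x -> cabs (f x) <= h x) ->
  rintegrable h -> Cintegrable mu D f.
Proof.
move=> [f1 f2] fh ih; split.
- by apply: le_rintegrable ih => // x Dx; exact: le_trans (Re_le_cabs _) (fh _ Dx).
- by apply: le_rintegrable ih => // x Dx; exact: le_trans (Im_le_cabs _) (fh _ Dx).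
Qed.

Lemma Cintegrable0 : Cintegrable mu D (fun=> 0).
Proof. by split; exact: integrable0. Qed.

Lemma CintegrableD f g : Cintegrable mu D f -> Cintegrable mu D g ->
  Cintegrable mu D (fun x => f x + g x).
Proof.
move=> [f1 f2] [g1 g2]; split.
- by under eq_fun do rewrite ReD; exact: rintegrableD.
- by under eq_fun do rewrite ImD; exact: rintegrableD.
Qed.

Lemma CintegralD f g : Cintegrable mu D f -> Cintegrable mu D g ->
  Cintegral mu D (fun x => f x + g x) = Cintegral mu D f + Cintegral mu D g.
Proof.
move=> [f1 f2] [g1 g2]; rewrite /Cintegral; apply: eqc; rewrite ?ReD ?ImD /=.
- by under eq_Rintegral do rewrite ReD; rewrite RintegralD.
- by under eq_Rintegral do rewrite ImD; rewrite RintegralD.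
Qed.

Lemma CintegrableZ (a : R[i]) f : Cintegrable mu D f -> Cintegrable mu D (fun x => a * f x).
Proof.
move=> [f1 f2]; split.
- under eq_fun do rewrite ReM -mulNr.
  by apply: rintegrableD; exact: rintegrableZ.
- under eq_fun do rewrite ImM.
  by apply: rintegrableD; exact: rintegrableZ.
Qed.

Lemma CintegralZ (a : R[i]) f : Cintegrable mu D f ->
  Cintegral mu D (fun x => a * f x) = a * Cintegral mu D f.
Proof.
move=> [f1 f2]; rewrite /Cintegral; apply: eqc; rewrite ?ReM ?ImM /=.
- under eq_Rintegral do rewrite ReM -mulNr.
  by rewrite RintegralD ?RintegralZl ?mulNr//; exact: rintegrableZ.
- under eq_Rintegral do rewrite ImM.
  by rewrite RintegralD ?RintegralZl//; exact: rintegrableZ.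
Qed.

Lemma CintegrableN f : Cintegrable mu D f -> Cintegrable mu D (fun x => - f x).
Proof.
by move=> /(CintegrableZ (-1)); apply: eq_Cintegrable => x _; rewrite mulN1r.
Qed.

Lemma CintegrableB f g : Cintegrable mu D f -> Cintegrable mu D g ->
  Cintegrable mu D (fun x => f x - g x).
Proof. by move=> f1 g1; apply: CintegrableD => //; exact: CintegrableN. Qed.

Lemma CintegralB f g : Cintegrable mu D f -> Cintegrable mu D g ->
  Cintegral mu D (fun x => f x - g x) = Cintegral mu D f - Cintegral mu D g.
Proof.
move=> f1 g1; rewrite CintegralD//; last exact: CintegrableN.
by congr (_ + _); rewrite -mulN1r -CintegralZ//; apply: eq_Cintegral => x _; rewrite mulN1r.
Qed.

Lemma Cintegral0 : Cintegral mu D (fun=> 0) = 0.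
Proof.
have h := CintegralZ 0 Cintegrable0.
by rewrite !mul0r in h.
Qed.

Lemma Cintegrable_sum (I : eqType) (r : seq I) (F : I -> T -> R[i]) :
  (forall i, i \in r -> Cintegrable mu D (F i)) -> Cintegrable mu D (fun x => \sum_(i <- r) F i x).
Proof.
elim: r => [|i r ih] h.
  by under eq_fun do rewrite big_nil; exact: Cintegrable0.
under eq_fun do rewrite big_cons; apply: CintegrableD; first by apply: h; rewrite mem_head.
by apply: ih => j jr; apply: h; rewrite inE jr orbT.
Qed.

Lemma Cintegral_sum (I : eqType) (r : seq I) (F : I -> T -> R[i]) :
  (forall i, i \in r -> Cintegrable mu D (F i)) ->
  Cintegral mu D (fun x => \sum_(i <- r) F i x) = \sum_(i <- r) Cintegral mu D (F i).
Proof.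
elim: r => [|i r ih] h.
  by rewrite big_nil -[RHS]Cintegral0; apply: eq_Cintegral => x _; rewrite big_nil.
have hr j : j \in r -> Cintegrable mu D (F j) by move=> jr; apply: h; rewrite inE jr orbT.
rewrite big_cons -ih// -CintegralD//; [|by apply: h; rewrite mem_head|exact: Cintegrable_sum].
by apply: eq_Cintegral => x _; rewrite big_cons.
Qed.

Lemma CintegralR h : Cintegral mu D (fun x => (h x)%:C) = (\int[mu]_(x in D) h x)%:C.
Proof.
by rewrite /Cintegral; apply: eqc => //=; rewrite Rintegral_cst// mul0r.
Qed.

(* The factor 2 comes from bounding the real and imaginary parts separately. *)
Lemma le_Cintegral f h : Cintegrable mu D f -> rintegrable h ->
  (forall x, D x -> cabs (f x) <= h x) ->
  cabs (Cintegral mu D f) <= 2 * \int[mu]_(x in D) h x.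
Proof.
move=> [f1 f2] ih fh; apply: le_trans (cabs_le_ReIm _) _ => /=.
rewrite mulrDl mul1r; apply: lerD.
- apply: le_trans (le_normr_Rintegral mD f1) _; apply: le_Rintegral => //.
    exact: (integrable_norm f1).
  by move=> x Dx; exact: le_trans (Re_le_cabs _) (fh _ Dx).
- apply: le_trans (le_normr_Rintegral mD f2) _; apply: le_Rintegral => //.
    exact: (integrable_norm f2).
  by move=> x Dx; exact: le_trans (Im_le_cabs _) (fh _ Dx).
Qed.

Lemma cabs_cvg0 (u : nat -> R[i]) : (fun n => cabs (u n)) @ \oo --> 0 ->
  (fun n => Re (u n)) @ \oo --> 0 /\ (fun n => Im (u n)) @ \oo --> 0.
Proof.
move=> h; split.
- apply/norm_cvg0P; apply: squeeze_cvgr (cvg_cst 0) h; apply: nearW => n.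
  by rewrite normr_ge0 Re_le_cabs.
- apply/norm_cvg0P; apply: squeeze_cvgr (cvg_cst 0) h; apply: nearW => n.
  by rewrite normr_ge0 Im_le_cabs.
Qed.

Lemma Rintegral_dominated (f_ : nat -> T -> R) (f h : T -> R) :
  (forall n, measurable_fun D (f_ n)) -> measurable_fun D f ->
  (forall x, D x -> (fun n => f_ n x) @ \oo --> f x) -> rintegrable h ->
  (forall n x, D x -> `|f_ n x| <= h x) ->
  (fun n => \int[mu]_(x in D) f_ n x) @ \oo --> \int[mu]_(x in D) f x.
Proof.
move=> mf_ mf cf ih fh.
have [] := @dominated_convergence _ _ _ mu D mD (fun n x => (f_ n x)%:E) (EFin \o f) (EFin \o h).
- by move=> n; exact/measurable_EFinP.
- exact/measurable_EFinP.
- by apply: aeW => x Dx; apply: cvg_EFin; [exact: nearW|exact: cf].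
- exact: ih.
- by apply: aeW => x n Dx /=; rewrite lee_fin fh.
move=> i1 _ c; apply: fine_cvg; rewrite fineK//.
exact: integrable_fin_num i1.
Qed.

Lemma Cintegral_dominated (f_ : nat -> T -> R[i]) (f : T -> R[i]) h :
  (forall n, cmeas D (f_ n)) -> cmeas D f ->
  (forall x, D x -> (fun n => cabs (f_ n x - f x)) @ \oo --> 0) -> rintegrable h ->
  (forall n x, D x -> cabs (f_ n x) <= h x) ->
  (fun n => cabs (Cintegral mu D (f_ n) - Cintegral mu D f)) @ \oo --> 0.
Proof.
move=> mf_ mf cf ih fh.
have cR : (fun n => \int[mu]_(x in D) Re (f_ n x)) @ \oo --> \int[mu]_(x in D) Re (f x).
  apply: (Rintegral_dominated _ _ _ ih) => [n||x Dx|n x Dx]; [exact: (mf_ n).1|exact: mf.1| |].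
    have [h1 _] := cabs_cvg0 (cf _ Dx); apply/subr_cvg0.
    by move: h1; under eq_fun do rewrite ReB.
  exact: le_trans (Re_le_cabs _) (fh _ _ Dx).
have cI : (fun n => \int[mu]_(x in D) Im (f_ n x)) @ \oo --> \int[mu]_(x in D) Im (f x).
  apply: (Rintegral_dominated _ _ _ ih) => [n||x Dx|n x Dx]; [exact: (mf_ n).2|exact: mf.2| |].
    have [_ h1] := cabs_cvg0 (cf _ Dx); apply/subr_cvg0.
    by move: h1; under eq_fun do rewrite ImB.
  exact: le_trans (Im_le_cabs _) (fh _ _ Dx).
have c : (fun n => `|\int[mu]_(x in D) Re (f_ n x) - \int[mu]_(x in D) Re (f x)| +
   `|\int[mu]_(x in D) Im (f_ n x) - \int[mu]_(x in D) Im (f x)|) @ \oo --> (0 + 0 : R).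
  by apply: cvgD; apply/norm_cvg0P; apply/subr_cvg0.
rewrite addr0 in c; apply: squeeze_cvgr (cvg_cst 0) c; apply: nearW => n.
apply/andP; split; first exact: cabs_ge0.
by apply: le_trans (cabs_le_ReIm _) _; rewrite ReB ImB.
Qed.

Lemma Cintegral_setU (A B : set T) f : d.-measurable A -> d.-measurable B ->
  [disjoint A & B] -> Cintegrable mu (A `|` B) f ->
  Cintegral mu (A `|` B) f = Cintegral mu A f + Cintegral mu B f.
Proof.
move=> mA mB AB [f1 f2]; rewrite /Cintegral; apply: eqc; rewrite ?ReD ?ImD /=;
  exact: Rintegral_setU.
Qed.

Lemma CintegrableS (A : set T) f : d.-measurable A -> A `<=` D ->
  Cintegrable mu D f -> Cintegrable mu A f.
Proof. by move=> mA AD [f1 f2]; split; [exact: integrableS f1|exact: integrableS f2]. Qed.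

End ComplexIntegral.

Lemma Cintegral_mkcond {R : realType} d (T : measurableType d) (mu : {measure set T -> \bar R})
  (D : set T) (f : T -> R[i]) : 
  Cintegral mu D f = Cintegral mu setT (fun x => (\1_D x)%:C * f x).
Proof.
rewrite /Cintegral; apply: eqc => /=; rewrite Rintegral_mkcond; apply: eq_Rintegral => x _.
  by rewrite Re_mulR patchE indicE; case: ifPn => _; rewrite ?mul1r ?mul0r.
by rewrite Im_mulR patchE indicE; case: ifPn => _; rewrite ?mul1r ?mul0r.
Qed.

Lemma Rintegrable_mkcond {R : realType} d (T : measurableType d) (mu : {measure set T -> \bar R})
  (D : set T) (mD : measurable D) (h : T -> R) : 
  rintegrable mu D h -> rintegrable mu setT (fun x => \1_D x * h x).
Proof.
move=> ih; have : mu.-integrable (setT `&` D) (EFin \o h) by rewrite setTI.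
move=> /(integrable_restrict mu mD measurableT (EFin \o h)).1.
apply: eq_integrable => // x _; rewrite /= patchE indicE.
by case: ifPn => _; rewrite ?mul1r ?mul0r.
Qed.

(** * Fubini's theorem for integrands bounded by a product g(x) h(y) *)

Section ComplexFubini.
Context {R : realType} d1 d2 (T1 : measurableType d1) (T2 : measurableType d2).
Variables (m1 : {sigma_finite_measure set T1 -> \bar R}).
Variables (m2 : {sigma_finite_measure set T2 -> \bar R}).

(** By Tonelli the integral of |f| is at most the product of the integrals of g and h. As the bound
    holds at every point, all sections are integrable, not just almost all. *)
Lemma Rfubini (f : T1 -> T2 -> R) (g : T1 -> R) (h : T2 -> R) :
  measurable_fun setT (fun z : T1 * T2 => f z.1 z.2) ->
  (forall x y, `|f x y| <= g x * h y) -> (forall x, 0 <= g x) -> (forall y, 0 <= h y) ->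
  rintegrable m1 setT g -> rintegrable m2 setT h ->
  [/\ (forall x, rintegrable m2 setT (f x)), (forall y, rintegrable m1 setT (f^~ y)) &
  \int[m1]_x (\int[m2]_y f x y) = \int[m2]_y (\int[m1]_x f x y)].
Proof.
move=> mf fgh g0 h0 ig ih.
have i2 x : rintegrable m2 setT (f x).
  apply: (le_rintegrable measurableT _ _ (rintegrableZ measurableT (g x) ih)) => //.
  exact: (measurable_fun_pair2 x mf).
have i1 y : rintegrable m1 setT (f^~ y).
  apply: (le_rintegrable measurableT _ _ (rintegrableZ measurableT (h y) ig)) => //.
    exact: (measurable_fun_pair1 y mf).
  by move=> x _; rewrite mulrC.
have mE : measurable_fun setT (fun z : T1 * T2 => (f z.1 z.2)%:E) by exact/measurable_EFinP.
have ip : (m1 \x m2)%E.-integrable setT (fun z : T1 * T2 => (f z.1 z.2)%:E).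
  apply/(integrable12ltyP _ _ mE) => /=.
  apply: (@le_lt_trans _ _ (\int[m1]_x ((g x)%:E * \int[m2]_y (h y)%:E))%E).
    apply: ge0_le_integral => //.
    - by move=> x _; exact: integral_ge0.
    - by apply: (@measurable_fun_fubini_tonelli_F _ _ _ _ _ m2 (fun z => `|(f z.1 z.2)%:E|%E)) =>
      //; exact: measurableT_comp.
    - by apply: emeasurable_funM => //; move: ig => /integrableP[].
    - move=> x _; rewrite -integralZl//.
      apply: ge0_le_integral => //.
      + by apply/measurable_EFinP; apply: measurableT_comp => //;
        exact: (measurable_fun_pair2 x mf).
      + by apply/measurable_EFinP; apply: measurable_funM => //;
        move: ih => /integrableP[/measurable_EFinP].
      + by move=> y _; rewrite /= lee_fin.
  have hf : (\int[m2]_y (h y)%:E)%E \is a fin_num by exact: integrable_fin_num ih.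
  rewrite -(fineK hf); under eq_integral do rewrite muleC.
  rewrite integralZl// ltey_eq fin_numM//; exact: integrable_fin_num ig.
split => //.
have := Fubini ip => /= E.
rewrite /Rintegral.
transitivity (fine (\int[m1]_x \int[m2]_y (f x y)%:E)%E).
  congr fine; apply: eq_integral => x _; rewrite fineK//; exact: integrable_fin_num (i2 x).
rewrite E; congr fine; apply: eq_integral => y _; rewrite fineK//; exact: integrable_fin_num (i1 y).
Qed.

Lemma Cfubini (D : set T1) (f : T1 -> T2 -> R[i]) (g : T1 -> R) (h : T2 -> R) :
  measurable D -> cmeas setT (fun z : T1 * T2 => f z.1 z.2) ->
  (forall x y, D x -> cabs (f x y) <= g x * h y) -> (forall x, D x -> 0 <= g x) ->
  (forall y, 0 <= h y) -> rintegrable m1 D g -> rintegrable m2 setT h ->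
  Cintegral m1 D (fun x => Cintegral m2 setT (f x)) =
  Cintegral m2 setT (fun y => Cintegral m1 D (f^~ y)).
Proof.
move=> mD [mf1 mf2] fgh g0 h0 ig ih.
have mi : measurable_fun setT (fun z : T1 * T2 => \1_D z.1 : R).
  by apply: (@measurableT_comp _ _ _ _ _ _ (\1_D : T1 -> R) setT fst) => //;
    exact: measurable_indic.
have hb p : p = @Re R \/ p = @Im R -> forall x y, `|\1_D x * p (f x y)| <= (\1_D x * g x) * h y.
  move=> hp x y; rewrite indicE; case: (boolP (x \in D)) => xD; last first.
    by rewrite !mul0r normr0.
  rewrite !mul1r; apply: le_trans (fgh _ _ (set_mem xD)).
  by case: hp => ->; [exact: Re_le_cabs|exact: Im_le_cabs].
have g1 x : 0 <= \1_D x * g x.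
  rewrite indicE; case: (boolP (x \in D)) => xD; rewrite ?mul0r// mul1r.
  exact: g0 (set_mem xD).
have [_ _ E1] := Rfubini (measurable_funM mi mf1) (hb _ (or_introl erefl)) g1 h0
  (Rintegrable_mkcond mD ig) ih.
have [_ _ E2] := Rfubini (measurable_funM mi mf2) (hb _ (or_intror erefl)) g1 h0
  (Rintegrable_mkcond mD ig) ih.
rewrite Cintegral_mkcond; under [in RHS]eq_Cintegral do rewrite Cintegral_mkcond.
rewrite /Cintegral; congr (_ +i* _).
- transitivity (\int[m1]_x (\int[m2]_y (\1_D x * Re (f x y)))).
    apply: eq_Rintegral => x _; rewrite Re_mulR /= indicE.
    case: (boolP (x \in D)) => xD; rewrite ?mul0r ?mul1r.
      by under [RHS]eq_Rintegral do rewrite mul1r.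
    by under eq_Rintegral do rewrite mul0r; rewrite Rintegral_cst// mul0r.
  by rewrite E1; apply: eq_Rintegral => y _; apply: eq_Rintegral => x _; rewrite Re_mulR.
- transitivity (\int[m1]_x (\int[m2]_y (\1_D x * Im (f x y)))).
    apply: eq_Rintegral => x _; rewrite Im_mulR /= indicE.
    case: (boolP (x \in D)) => xD; rewrite ?mul0r ?mul1r.
      by under [RHS]eq_Rintegral do rewrite mul1r.
    by under eq_Rintegral do rewrite mul0r; rewrite Rintegral_cst// mul0r.
  by rewrite E2; apply: eq_Rintegral => y _; apply: eq_Rintegral => x _; rewrite Im_mulR.
Qed.

End ComplexFubini.

(** * Complex differentiability of parametric integrals *)

Section ComplexDerivable.
Variable K : numFieldType.
Implicit Types (f g : K -> K) (z : K).

Definition cdiff f z := derivable f z 1.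

Lemma cdiff_cst (a : K) z : cdiff (fun=> a) z.
Proof. exact: derivable_cst. Qed.

Lemma cdiff_id z : cdiff (fun w => w) z.
Proof. exact: derivable_id. Qed.

Lemma cdiffD f g z : cdiff f z -> cdiff g z -> cdiff (fun w => f w + g w) z.
Proof. exact: derivableD. Qed.

Lemma cdiffB f g z : cdiff f z -> cdiff g z -> cdiff (fun w => f w - g w) z.
Proof. exact: derivableB. Qed.

Lemma cdiffM f g z : cdiff f z -> cdiff g z -> cdiff (fun w => f w * g w) z.
Proof. exact: derivableM. Qed.

Lemma cdiffV f z : f z != 0 -> cdiff f z -> cdiff (fun w => (f w)^-1) z.
Proof. exact: derivableV. Qed.

Lemma cdiff_prod I (r : seq I) (F : I -> K -> K) z :
  (forall i, cdiff (F i) z) -> cdiff (fun w => \prod_(i <- r) F i w) z.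
Proof.
move=> h; elim: r => [|i r ih].
  by under eq_fun do rewrite big_nil; exact: cdiff_cst.
by under eq_fun do rewrite big_cons; exact: cdiffM.
Qed.

Lemma cdiff_comp f g z : cdiff g z -> cdiff f (g z) -> cdiff (fun w => f (g w)) z.
Proof.
rewrite /cdiff => /derivable1_diffP dg /derivable1_diffP df.
by apply/derivable1_diffP; exact: differentiable_comp.
Qed.

Lemma cdiff_shift f a z : cdiff f (z + a) -> cdiff (fun w => f (w + a)) z.
Proof.
move=> h; have h1 : cdiff (fun w => w + a) z.
  by apply: cdiffD; [exact: cdiff_id|exact: cdiff_cst].
by apply: (@cdiff_comp f (fun w => w + a)).
Qed.

Lemma cdiff_continuous f z : cdiff f z -> f w @[w --> z] --> f z.
Proof. by move=> /derivable1_diffP /differentiable_continuous. Qed.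

Lemma cdiff_near_eq f g z : (\forall w \near z, f w = g w) -> cdiff f z -> cdiff g z.
Proof. by move=> fg; apply: near_eq_derivable => //; rewrite oner_neq0. Qed.

(** The difference quotient differs from l by at most C |h|. This is how analyticity is reached
    throughout: only a second-order remainder has to be estimated. *)
Lemma cdiff_quad f z (l C e : K) : 0 < e -> 0 <= C ->
  (forall h, `|h| < e -> `|f (z + h) - f z - h * l| <= C * `|h| ^+ 2) -> cdiff f z.
Proof.
move=> e0 C0 H; apply/cvg_ex; exists l; apply/cvgrPdist_le => /= r r0.
near=> h.
have h0 : h != 0 by near: h; exact: nbhs_dnbhs_neq.
have he : `|h| < e by near: h; apply: dnbhs0_lt.
(* C + 1 keeps the divisor positive when C = 0. *)
have hr : `|h| < r / (C + 1).
  by near: h; apply: dnbhs0_lt; rewrite divr_gt0// ltr_wpDl.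
rewrite [h *: 1]mulr1 distrC (addrC h z).
have -> : h^-1 *: (f (z + h) - f z) - l = h^-1 * (f (z + h) - f z - h * l).
  by rewrite [RHS]mulrBr mulKf.
rewrite normrM normfV.
apply: (@le_trans _ _ (`|h|^-1 * (C * `|h| ^+ 2))).
  by rewrite ler_wpM2l ?invr_ge0// H.
rewrite mulrCA expr2 mulKf ?normr_eq0//.
apply: (@le_trans _ _ ((C + 1) * `|h|)); first by rewrite ler_wpM2r// lerDl.
by rewrite mulrC -ler_pdivlMr ?ltr_wpDl// ltW.
Unshelve. all: by end_near. Qed.

End ComplexDerivable.

Section HalfPlanes.
Variable R : realType.
Implicit Types (z w : R[i]).

Lemma near_cabs (z : (R[i] : numFieldType)) (e : R) : 0 < e -> \forall w \near z, cabs (z - w) < e.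
Proof.
move=> e0; have e0' : 0 < e%:C by rewrite ltcR.
apply: filterS (nbhsx_ballx z _ e0') => w.
by rewrite /ball /= cabsE ltcR.
Qed.

Lemma near_Re_gt (z : (R[i] : numFieldType)) (a : R) : a < Re z -> \forall w \near z, a < Re w.
Proof.
move=> az; rewrite -subr_gt0 in az; apply: filterS (near_cabs z az) => w h.
have := le_lt_trans (ler_norm _) (le_lt_trans (Re_le_cabs (z - w)) h).
by rewrite ReB ltrD2l ltrN2.
Qed.

End HalfPlanes.

Section ParametricIntegrals.
Context {R : realType} d (T : measurableType d) (mu : {measure set T -> \bar R}).
Variables (D : set T) (mD : measurable D).

Lemma expR_ge_sqr (y : R) : 0 <= y -> y ^+ 2 <= 4 * expR y.
Proof.
move=> y0; have h : y / 2 <= expR (y / 2).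
  by apply: le_trans (expR_ge1Dx _); rewrite lerDr.
have -> : expR y = expR (y / 2) ^+ 2 by rewrite -expRM_natl; congr expR; lra.
have := lerXn2r 2 _ _ h; rewrite !nnegrE divr_ge0// expR_ge0 => /(_ isT isT).
rewrite expr_div_n; lra.
Qed.

(** The second-order remainder of the integrand in p is A e^(p0 B) times [exp_rem 2] at h B. For |h|
    < e / 2, half of the reserve e^(e |B|) absorbs e^(|h B|) and the other half absorbs B^2, so the
    integrated remainder is O(|h|^2). *)
Lemma mellin_diff_at (A : T -> R[i]) (B : T -> R) p0 e : 0 < e ->
  cmeas D A -> measurable_fun D B ->
  rintegrable mu D (fun x => cabs (A x) * expR (Re p0 * B x + e * `|B x|)) ->
  cdiff (fun p => Cintegral mu D (fun x => A x * Cexp (p * (B x)%:C))) p0.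
Proof.
move=> e0 mA mB ig.
set g := fun x => cabs (A x) * expR (Re p0 * B x + e * `|B x|).
have g0 x : 0 <= g x by rewrite mulr_ge0 ?cabs_ge0 ?expR_ge0.
have mE p : cmeas D (fun x => Cexp (p * (B x)%:C)).
  by apply: cmeas_Cexp; apply: cmeasM; [exact: cmeas_cst|exact: cmeasR].
have iE p : cabs (p - p0) <= e -> Cintegrable mu D (fun x => A x * Cexp (p * (B x)%:C)).
  move=> pe; apply: (@Cintegrable_le _ _ _ _ _ mD _ g) => //; first exact: cmeasM.
  move=> x _; rewrite cabsM cabs_Cexp ler_wpM2l ?cabs_ge0// ler_expR.
  rewrite mulrC Re_mulR mulrC -lerBlDl -mulrBl -ReB.
  apply: le_trans (ler_norm _) _; rewrite normrM ler_wpM2r//.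
  exact: le_trans (Re_le_cabs _) pe.
have iL : Cintegrable mu D (fun x => A x * (B x)%:C * Cexp (p0 * (B x)%:C)).
  apply: (@Cintegrable_le _ _ _ _ _ mD _ (fun x => e^-1 * g x)) => //; last exact: rintegrableZ.
    by apply: cmeasM => //; apply: cmeasM => //; exact: cmeasR.
  move=> x _; rewrite /g !cabsM cabs_Cexp cabsR -mulrA (mulrCA e^-1) ler_wpM2l ?cabs_ge0//.
  rewrite (mulrC p0) Re_mulR (mulrC (B x)) expRD (mulrCA e^-1) [leLHS]mulrC ler_wpM2l ?expR_ge0//.
  rewrite ler_pdivlMl//; apply: le_trans (expR_ge1Dx _).
  by rewrite lerDr.
set l := Cintegral mu D (fun x => A x * (B x)%:C * Cexp (p0 * (B x)%:C)).
set M := \int[mu]_(x in D) g x.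
have M0 : 0 <= M by exact: Rintegral_ge0.
(* The outer 2 is the loss in [le_Cintegral]. In 256 = 4 * 16 * 4 the first 4 is 2^2 from
   [le_exp_rem], 16 / e^2 comes from [expR_ge_sqr] at e |B| / 2, and the last 4 is slack. *)
pose C : R := 2 * (256 / e ^+ 2 * M).
apply: (@cdiff_quad _ _ _ l C%:C (e / 2)%:C).
- by rewrite ltcR divr_gt0.
- by rewrite lecR /C !mulr_ge0// invr_ge0 exprn_ge0// ltW.
move=> h; rewrite !cabsE -rmorphXn -rmorphM /= ltcR lecR => he.
have he' : cabs (p0 + h - p0) <= e by rewrite addrC addKr; apply: ltW; lra.
have h0 : cabs (p0 - p0) <= e by rewrite subrr cabs0 ltW.
have j1 := iE _ he'; have j2 := iE _ h0.
rewrite -CintegralB//.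
have -> : h * l = Cintegral mu D (fun x => h * (A x * (B x)%:C * Cexp (p0 * (B x)%:C))).
  by rewrite CintegralZ.
rewrite -CintegralB//; [|exact: CintegrableB|exact: CintegrableZ].
have iK : rintegrable mu D (fun x => (256 / e ^+ 2 * cabs h ^+ 2) * g x) by exact: rintegrableZ.
apply: le_trans (le_Cintegral mD _ iK _) _.
- by apply: CintegrableB => //; [exact: CintegrableB|exact: CintegrableZ].
- move=> x _.
  have -> : A x * Cexp ((p0 + h) * (B x)%:C) - A x * Cexp (p0 * (B x)%:C) -
    h * (A x * (B x)%:C * Cexp (p0 * (B x)%:C)) =
    A x * Cexp (p0 * (B x)%:C) * exp_rem 2 (h * (B x)%:C).
    rewrite mulrDl CexpD /exp_rem /exp_sum !big_ord_recl big_ord0 /= !expr0 !expr1 !divr1; ring.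
  rewrite !cabsM cabs_Cexp (mulrC p0) Re_mulR.
  apply: le_trans (ler_wpM2l _ (le_exp_rem _ _)) _.
    by rewrite mulr_ge0 ?cabs_ge0 ?expR_ge0.
  rewrite /g expRD (mulrC (Re p0)).
  set a := cabs (A x); set E := expR (B x * Re p0).
  have -> : 256 / e ^+ 2 * cabs h ^+ 2 * (a * (E * expR (e * `|B x|))) =
   a * E * (256 / e ^+ 2 * cabs h ^+ 2 * expR (e * `|B x|)) by ring.
  rewrite ler_wpM2l ?mulr_ge0 ?expR_ge0 ?cabs_ge0//.
  rewrite (mulrC h) Re_mulR cabsM cabsR exprMn.
  have hB : expR `|B x * Re h| <= expR (e / 2 * `|B x|).
    rewrite ler_expR normrM mulrC ler_wpM2r//.
    exact: le_trans (Re_le_cabs _) (ltW he).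
  have y0 : 0 <= e / 2 * `|B x| by rewrite mulr_ge0// ltW// divr_gt0.
  have hB2 : `|B x| ^+ 2 <= 16 / e ^+ 2 * expR (e / 2 * `|B x|).
    have := expR_ge_sqr y0; rewrite exprMn expr_div_n => h2.
    rewrite mulrAC ler_pdivlMr ?exprn_gt0//; lra.
  have -> : expR (e * `|B x|) = expR (e / 2 * `|B x|) * expR (e / 2 * `|B x|).
    by rewrite -expRD; congr expR; lra.
  set F := expR (e / 2 * `|B x|) in hB hB2 *.
  have -> : 256 / e ^+ 2 * cabs h ^+ 2 * (F * F) =
    2 ^+ 2 * ((4 * (16 / e ^+ 2 * F)) * cabs h ^+ 2) * F by ring.
  apply: ler_pM => //; rewrite ?mulr_ge0 ?exprn_ge0 ?cabs_ge0 ?expR_ge0//.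
  rewrite ler_wpM2l// ler_wpM2r ?exprn_ge0 ?cabs_ge0//.
  apply: (le_trans hB2); rewrite ler_peMl//; last by lra.
  by rewrite mulr_ge0 ?expR_ge0// divr_ge0 ?exprn_ge0// ltW.
- by rewrite RintegralZl// -/M (_ : 2 * _ = C * cabs h ^+ 2)// /C; ring.
Qed.

(** With e half the distance from Re p to a, the weight e^(Re p B + e |B|) is at most the sum of the
    weights with exponents Re p + e and Re p - e, both of which exceed a. The case B = ln is the
    Mellin transform. *)
Lemma mellin_diff (A : T -> R[i]) (B : T -> R) (a : R) :
  cmeas D A -> measurable_fun D B ->
  (forall s, a < s -> rintegrable mu D (fun x => cabs (A x) * expR (s * B x))) ->
  forall p, a < Re p ->
  cdiff (fun p => Cintegral mu D (fun x => A x * Cexp (p * (B x)%:C))) p.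
Proof.
move=> mA mB ig p ap.
pose e := (Re p - a) / 2; have e0 : 0 < e by rewrite divr_gt0 ?subr_gt0.
apply: (mellin_diff_at e0) => //.
have i1 : rintegrable mu D (fun x => cabs (A x) * expR ((Re p + e) * B x)) by apply: ig; lra.
have i2 : rintegrable mu D (fun x => cabs (A x) * expR ((Re p - e) * B x)) by apply: ig;
  rewrite /e; lra.
apply: (le_rintegrable mD _ _ (rintegrableD mD i1 i2)).
  have /integrableP[/measurable_EFinP mi _] := i1.
  under eq_fun => x.
    rewrite (_ : _ * _ = (cabs (A x) * expR ((Re p + e) * B x)) * (expR (- ((Re p + e) * B x)) *
      expR (Re p * B x + e * `|B x|))); last first.
      by rewrite -mulrA (mulrA (expR _)) -expRD subrr expR0 mul1r.
    over.
  apply: measurable_funM => //; apply: measurable_funM; apply: measurableT_comp => //.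
    by apply: measurableT_comp => //; exact: measurable_funM.
  apply: measurable_funD; apply: measurable_funM => //; exact: measurableT_comp.
move=> x _; rewrite ger0_norm ?mulr_ge0 ?cabs_ge0 ?expR_ge0//.
rewrite -mulrDr ler_wpM2l ?cabs_ge0//.
have [B0|B0] := lerP 0 (B x).
  by rewrite (ger0_norm B0) -[_ * _ + _]mulrDl lerDl expR_ge0.
by rewrite (ltr0_norm B0) mulrN -mulNr -[_ * _ + _]mulrDl lerDr expR_ge0.
Qed.

Lemma cderiv_under_integral (f df : R -> T -> R[i]) (a u v : R) (g : T -> R) :
  u < a < v ->
  (forall t, u < t < v -> Cintegrable mu D (f t)) ->
  (forall t x, u < t < v -> D x -> cderiv (f^~ x) t (df t x)) ->
  (forall x, 0 <= g x) -> rintegrable mu D g ->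
  (forall t x, u < t < v -> D x -> cabs (df t x) <= g x) ->
  cderiv (fun t => Cintegral mu D (f t)) a (Cintegral mu D (df a)).
Proof.
move=> ha hi hd g0 ig hg.
have aI : `]u, v[%classic a by rewrite /= in_itv.
split => /=.
- have h1 t : `]u, v[%classic t -> mu.-integrable D (EFin \o (fun x => Re (f t x))).
    by rewrite /= in_itv /= => /hi[].
  have h2 (t : R) x : `]u, v[%classic t -> D x -> is_derive t 1 (fun t => Re (f t x)) (Re (df t x)).
    by rewrite /= in_itv /= => tI Dx; exact: (hd _ _ tI Dx).1.
  have h3 (t : R) x : `]u, v[%classic t -> D x -> derivable (fun t => Re (f t x)) t 1.
    by move=> tI Dx; case: (h2 _ _ tI Dx).
  have e2 (t : R) x : `]u, v[%classic t -> D x ->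
     partial1of2 (fun t x => Re (f t x)) t x = Re (df t x).
    by move=> tI Dx; rewrite partial1of2E; case: (h2 _ _ tI Dx).
  have h4 t x : `]u, v[%classic t -> D x -> `|partial1of2 (fun t x => Re (f t x)) t x| <= g x.
    move=> tI Dx; rewrite e2//; apply: le_trans (Re_le_cabs _) _; exact: hg.
  apply: DeriveDef; first exact: (derivable_under_integral mD aI h1 h3 g0 ig h4).
  rewrite -derive1E (differentiation_under_integral mD aI h1 h3 g0 ig h4).
  by apply: eq_Rintegral => x xD; rewrite e2//; exact: set_mem.
- have h1 t : `]u, v[%classic t -> mu.-integrable D (EFin \o (fun x => Im (f t x))).
    by rewrite /= in_itv /= => /hi[].
  have h2 (t : R) x : `]u, v[%classic t -> D x -> is_derive t 1 (fun t => Im (f t x)) (Im (df t x)).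
    by rewrite /= in_itv /= => tI Dx; exact: (hd _ _ tI Dx).2.
  have h3 (t : R) x : `]u, v[%classic t -> D x -> derivable (fun t => Im (f t x)) t 1.
    by move=> tI Dx; case: (h2 _ _ tI Dx).
  have e2 (t : R) x : `]u, v[%classic t -> D x ->
     partial1of2 (fun t x => Im (f t x)) t x = Im (df t x).
    by move=> tI Dx; rewrite partial1of2E; case: (h2 _ _ tI Dx).
  have h4 t x : `]u, v[%classic t -> D x -> `|partial1of2 (fun t x => Im (f t x)) t x| <= g x.
    move=> tI Dx; rewrite e2//; apply: le_trans (Im_le_cabs _) _; exact: hg.
  apply: DeriveDef; first exact: (derivable_under_integral mD aI h1 h3 g0 ig h4).
  rewrite -derive1E (differentiation_under_integral mD aI h1 h3 g0 ig h4).
  by apply: eq_Rintegral => x xD; rewrite e2//; exact: set_mem.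
Qed.

End ParametricIntegrals.

Lemma cderiv0_cst (R : realType) (f : R -> R[i]) : (forall t, cderiv f t 0) ->
  forall s t, f s = f t.
Proof.
move=> h s t; apply: eqc.
- by apply: (@is_derive_0_is_cst _ (fun t => Re (f t))) => u; exact: (h u).1.
- by apply: (@is_derive_0_is_cst _ (fun t => Im (f t))) => u; exact: (h u).2.
Qed.

(** * Calculus on the half-line *)

Section HalfLineCalculus.
Variable R : realType.
Local Notation L := (@lebesgue_measure R).
Implicit Types (f df : R -> R) (x : R).

Lemma is_derive_continuous f x (l : R) : is_derive x 1 f l -> {for x, continuous f}.
Proof. by case=> h _; apply: differentiable_continuous; apply/derivable1_diffP. Qed.

Section Exhaustion.
Variables (a_ b_ : nat -> R).
Hypothesis a_gt0 : forall n, 0 < a_ n.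
Hypothesis a_lt_b : forall n, a_ n < b_ n.
Hypothesis a_noninc : forall m n, (m <= n)%N -> a_ n <= a_ m.
Hypothesis b_nondec : forall m n, (m <= n)%N -> b_ m <= b_ n.
Let E := \bigcup_n `[a_ n, b_ n]%classic.

Variables (f df : R -> R).
Hypothesis f_der : forall x, 0 < x -> is_derive x 1 f (df x).
Hypothesis df_cont : forall x, 0 < x -> {for x, continuous df}.

Let F_pos n x : `[a_ n, b_ n]%classic x -> 0 < x.
Proof. by rewrite /= in_itv /= => /andP[h _]; exact: lt_le_trans h. Qed.

Let ftc_F n : (\int[L]_(x in `[a_ n, b_ n]) (df x)%:E = (f (b_ n) - f (a_ n))%:E)%E.
Proof.
rewrite (@continuous_FTC2 R df f)//.
- apply: continuous_in_subspaceT => x; rewrite inE => /F_pos; exact: df_cont.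
- split.
  + move=> x; rewrite in_itv /= => /andP[ax _].
    by case: (f_der (lt_trans (a_gt0 n) ax)).
  + apply: cvg_at_right_filter; exact: is_derive_continuous (f_der (a_gt0 n)).
  + apply: cvg_at_left_filter; apply: is_derive_continuous (f_der _).
    exact: lt_trans (a_lt_b n).
- move=> x; rewrite in_itv /= => /andP[ax _]; rewrite derive1E.
  by case: (f_der (lt_trans (a_gt0 n) ax)).
Qed.

Let F_nd m n : (m <= n)%N -> `[a_ m, b_ m]%classic `<=` `[a_ n, b_ n]%classic.
Proof.
move=> mn x; rewrite /= !in_itv /= => /andP[h1 h2].
by rewrite (le_trans (a_noninc mn) h1) (le_trans h2 (b_nondec mn)).
Qed.

Lemma exhaustion_measurable : measurable E.
Proof. by apply: bigcup_measurable => n _; exact: measurable_itv. Qed.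

(** On each compact interval the integral is an increment of the primitive f; a common bound M on
    these increments passes to the union by monotone convergence. *)
Lemma ftc_integrable (M : R) : measurable_fun E df -> (forall x, 0 < x -> 0 <= df x) ->
  (forall n, f (b_ n) - f (a_ n) <= M) -> rintegrable L E df.
Proof.
move=> mdf df0 fM; apply/integrableP; split; first exact/measurable_EFinP.
have c : (\int[L]_(x in `[a_ n, b_ n]) (df x)%:E)%E @[n --> \oo] --> (\int[L]_(x in E) (df x)%:E)%E.
  apply: ge0_nondecreasing_set_cvg_integral.
  - by move=> m n mn; rewrite subsetEset; exact: F_nd.
  - by move=> n; exact: measurable_itv.
  - move=> n; apply/measurable_EFinP; apply: measurable_funS mdf;
    first exact: exhaustion_measurable.
    by move=> x Fx; exists n.
  - by move=> n x /F_pos x0; rewrite lee_fin df0.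
move: c; under eq_fun do rewrite ftc_F; move=> c.
apply: (@le_lt_trans _ _ M%:E); last exact: ltry.
have -> : (\int[L]_(x in E) `|(EFin \o df) x| = \int[L]_(x in E) (df x)%:E)%E.
  apply: eq_integral => x; rewrite inE => -[n _ /F_pos x0].
  by rewrite gee0_abs// lee_fin df0.
rewrite -(cvg_lim _ c)//; apply: lime_le; first by apply/cvg_ex; eexists; exact: c.
by apply: nearW => n; rewrite lee_fin.
Qed.

(** Dominated convergence for the truncations of [df] to the compact intervals, with |df| as
    dominating function. *)
Lemma ftc_limit (l : R) : rintegrable L E df ->
  (fun n => f (b_ n) - f (a_ n)) @ \oo --> l -> \int[L]_(x in E) df x = l.
Proof.
move=> idf cf.
have /integrableP[/measurable_EFinP mdf _] := idf.
pose F n := `[a_ n, b_ n]%classic : set R.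
have mF n : measurable (F n) by exact: measurable_itv.
have c : (fun n => \int[L]_(x in E) (df \_ (F n)) x) @ \oo --> \int[L]_(x in E) df x.
  apply: (@Rintegral_dominated _ _ _ L E exhaustion_measurable _ _ (fun x => `|df x|)) => //;
    last 2 first.
  - exact: (integrable_norm idf).
  - by move=> n x _ /=; rewrite patchE; case: ifPn => // _; rewrite normr0.
  - move=> n; apply: (measurable_restrict _ (mF n) exhaustion_measurable).1.
    by apply: measurable_funS mdf; [exact: exhaustion_measurable|exact: subIsetl].
  - move=> x [m _ Fmx]; apply: cvg_near_cst; exists m => // n /= mn.
    by rewrite patchE mem_set//; exact: F_nd mn _ Fmx.
have e n : \int[L]_(x in E) (df \_ (F n)) x = f (b_ n) - f (a_ n).
  rewrite -Rintegral_mkcondr (_ : E `&` F n = F n); last first.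
    by apply/setIidPr => x Fx; exists n.
  by rewrite /Rintegral ftc_F.
move: c; under eq_fun do rewrite e; move=> c.
by apply: (cvg_unique _ c cf).
Qed.

End Exhaustion.

(** The endpoints e^(-(n+1)) turn a bound by x^a into a geometric sequence. The shifts n + 1 and n +
    2 make all the intervals non-degenerate. *)
Let a1 (n : nat) : R := expR (- n.+1%:R).
Let b1 (n : nat) : R := 1.
Let a2 (n : nat) : R := 1.
Let b2 (n : nat) : R := n.+2%:R.

Let a1_gt0 n : 0 < a1 n. Proof. exact: expR_gt0. Qed.
Let a1b1 n : a1 n < b1 n. Proof. by rewrite expR_lt1 oppr_lt0. Qed.
Let a1_ni m n : (m <= n)%N -> a1 n <= a1 m.
Proof. by move=> mn; rewrite ler_expR lerN2 ler_nat. Qed.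
Let b1_nd m n : (m <= n)%N -> b1 m <= b1 n. Proof. by []. Qed.
Let a2_gt0 n : 0 < a2 n. Proof. by []. Qed.
Let a2b2 n : a2 n < b2 n. Proof. by rewrite ltr1n. Qed.
Let a2_ni m n : (m <= n)%N -> a2 n <= a2 m. Proof. by []. Qed.
Let b2_nd m n : (m <= n)%N -> b2 m <= b2 n.
Proof. by move=> mn; rewrite ler_nat. Qed.

Lemma exhaustion01 : \bigcup_n `[a1 n, b1 n]%classic = `]0, 1]%classic.
Proof.
apply/seteqP; split => x /=.
  by move=> [n _]; rewrite /= !in_itv /= => /andP[h ->]; rewrite (lt_le_trans (a1_gt0 n) h).
rewrite in_itv /= => /andP[x0 x1].
have h : 0 <= - ln x by rewrite oppr_ge0 ln_le0.
exists (Num.bound (- ln x)) => //=; rewrite in_itv /= x1 andbT.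
rewrite -[leRHS]lnK ?posrE// ler_expR lerNl.
by apply: le_trans (ltW (archi_boundP h)) _; rewrite ler_nat.
Qed.

Lemma exhaustion1y : \bigcup_n `[a2 n, b2 n]%classic = `[1, +oo[%classic.
Proof.
apply/seteqP; split => x /=.
  by move=> [n _]; rewrite /= !in_itv /= andbT => /andP[].
rewrite in_itv /= andbT => x1.
exists (Num.bound x) => //=; rewrite in_itv /= [a2 _ <= x]x1 /=.
have h := archi_boundP (le_trans ler01 x1).
by apply: le_trans (ltW h) _; rewrite ler_nat -addn2 leq_addr.
Qed.

Lemma is_derive_ln_lin (s x : R) : 0 < x ->
  is_derive x 1 (fun t => expR (s * ln t)) (s * (x^-1 * expR (s * ln x))).
Proof.
move=> x0; have h1 := is_derive1_ln x0.
have h2 : is_derive x 1 (fun t => s * ln t) (s * x^-1).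
  by have := is_deriveZ s h1; rewrite /GRing.scale.
have h3 : is_derive x 1 (expR \o (fun t => s * ln t)) (expR (s * ln x) * (s * x^-1)).
  exact: is_derive1_comp.
by apply: (is_derive_eq h3); ring.
Qed.

Lemma measurable_lnpow (s : R) (D : set R) : measurable_fun D (fun x => expR (s * ln x)).
Proof.
apply: (@measurable_funTS _ _ _ _ D); apply: measurableT_comp => //.
by apply: measurable_funM => //; exact: measurable_ln.
Qed.

(** The identity 1/x = x e^(-ln(x^2)) holds for x != 0 of either sign, and at 0 both sides are 0 by
    convention. *)
Lemma measurable_inv (D : set R) : measurable_fun D (fun x : R => x^-1).
Proof.
apply: (@measurable_funTS _ _ _ _ D).
rewrite [X in measurable_fun _ X](_ : _ = fun x : R => x * expR (- ln (x * x))).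
  apply: measurable_funM => //; apply: measurableT_comp => //; apply: measurableT_comp => //.
  by apply: measurableT_comp; [exact: measurable_ln|exact: measurable_funM].
apply/funext => x; have [->|x0] := eqVneq x 0; first by rewrite invr0 mul0r.
rewrite expRN lnK; last by rewrite posrE -expr2 exprn_even_gt0.
by rewrite invfM mulrA mulfV// mul1r.
Qed.

Lemma lnpow_cont (s x : R) : 0 < x ->
  {for x, continuous (fun t : R => s * (t^-1 * expR (s * ln t)))}.
Proof.
move=> x0; have h := is_derive_ln_lin s x0.
apply: cvgM; first exact: cvg_cst.
apply: cvgM; first by apply: cvgV; [rewrite gt_eqF|exact: cvg_id].
exact: is_derive_continuous h.
Qed.

Lemma integrable_lnpow01 (s : R) : 0 < s ->
  rintegrable L `]0, 1]%classic (fun x => x^-1 * expR (s * ln x)).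
Proof.
move=> s0.
have h : rintegrable L `]0, 1]%classic (fun x => s * (x^-1 * expR (s * ln x))).
  rewrite -exhaustion01.
  apply: (@ftc_integrable a1 b1 a1_gt0 a1b1 a1_ni b1_nd (fun x => expR (s * ln x)) _ _ _ 1).
  - by move=> x; exact: is_derive_ln_lin.
  - by move=> x; exact: lnpow_cont.
  - by apply: measurable_funM => //; apply: measurable_funM;
    [exact: measurable_inv|exact: measurable_lnpow].
  - by move=> x x0; rewrite !mulr_ge0 ?expR_ge0 ?invr_ge0 ?ltW.
  - by move=> n; rewrite ln1 mulr0 expR0 lerBlDr lerDl expR_ge0.
have := @rintegrableZ _ _ _ L _ (measurable_itv `]0, 1]) s^-1 _ h.
by apply: eq_integrable => // x _ /=; rewrite mulKf// gt_eqF.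
Qed.

Lemma ln_le_lin (e x : R) : 0 < e -> 0 < x -> ln x <= e * x - ln e.
Proof.
move=> e0 x0; rewrite lerBrDr addrC -lnM ?posrE//.
have ex0 : 0 < e * x by rewrite mulr_gt0.
rewrite -ler_expR lnK ?posrE//; apply: le_trans (expR_ge1Dx _).
by rewrite lerDr.
Qed.

Lemma lnpow_le_exp (s c : R) : 0 < c -> exists2 C : R, 0 <= C &
  forall x, 1 <= x -> expR (s * ln x) <= C * expR (c * x).
Proof.
(* k dominates s and stays positive when s = 0; multiplying ln x <= (c / k) x - ln (c / k) by k
   gives slope exactly c. *)
move=> c0; pose k := `|s| + 1; have k0 : 0 < k by rewrite ltr_wpDl.
exists (expR (- (k * ln (c / k)))); first exact: expR_ge0.
move=> x x1; rewrite -expRD ler_expR.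
have x0 : 0 < x := lt_le_trans ltr01 x1.
have lx : 0 <= ln x by exact: ln_ge0.
apply: (@le_trans _ _ (k * ln x)).
  by rewrite ler_wpM2r// (le_trans (ler_norm s))// lerDl.
have ck0 : 0 < c / k by rewrite divr_gt0.
have := ler_wpM2l (ltW k0) (ln_le_lin ck0 x0).
rewrite mulrBr [k * (c / k * x)]mulrA [k * (c / k)]mulrCA divff ?gt_eqF// mulr1.
by rewrite addrC.
Qed.

Lemma integrable_exp1y (c : R) : 0 < c ->
  rintegrable L `[1, +oo[%classic (fun x => expR (- (c * x))).
Proof.
move=> c0.
have d x : is_derive x 1 (fun t => - (c^-1 * expR (- (c * t)))) (expR (- (c * x))).
  have h2 : is_derive x 1 (fun t : R => - (c * t)) (- (c * 1)).
    by apply: is_deriveN; apply: (is_deriveZ c (is_derive_id x 1)).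
  have h3 : is_derive x 1 (expR \o (fun t : R => - (c * t))) (expR (- (c * x)) * - (c * 1)).
    exact: is_derive1_comp.
  have h4 := is_deriveN (is_deriveZ c^-1 h3).
  apply: (is_derive_eq h4); rewrite /GRing.scale /= mulr1 mulrN mulrN opprK mulrCA mulVf ?mulr1//
    gt_eqF//.
rewrite -exhaustion1y.
apply: (@ftc_integrable a2 b2 a2_gt0 a2b2 a2_ni b2_nd
  (fun t => - (c^-1 * expR (- (c * t)))) _ _ _ (c^-1 * expR (- (c * 1)))).
- move=> x _; apply: (@continuous_comp _ _ _ (fun t => - (c * t)) expR);
  last exact: continuous_expR.
  by apply: cvgN; apply: cvgM; [exact: cvg_cst|exact: cvg_id].
- by apply: measurableT_comp => //; apply: measurableT_comp => //; apply: measurable_funM.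
- by move=> x _; exact: expR_ge0.
- move=> n; rewrite opprK addrC lerBlDr lerDl mulr_ge0 ?expR_ge0 ?invr_ge0//; exact: ltW.
Qed.

(** Half of the exponential decay absorbs the power of x, the other half remains for
    integrability. *)
Lemma integrable_lnpow1y (s c : R) : 0 < c ->
  rintegrable L `[1, +oo[%classic (fun x => x^-1 * expR (s * ln x) * expR (- (c * x))).
Proof.
move=> c0; have c20 : 0 < c / 2 by rewrite divr_gt0.
have [C C0 hC] := lnpow_le_exp s c20.
have iC := @rintegrableZ _ _ _ L _ (measurable_itv `[1, +oo[) C _ (integrable_exp1y c20).
apply: (@le_rintegrable _ _ _ L _ (measurable_itv `[1, +oo[) _ _ _ _ iC).
  apply: measurable_funM; last by apply: measurableT_comp => //; apply: measurableT_comp => //;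
    apply: measurable_funM.
  by apply: measurable_funM; [exact: measurable_inv|exact: measurable_lnpow].
move=> x; rewrite /= in_itv /= andbT => x1.
have x0 : 0 < x := lt_le_trans ltr01 x1.
rewrite ger0_norm ?mulr_ge0 ?expR_ge0 ?invr_ge0 ?(ltW x0)//.
apply: (@le_trans _ _ (1 * (C * expR (c / 2 * x)) * expR (- (c * x)))).
  rewrite ler_wpM2r ?expR_ge0// ler_pM ?expR_ge0 ?invr_ge0 ?(ltW x0)//; last exact: hC.
  by rewrite invf_le1.
by rewrite mul1r -mulrA -expRD ler_wpM2l// ler_expR; lra.
Qed.

(** The bound C x^a with a > 0 kills the boundary term at 0. Differentiability of [df] supplies the
    continuity that the fundamental theorem of calculus asks for. *)
Lemma cftc01 (f df : R -> R[i]) (a C : R) : 0 < a ->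
  (forall x, 0 < x -> cderiv f x (df x)) ->
  (forall x, 0 < x -> exists l, cderiv df x l) ->
  (forall x, 0 < x <= 1 -> cabs (f x) <= C * expR (a * ln x)) ->
  Cintegrable L `]0, 1]%classic df -> Cintegral L `]0, 1]%classic df = f 1.
Proof.
move=> a0 hf hdf fb [i1 i2].
have cl : (fun n => cabs (f (a1 n))) @ \oo --> 0.
  have c0 : (fun n => C * (expR (- a) * expR (- a) ^+ n)) @ \oo --> C * (expR (- a) * 0).
    apply: cvgM; first exact: cvg_cst.
    apply: cvgM; first exact: cvg_cst.
    by apply: cvg_expr; rewrite ger0_norm ?expR_ge0// expR_lt1 oppr_lt0.
  rewrite !mulr0 in c0; apply: squeeze_cvgr (cvg_cst 0) c0; apply: nearW => n.
  apply/andP; split; first exact: cabs_ge0.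
  have /fb : 0 < a1 n <= 1 by rewrite a1_gt0 ltW// a1b1.
  by rewrite expRK mulrN -mulNr -exprS -expRM_natr.
have [cR cI] := cabs_cvg0 cl.
have gen (p : R[i] -> R) : (forall x, 0 < x -> is_derive x 1 (fun t => p (f t)) (p (df x))) ->
   (forall x, 0 < x -> exists l : R, is_derive x 1 (fun t => p (df t)) l) ->
   rintegrable L `]0, 1]%classic (fun t => p (df t)) -> (fun n => p (f (a1 n))) @ \oo --> 0 ->
   \int[L]_(x in `]0, 1]) p (df x) = p (f 1).
  move=> h1 h2 h3 h4; rewrite -exhaustion01.
  apply: (@ftc_limit a1 b1 a1_gt0 a1b1 a1_ni b1_nd (fun t => p (f t))) => //.
  - by move=> x /h2[l]; exact: is_derive_continuous.
  - by rewrite exhaustion01.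
  - by rewrite -[X in _ --> X]subr0; apply: cvgB h4; rewrite /b1; exact: cvg_cst.
rewrite /Cintegral; apply: eqc => /=.
- apply: gen => //; first by move=> x /hf[].
  by move=> x /hdf[l [h _]]; exists (Re l).
- apply: gen => //; first by move=> x /hf[].
  by move=> x /hdf[l [_ h]]; exists (Im l).
Qed.

Lemma cftc1y (f df : R -> R[i]) (C : R) :
  (forall x, 0 < x -> cderiv f x (df x)) ->
  (forall x, 0 < x -> exists l, cderiv df x l) ->
  (forall x, 1 <= x -> cabs (f x) <= C / x) ->
  Cintegrable L `[1, +oo[%classic df -> Cintegral L `[1, +oo[%classic df = - f 1.
Proof.
move=> hf hdf fb [i1 i2].
have cl : (fun n => cabs (f (b2 n))) @ \oo --> 0.
  have c0 : (fun n => C * n.+2%:R^-1) @ \oo --> C * 0.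
    apply: cvgM; first exact: cvg_cst.
    by have := (@cvg_harmonic R); rewrite -(cvg_shiftn 1); under eq_fun do rewrite addn1.
  rewrite mulr0 in c0; apply: squeeze_cvgr (cvg_cst 0) c0; apply: nearW => n.
  by apply/andP; split; [exact: cabs_ge0|rewrite fb// ler1n].
have [cR cI] := cabs_cvg0 cl.
have gen (p : R[i] -> R) : (forall x, 0 < x -> is_derive x 1 (fun t => p (f t)) (p (df x))) ->
   (forall x, 0 < x -> exists l : R, is_derive x 1 (fun t => p (df t)) l) ->
   rintegrable L `[1, +oo[%classic (fun t => p (df t)) -> (fun n => p (f (b2 n))) @ \oo --> 0 ->
   \int[L]_(x in `[1, +oo[) p (df x) = - p (f 1).
  move=> h1 h2 h3 h4; rewrite -exhaustion1y.
  apply: (@ftc_limit a2 b2 a2_gt0 a2b2 a2_ni b2_nd (fun t => p (f t))) => //.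
  - by move=> x /h2[l]; exact: is_derive_continuous.
  - by rewrite exhaustion1y.
  - rewrite -[X in _ --> X]add0r; apply: cvgB; [exact: h4|rewrite /a2; exact: cvg_cst].
rewrite /Cintegral; apply: eqc; rewrite ?ReN ?ImN /=.
- apply: gen => //; first by move=> x /hf[].
  by move=> x /hdf[l [h _]]; exists (Re l).
- apply: gen => //; first by move=> x /hf[].
  by move=> x /hdf[l [_ h]]; exists (Im l).
Qed.

End HalfLineCalculus.

(** * Mellin transforms *)

Section Mellin.
Variable R : realType.
Local Notation L := (@lebesgue_measure R).
Local Notation D := (`]0, +oo[%classic : set R).
Local Notation I01 := (`]0, 1]%classic : set R).
Local Notation I1y := (`]1, +oo[%classic : set R).
Implicit Types (x : R) (z w : R[i]) (K G : R -> R[i]).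

(** The principal power of a positive real, in the shape [Cexp (z * B x)] to which [mellin_diff]
    applies with B = ln. *)
Definition cpow x z : R[i] := Cexp (z * (ln x)%:C).

Lemma cpowD x z w : cpow x (z + w) = cpow x z * cpow x w.
Proof. by rewrite /cpow mulrDl CexpD. Qed.

Lemma cpow_nat x n : 0 < x -> cpow x n%:R = (x ^+ n)%:C.
Proof.
move=> x0; rewrite /cpow natcE -rmorphM CexpR mulr_natl.
by rewrite -lnXn// lnK// posrE exprn_gt0.
Qed.

Lemma cpowD1 x z : 0 < x -> cpow x (z + 1) = x%:C * cpow x z.
Proof. by move=> x0; rewrite cpowD (cpow_nat 1 x0) mulrC. Qed.

Lemma cabs_cpow x z : cabs (cpow x z) = expR (Re z * ln x).
Proof. by rewrite cabs_Cexp mulrC Re_mulR mulrC. Qed.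

Lemma cderiv_cpow x z : 0 < x -> cderiv (cpow ^~ z) x (z * (x^-1)%:C * cpow x z).
Proof.
move=> x0; apply: cderiv_Cexp; apply: cderivZ; apply: cderivR.
exact: is_derive1_ln.
Qed.

Lemma cderiv_inv x : 0 < x -> exists l, cderiv (fun t => (t^-1)%:C) x l.
Proof.
move=> x0; have h : is_derive x 1 (fun y : R => y^-1) (- x ^- 2 *: 1).
  by apply: (@is_deriveV _ id); rewrite ?gt_eqF.
by eexists; apply: cderivR; exact: h.
Qed.

Definition mellin K z := Cintegral L D (fun x => (x^-1)%:C * K x * cpow x z).

(** Order x^a at 0 and exponential decay at infinity: the transform then converges and is analytic
    on Re z > - a. *)
Definition mellin_dominated K (a : R) := cmeas setT K /\ exists C1 C2 c : R,
  [/\ 0 < c, forall x, 0 < x <= 1 -> cabs (K x) <= C1 * expR (a * ln x) &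
     forall x, 1 < x -> cabs (K x) <= C2 * expR (- (c * x))].

Lemma halflineE : D = I01 `|` I1y.
Proof.
apply/seteqP; split => x /=; rewrite !in_itv /= !andbT.
  by move=> x0; case: (lerP x 1) => h; [left; rewrite x0|right].
by move=> [/andP[]//|]; exact: lt_trans.
Qed.

Lemma I01_D : I01 `<=` D. Proof. by rewrite halflineE; exact: subsetUl. Qed.
Lemma I1y_D : I1y `<=` D. Proof. by rewrite halflineE; exact: subsetUr. Qed.

Lemma mellin_dominated_integrable K a s : mellin_dominated K a -> - a < s ->
  rintegrable L D (fun x => cabs ((x^-1)%:C * K x) * expR (s * ln x)).
Proof.
move=> [mK [C1 [C2 [c [c0 h1 h2]]]]] as_.
have sa : 0 < s + a by lra.
have i1 := @Rintegrable_mkcond _ _ _ L _ (measurable_itv `]0, 1]) _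
  (@rintegrableZ _ _ _ L _ (measurable_itv `]0, 1]) C1 _ (integrable_lnpow01 sa)).
have i2 := @Rintegrable_mkcond _ _ _ L _ (measurable_itv `[1, +oo[) _
  (@rintegrableZ _ _ _ L _ (measurable_itv `[1, +oo[) C2 _ (integrable_lnpow1y s c0)).
have i3 := @rintegrableD _ _ _ L _ measurableT _ _ i1 i2.
have i4 := @integrableS _ _ _ L setT D _ measurableT (measurable_itv `]0, +oo[) (@subsetT _ _) i3.
apply: (@le_rintegrable _ _ _ L _ (measurable_itv `]0, +oo[) _ _ _ _ i4).
  apply: measurable_funM; last exact: measurable_lnpow.
  apply: (@measurable_funTS _ _ _ _ D).
  have [mR mI] : cmeas setT (fun x => (x^-1)%:C * K x).
    by apply: cmeasM => //; apply: cmeasR; exact: measurable_inv.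
  rewrite (_ : (fun x : R => _) = fun x => Num.sqrt (Re ((x^-1)%:C * K x) ^+ 2 + Im
    ((x^-1)%:C * K x) ^+ 2)).
    apply: measurableT_comp; first by apply: continuous_measurable_fun => x; exact: sqrt_continuous.
    by apply: measurable_funD; exact: measurable_funX.
  by apply/funext => x; case: (_ * _).
move=> x; rewrite /= in_itv /= andbT => x0.
rewrite ger0_norm ?mulr_ge0 ?cabs_ge0 ?expR_ge0// !indicE.
rewrite cabsM cabsR ger0_norm ?invr_ge0 ?(ltW x0)//.
have [x1|x1] := lerP x 1.
  have hx : x \in I01 by rewrite inE /= in_itv /= x0.
  rewrite hx mul1r; apply: (@le_trans _ _ (C1 * (x^-1 * expR ((s + a) * ln x)))).
    rewrite mulrDl expRD.
    rewrite [leRHS](_ : _ = (x^-1 * (C1 * expR (a * ln x))) * expR (s * ln x)); last by ring.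
    by rewrite ler_wpM2r ?expR_ge0// ler_wpM2l ?invr_ge0 ?(ltW x0)// h1// x0.
  rewrite lerDl mulr_ge0 ?ler0n//.
  (* The sign of C2 is read off its own bound, at the point x = 2. *)
  have : 0 <= C2 * expR (- (c * 2)) by apply: le_trans (h2 2 _); rewrite ?cabs_ge0// ltr1n.
  rewrite pmulr_lge0 ?expR_gt0// => C20.
  by rewrite !mulr_ge0 ?expR_ge0 ?invr_ge0 ?(ltW x0).
have hx : (x \in I01) = false by apply: memNset; rewrite /= in_itv /= x0 /= leNgt x1.
have hx2 : x \in `[1, +oo[%classic by rewrite inE /= in_itv /= andbT ltW.
rewrite hx hx2 mul0r add0r mul1r.
rewrite [leRHS](_ : _ = (x^-1 * (C2 * expR (- (c * x)))) * expR (s * ln x)); last by ring.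
by rewrite ler_wpM2r ?expR_ge0// ler_wpM2l ?invr_ge0 ?(ltW x0)// h2.
Qed.

Lemma cmeas_cpow z (A : set R) : cmeas A (cpow ^~ z).
Proof.
apply: cmeas_Cexp; apply: cmeasM; first exact: cmeas_cst.
by apply: cmeasR; apply: (@measurable_funTS _ _ _ _ A); exact: measurable_ln.
Qed.

Lemma cmeas_integrand K z : cmeas setT K -> 
  cmeas D (fun x => (x^-1)%:C * K x * cpow x z).
Proof.
move=> mK; apply: cmeasM; last exact: cmeas_cpow.
apply: (@cmeasS _ _ _ D setT) => //; apply: cmeasM => //.
by apply: cmeasR; exact: measurable_inv.
Qed.

Lemma mellin_integrable K a z : mellin_dominated K a -> - a < Re z ->
  Cintegrable L D (fun x => (x^-1)%:C * K x * cpow x z).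
Proof.
move=> hK az; have i := mellin_dominated_integrable hK az.
apply: (@Cintegrable_le _ _ _ L _ (measurable_itv `]0, +oo[) _ _ _ _ i).
  by apply: cmeas_integrand; case: hK.
by move=> x _; rewrite cabsM cabs_cpow.
Qed.

Lemma mellin_cdiff K a z : mellin_dominated K a -> - a < Re z -> cdiff (mellin K) z.
Proof.
move=> hK az.
have := @mellin_diff _ _ _ L D (measurable_itv `]0, +oo[) (fun x => (x^-1)%:C * K x) (@ln R) (- a).
apply => //.
- apply: (@cmeasS _ _ _ D setT) => //; apply: cmeasM; last by case: hK.
  by apply: cmeasR; exact: measurable_inv.
- by apply: (@measurable_funTS _ _ _ _ D); exact: measurable_ln.
- by move=> s as_; exact: mellin_dominated_integrable as_.
Qed.

Lemma mellinB K1 K2 a1 a2 z : mellin_dominated K1 a1 -> mellin_dominated K2 a2 ->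
  - a1 < Re z -> - a2 < Re z ->
  mellin (fun x => K1 x - K2 x) z = mellin K1 z - mellin K2 z.
Proof.
move=> h1 h2 z1 z2; rewrite /mellin -(@CintegralB _ _ _ L _ (measurable_itv `]0, +oo[)).
- by apply: eq_Cintegral => x _; ring.
- exact: mellin_integrable h1 z1.
- exact: mellin_integrable h2 z2.
Qed.

Lemma mellin_split K a z : mellin_dominated K a -> - a < Re z ->
  mellin K z = Cintegral L I01 (fun x => (x^-1)%:C * K x * cpow x z) +
               Cintegral L I1y (fun x => (x^-1)%:C * K x * cpow x z).
Proof.
move=> hK az; rewrite /mellin halflineE (@Cintegral_setU _ _ _ L)//.
- rewrite disj_set2E; apply/eqP/seteqP; split => x //=; rewrite !in_itv /= andbT.
  by move=> [/andP[_ h1]]; rewrite ltNge h1.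
- by rewrite -halflineE; exact: mellin_integrable az.
Qed.

Definition taylor (g : nat -> R[i]) N x : R[i] := \sum_(n < N) g n * (x ^+ n)%:C.
(** The Taylor polynomial, of degree less than N, is subtracted on ]0, 1] only, so that the decay of
    G at infinity is preserved. *)
Definition cut G g N x : R[i] := G x - (\1_I01 x)%:C * taylor g N x.
(* When g n are the Taylor coefficients of G at 0, this is for - N < Re z the analytic continuation
   of the Mellin transform of G. *)
Definition mellin_ext G g N z : R[i] := mellin (cut G g N) z + \sum_(n < N) g n / (z + n%:R).

Lemma cut01 G g N x : 0 < x <= 1 -> cut G g N x = G x - taylor g N x.
Proof. by move=> hx; rewrite /cut indicE mem_set ?mul1r//= in_itv. Qed.

Lemma cut1y G g N x : 1 < x -> cut G g N x = G x.
Proof.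
move=> hx; rewrite /cut indicE memNset ?mul0r ?subr0//= in_itv /=.
by rewrite leNgt hx andbF.
Qed.

Lemma cmeas_indic : cmeas setT (fun x => (\1_I01 x)%:C : R[i]).
Proof. by apply: cmeasR; apply: measurable_indic; exact: measurable_itv. Qed.

Lemma cmeas_taylor g N : cmeas setT (taylor g N).
Proof.
apply: cmeas_sum => i; apply: cmeasM; first exact: cmeas_cst.
by apply: cmeasR; exact: measurable_funX.
Qed.

Lemma cmeas_cut G g N : cmeas setT G -> cmeas setT (cut G g N).
Proof.
by move=> mG; apply: cmeasB => //; apply: cmeasM; [exact: cmeas_indic|exact: cmeas_taylor].
Qed.

(** The integral of x^(z+n-1) over ]0, 1] is 1 / (z + n): this is the origin of the poles in
    [mellin_ext]. *)
Lemma mellin_monomial (g : R[i]) n z : - n%:R < Re z ->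
  mellin_dominated (fun x => (\1_I01 x)%:C * (g * (x ^+ n)%:C)) n%:R /\
  mellin (fun x => (\1_I01 x)%:C * (g * (x ^+ n)%:C)) z = g / (z + n%:R).
Proof.
move=> nz; set K := fun x => _.
have zn : 0 < Re (z + n%:R) by rewrite ReD Re_nat; lra.
have zn0 : z + n%:R != 0 by apply: contraTneq zn => ->; rewrite ltxx.
have hK : mellin_dominated K n%:R.
  split.
    apply: cmeasM; first exact: cmeas_indic.
    by apply: cmeasM; [exact: cmeas_cst|apply: cmeasR; exact: measurable_funX].
  exists (cabs g), 0, 1; split => //.
    move=> x /andP[x0 x1]; rewrite /K indicE mem_set ?mul1r//= ?in_itv /= ?x0//.
    rewrite cabsM cabsR ger0_norm ?exprn_ge0 ?(ltW x0)// ler_wpM2l ?cabs_ge0//.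
    by rewrite mulr_natl -lnXn// lnK// posrE exprn_gt0.
  move=> x x1; rewrite /K indicE memNset; last by rewrite /= in_itv /= [x <= 1]leNgt x1 andbF.
  by rewrite mul0r cabs0 mul0r.
split => //; rewrite (mellin_split hK nz).
have -> : Cintegral L I1y (fun x => (x^-1)%:C * K x * cpow x z) = 0.
  rewrite -[RHS](@Cintegral0 _ _ _ L _ (measurable_itv `]1, +oo[)); apply: eq_Cintegral => x;
    rewrite inE /= in_itv /= andbT => x1.
  rewrite /K indicE memNset; last by rewrite /= in_itv /= [x <= 1]leNgt x1 andbF.
  by rewrite !mul0r mulr0 mul0r.
rewrite addr0.
pose f x := g / (z + n%:R) * cpow x (z + n%:R).
pose df x := g * (x^-1)%:C * cpow x (z + n%:R).
have e : Cintegral L I01 (fun x => (x^-1)%:C * K x * cpow x z) = Cintegral L I01 df.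
  apply: eq_Cintegral => x; rewrite inE /= => xI.
  have x0 : 0 < x by move: xI; rewrite in_itv /= => /andP[].
  by rewrite /K /df indicE mem_set// mul1r cpowD cpow_nat//; ring.
rewrite e (@cftc01 _ f df (Re (z + n%:R)) (cabs (g / (z + n%:R))))//.
- by rewrite /f /cpow ln1 mulr0 Cexp0 mulr1.
- move=> x x0; apply: cderiv_eq (cderivZ _ (cderiv_cpow _ x0)) _.
  by rewrite /df -!mulrA mulKf.
- move=> x x0; have [l hl] := cderiv_inv x0; eexists.
  by apply: cderivM (cderiv_cpow _ x0); apply: cderivZ; exact: hl.
- by move=> x _; rewrite /f cabsM cabs_cpow.
- apply: (@eq_Cintegrable _ _ _ L _ (measurable_itv `]0, 1]) (fun x => (x^-1)%:C * K x * cpow x z)).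
    move=> x; rewrite inE /= => xI.
    have x0 : 0 < x by move: xI; rewrite in_itv /= => /andP[].
    by rewrite /K /df indicE mem_set// mul1r cpowD cpow_nat//; ring.
  apply: (@CintegrableS _ _ _ L D (measurable_itv `]0, +oo[)); first exact: measurable_itv.
    exact: I01_D.
  exact: mellin_integrable nz.
Qed.

(** Subtracting one more Taylor term lowers the transform by g N / (z + N), which the finite sum
    gives back. Hence [mellin_ext] does not depend on the level N. *)
Lemma mellin_extS G g N z : mellin_dominated (cut G g N) N%:R -> - N%:R < Re z ->
  mellin_ext G g N.+1 z = mellin_ext G g N z.
Proof.
move=> h hz; have [h1 e1] := mellin_monomial (g N) hz.
rewrite /mellin_ext big_ord_recr /= -e1.
rewrite (_ : mellin (cut G g N.+1) z =
  mellin (fun x => cut G g N x - (\1_I01 x)%:C * (g N * (x ^+ N)%:C)) z).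
  by rewrite (mellinB h h1)//; ring.
apply: eq_Cintegral => x _; congr (_ * _ * _).
by rewrite /cut /taylor big_ord_recr /=; ring.
Qed.

End Mellin.

(** * The Mellin transform of e^(-x w), as a function of z and of w *)

Section GammaFunction.
Variable R : realType.
Local Notation L := (@lebesgue_measure R).
Local Notation D := (`]0, +oo[%classic : set R).
Local Notation I01 := (`]0, 1]%classic : set R).
Local Notation I1y := (`]1, +oo[%classic : set R).
Implicit Types (x : R) (z w : R[i]).

(** The half-line is split into disjoint pieces with ]1, +oo[, whereas exhaustion by compact
    intervals produces [1, +oo[. *)
Lemma integrable_closed_left (f : R -> R) : measurable_fun setT f ->
  rintegrable L I1y f -> rintegrable L `[1, +oo[ f.
Proof.
move=> mf /integrableP[_ fi].
have mf' (A : set R) : measurable_fun A (fun x => `|f x|%:E).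
  apply: (@measurable_funTS _ _ _ _ A); apply/measurable_EFinP.
  by apply: measurableT_comp.
apply/integrableP; split.
  by apply/measurable_funTS/measurable_EFinP.
by rewrite -(integral_itv_obnd_cbnd (mf' _)).
Qed.

Definition expw w x : R[i] := Cexp (x%:C * - w).
Definition expw_coef w n : R[i] := (- w) ^+ n / n`!%:R.

Lemma taylor_expw w N x : taylor (expw_coef w) N x = exp_sum N (x%:C * - w).
Proof.
apply: eq_bigr => i _; rewrite /expw_coef exprMn -rmorphXn /=; ring.
Qed.

Lemma cut_expw01 w N x : 0 < x <= 1 -> cut (expw w) (expw_coef w) N x = exp_rem N (x%:C * - w).
Proof. by move=> hx; rewrite cut01// taylor_expw. Qed.

Lemma cmeas_expw w (A : set R) : cmeas A (expw w).
Proof.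
by apply: cmeas_Cexp; apply: cmeasM; [apply: cmeasR|exact: cmeas_cst].
Qed.

Lemma expw_dominated w N : 0 < Re w ->
  mellin_dominated (cut (expw w) (expw_coef w) N) N%:R.
Proof.
move=> w0; split; first by apply: cmeas_cut; exact: cmeas_expw.
exists (2 ^+ N * cabs w ^+ N * expR (Re w)), 1, (Re w); split => //.
- move=> x hx; rewrite cut_expw01//; case/andP: hx => x0 x1.
  apply: le_trans (le_exp_rem _ _) _.
  rewrite cabsM cabsR cabsN ger0_norm ?(ltW x0)// exprMn.
  rewrite mulr_natl -lnXn// lnK ?posrE ?exprn_gt0//.
  rewrite [leRHS](_ : _ = 2 ^+ N * (x ^+ N * cabs w ^+ N) * expR (Re w)); last by ring.
  rewrite ler_wpM2l ?mulr_ge0 ?exprn_ge0 ?cabs_ge0 ?(ltW x0)// ler_expR.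
  rewrite Re_mulR ReN mulrN normrN ger0_norm ?mulr_ge0 ?(ltW x0) ?(ltW w0)//.
  by rewrite ler_piMl// ltW.
- move=> x x1; rewrite cut1y// mul1r cabs_Cexp Re_mulR ReN mulrN.
  by rewrite mulrC.
Qed.

Lemma exp_rem_cderiv N w x : exists l, cderiv (fun t => exp_rem N (t%:C * w)) x l.
Proof.
case: N => [|N]; last by eexists; apply: cderiv_exp_rem; exact: cderiv_lin.
eexists; apply: cderiv_ext (cderiv_Cexp (cderiv_lin w x)) => t.
by rewrite /exp_rem /exp_sum big_ord0 subr0.
Qed.

(** Integration by parts. The combined integrand has primitive x^z [exp_rem N.+1] (- x w) on ]0, 1],
    of order x^(Re z + N + 1) at 0 and so vanishing there, and primitive x^z e^(-x w) beyond 1,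
    vanishing at infinity. The right-hand side is the jump at x = 1 between the two primitives. *)
Lemma cut_ibp w N z : 0 < Re w -> - N.+1%:R < Re z ->
  z * mellin (cut (expw w) (expw_coef w) N.+1) z -
  w * mellin (cut (expw w) (expw_coef w) N) (z + 1) = - exp_sum N.+1 (- w).
Proof.
move=> w0 Nz.
have h1 := expw_dominated N.+1 w0; have h0 := expw_dominated N w0.
have Nz1 : - N%:R < Re (z + 1) by rewrite ReD /= -natr1 in Nz *; lra.
have i1 := mellin_integrable h1 Nz; have i0 := mellin_integrable h0 Nz1.
pose K x := z * ((x^-1)%:C * cut (expw w) (expw_coef w) N.+1 x * cpow x z) -
   w * ((x^-1)%:C * cut (expw w) (expw_coef w) N x * cpow x (z + 1)).
have iK : Cintegrable L D K.
  apply: (@CintegrableB _ _ _ L _ (measurable_itv `]0, +oo[));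
    by apply: (@CintegrableZ _ _ _ L _ (measurable_itv `]0, +oo[)).
have -> : z * mellin (cut (expw w) (expw_coef w) N.+1) z -
  w * mellin (cut (expw w) (expw_coef w) N) (z + 1) = Cintegral L D K.
  rewrite (@CintegralB _ _ _ L _ (measurable_itv `]0, +oo[)).
  - by rewrite !(@CintegralZ _ _ _ L _ (measurable_itv `]0, +oo[)).
  - exact: (@CintegrableZ _ _ _ L _ (measurable_itv `]0, +oo[)).
  - exact: (@CintegrableZ _ _ _ L _ (measurable_itv `]0, +oo[)).
rewrite halflineE in iK *.
have iK1 : Cintegrable L I01 K.
  apply: (@CintegrableS _ _ _ L D (measurable_itv `]0, +oo[)); first exact: measurable_itv.
    exact: I01_D.
  by rewrite halflineE.
have iK2 : Cintegrable L I1y K.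
  apply: (@CintegrableS _ _ _ L D (measurable_itv `]0, +oo[)); first exact: measurable_itv.
    exact: I1y_D.
  by rewrite halflineE.
rewrite (@Cintegral_setU _ _ _ L)//; last first.
  rewrite disj_set2E; apply/eqP/seteqP; split => x //=; rewrite !in_itv /= andbT.
  by move=> [/andP[_ h]]; rewrite ltNge h.
pose f1 x := cpow x z * exp_rem N.+1 (x%:C * - w).
pose df1 x := cpow x z * (- w * exp_rem N (x%:C * - w)) +
  exp_rem N.+1 (x%:C * - w) * (z * (x^-1)%:C * cpow x z).
have e1 : {in I01, K =1 df1}.
  move=> x; rewrite inE /= in_itv /= => hx; have /andP[x0 _] := hx.
  rewrite /K /df1 !cut_expw01// cpowD1//.
  have xx : (x^-1)%:C * x%:C = 1 :> R[i] by rewrite -rmorphM /= mulVf ?gt_eqF.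
  rewrite [w * _](_ : _ = (x^-1)%:C * x%:C * (w * exp_rem N (x%:C * - w) * cpow x z)); last by ring.
  rewrite xx; ring.
rewrite (@eq_Cintegral _ _ _ L I01 K df1 e1).
rewrite (@cftc01 _ f1 df1 (Re z + N.+1%:R) (2 ^+ N.+1 * cabs w ^+ N.+1 * expR (Re w)))//;
  first last.
- exact: (@eq_Cintegrable _ _ _ L _ (measurable_itv `]0, 1]) K).
- move=> x hx; rewrite /f1 -(cut_expw01 w N.+1 hx) cabsM cabs_cpow.
  case: h1 => _; rewrite cut_expw01//; case/andP: hx => x0 x1 _.
  rewrite mulrDl expRD mulrCA ler_wpM2l ?expR_ge0//.
  apply: le_trans (le_exp_rem _ _) _.
  rewrite cabsM cabsR cabsN ger0_norm ?(ltW x0)// exprMn.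
  rewrite mulr_natl -lnXn// lnK ?posrE ?exprn_gt0//.
  rewrite [leRHS](_ : _ = 2 ^+ N.+1 * (x ^+ N.+1 * cabs w ^+ N.+1) * expR (Re w)); last by ring.
  rewrite ler_wpM2l ?mulr_ge0 ?exprn_ge0 ?cabs_ge0 ?(ltW x0)// ler_expR.
  rewrite Re_mulR ReN mulrN normrN ger0_norm ?mulr_ge0 ?(ltW x0) ?(ltW w0)//.
  by rewrite ler_piMl// ltW.
- move=> x x0; have [l hl] := cderiv_inv x0.
  have [l1 hl1] := exp_rem_cderiv N (- w) x.
  have [l2 hl2] := exp_rem_cderiv N.+1 (- w) x.
  have hc := cderiv_cpow z x0.
  eexists; apply: cderivD.
    by apply: (cderivM hc); apply: cderivZ; exact: hl1.
  by apply: (cderivM hl2); apply: cderivM hc; apply: cderivZ; exact: hl.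
- move=> x x0; apply: cderivM; first exact: cderiv_cpow.
  by apply: cderiv_exp_rem; exact: cderiv_lin.
- by rewrite -natr1 in Nz *; lra.
pose f2 x := cpow x z * expw w x.
pose df2 x := cpow x z * (- w * expw w x) + expw w x * (z * (x^-1)%:C * cpow x z).
have e2 : {in I1y, K =1 df2}.
  move=> x; rewrite inE /= in_itv /= andbT => x1; have x0 := lt_trans ltr01 x1.
  rewrite /K /df2 !cut1y// cpowD1//.
  have xx : (x^-1)%:C * x%:C = 1 :> R[i] by rewrite -rmorphM /= mulVf ?gt_eqF.
  rewrite [w * _](_ : _ = (x^-1)%:C * x%:C * (w * expw w x * cpow x z)); last by ring.
  rewrite xx; ring.
have i2 : Cintegrable L I1y df2 by exact: (@eq_Cintegrable _ _ _ L _ (measurable_itv `]1, +oo[) K).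
have i2' : Cintegrable L `[1, +oo[ df2.
  have [m1 m2] : cmeas setT (fun x => cpow x z * (- w * expw w x) + expw w x *
    (z * (x^-1)%:C * cpow x z)).
    apply: cmeasD; apply: cmeasM.
    - exact: cmeas_cpow.
    - by apply: cmeasM; [exact: cmeas_cst|exact: cmeas_expw].
    - exact: cmeas_expw.
    - apply: cmeasM; last exact: cmeas_cpow.
      by apply: cmeasM; [exact: cmeas_cst|apply: cmeasR; exact: measurable_inv].
  case: i2 => j1 j2; split.
    exact: integrable_closed_left m1 j1.
  exact: integrable_closed_left m2 j2.
have e3 : Cintegral L I1y df2 = Cintegral L `[1, +oo[ df2.
  by rewrite /Cintegral !Rintegral_itv_obnd_cbnd//; case: i2.
(* The exponent Re z + 1 gives x^(Re z) e^(-x Re w) <= C / x, the decay asked by [cftc1y]. *)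
have [C C0 hC] := lnpow_le_exp (Re z + 1) w0.
rewrite (@eq_Cintegral _ _ _ L I1y K df2 e2) e3 (@cftc1y _ f2 df2 C)//; first last.
- move=> x x1; have x0 := lt_le_trans ltr01 x1.
  rewrite /f2 cabsM cabs_cpow cabs_Cexp Re_mulR ReN mulrN.
  have := hC x x1; rewrite mulrDl expRD mul1r lnK ?posrE// => h.
  by rewrite expRN ler_pdivlMr// mulrAC ler_pdivrMr ?expR_gt0// (mulrC x).
- move=> x x0; have [l hl] := cderiv_inv x0.
  have hc := cderiv_cpow z x0; have he := cderiv_Cexp (cderiv_lin (- w) x).
  eexists; apply: cderivD.
    by apply: (cderivM hc); apply: cderivZ; exact: he.
  by apply: (cderivM he); apply: cderivM hc; apply: cderivZ; exact: hl.
- move=> x x0; apply: cderivM; first exact: cderiv_cpow.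
  by apply: cderiv_Cexp; exact: cderiv_lin.
by rewrite /f1 /f2 /cpow ln1 mulr0 Cexp0 !mul1r /exp_rem /expw mul1r; ring.
Qed.

(** The boundary term of [cut_ibp] cancels against the finite sums: with g_n = (-w)^n / n!, the
    relation (n + 1) g_(n+1) = - w g_n gives z g_(n+1) / (z + n + 1) = g_(n+1) + w g_n / (z + 1 +
    n), and the leftover g_n add up to [exp_sum]. *)
Lemma expw_ext_rec w N z : 0 < Re w -> - N.+1%:R < Re z ->
  (forall n : nat, z != - n%:R) ->
  z * mellin_ext (expw w) (expw_coef w) N.+1 z =
  w * mellin_ext (expw w) (expw_coef w) N (z + 1).
Proof.
move=> w0 Nz zn; rewrite /mellin_ext !mulrDr.
have /eqP := cut_ibp w0 Nz; rewrite subr_eq => /eqP ->.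
rewrite -addrA addrCA; congr (_ + _).
rewrite mulr_sumr big_ord_recl /= addr0.
have z0 : z != 0 by have := zn 0; rewrite oppr0.
rewrite mulrCA mulfV// mulr1 /exp_sum big_ord_recl /= opprD addrACA.
rewrite [X in X + _](_ : _ = 0) ?add0r; last by rewrite /expw_coef; ring.
rewrite mulr_sumr -sumrN -big_split /=; apply: eq_bigr => i _.
have zi : z + i.+1%:R != 0 by rewrite addr_eq0 zn.
rewrite /bump /= add1n /expw_coef.
have -> : z + 1 + i%:R = z + i.+1%:R by rewrite -addrA nat1r.
apply: (mulIf zi); rewrite mulrDl -!mulrA !mulVf// !mulr1.
rewrite factS natrM exprS invfM.
have f0 : i.+1%:R != 0 :> R[i] by rewrite pnatr_eq0.
rewrite [LHS](_ : _ = - (- w * (- w) ^+ i) * (i.+1%:R^-1 * i.+1%:R) / i`!%:R); last by ring.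
by rewrite mulVf//; ring.
Qed.

(** The integral of x^(z-1) e^(-x w), with w as the variable of interest: it is Gamma z at w = 1,
    and is to be identified with Gamma(z) w^(-z). *)
Definition Kw z w : R[i] := mellin (expw w) z.

Lemma mellin_ext0 G g z : mellin_ext G g 0 z = mellin G z.
Proof.
rewrite /mellin_ext big_ord0 addr0; apply: eq_Cintegral => x _.
by rewrite /cut /taylor big_ord0 mulr0 subr0.
Qed.

Lemma expw0_dominated w : 0 < Re w -> mellin_dominated (expw w) 0.
Proof.
move=> w0; have := expw_dominated 0 w0; congr mellin_dominated.
by apply/funext => x; rewrite /cut /taylor big_ord0 mulr0 subr0.
Qed.

Lemma Kw_rec z w : 0 < Re z -> 0 < Re w -> z * Kw z w = w * Kw (z + 1) w.
Proof.
move=> z0 w0; rewrite /Kw -!(mellin_ext0 _ (expw_coef w)).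
have zn (n : nat) : z != - n%:R.
  by apply: contraTneq z0 => ->; rewrite ReN Re_nat -leNgt oppr_le0 ler0n.
rewrite -expw_ext_rec//; last by rewrite (lt_trans _ z0)// oppr_lt0.
by rewrite mellin_extS// ?oppr0//; exact: expw_dominated.
Qed.

(** Along w = e^(p s), whose derivative is p' w, differentiation under the integral gives - p' w
    K_(z+1)(w), and [Kw_rec] turns w K_(z+1)(w) into z K_z(w). The uniform bounds c and M provide
    the dominating function M x^(Re z) e^(-c x). *)
Lemma Kw_cderiv z (p : R -> R[i]) (t c M : R) (dq : R -> R[i]) : 0 < Re z -> 0 < c ->
  (forall s, cderiv p s (dq s)) ->
  (forall s, c <= Re (Cexp (p s))) -> (forall s, cabs (dq s * Cexp (p s)) <= M) ->
  cderiv (fun s => Kw z (Cexp (p s))) t (- (dq t) * z * Kw z (Cexp (p t))).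
Proof.
move=> z0 c0 hp hc hM.
pose f s x := (x^-1)%:C * expw (Cexp (p s)) x * cpow x z.
pose df s x := (- (dq s * Cexp (p s))) * ((x^-1)%:C * expw (Cexp (p s)) x * cpow x (z + 1)).
have pos s : 0 < Re (Cexp (p s)) := lt_le_trans c0 (hc s).
have z1 : 0 < Re (z + 1) by rewrite ReD /=; lra.
have e : Cintegral L D (df t) = - (dq t) * z * Kw z (Cexp (p t)).
  rewrite (@CintegralZ _ _ _ L _ (measurable_itv `]0, +oo[)); last first.
    by apply: (mellin_integrable (expw0_dominated (pos t))); rewrite oppr0.
  by rewrite -mulrA Kw_rec// /Kw /mellin; ring.
rewrite -e.
have hcz : 0 < Re c%:C by [].
have i0 := mellin_dominated_integrable (expw0_dominated hcz) (_ : - 0 < Re (z + 1)).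
rewrite oppr0 in i0; have i1 := @rintegrableZ _ _ _ L _ (measurable_itv `]0, +oo[) M _ (i0 z1).
apply: (@cderiv_under_integral _ _ _ L D (measurable_itv `]0,
  +oo[) f df t (t - 1) (t + 1) _ _ _ _ _ i1).
- by apply/andP; split; lra.
- move=> s _; apply: (mellin_integrable (expw0_dominated (pos s))); by rewrite oppr0.
- move=> s x _; rewrite /= in_itv /= andbT => x0.
  have h1 := cderiv_Cexp (cderivZ x%:C (cderivN (cderiv_Cexp (hp s)))).
  have h2 := cderivZ ((x^-1)%:C * cpow x z) h1.
  apply: cderiv_eq (cderiv_ext _ h2) _; first by move=> u; rewrite /f /expw; ring.
  by rewrite /df /expw cpowD1//; ring.
- move=> x; have M0 : 0 <= M by apply: le_trans (hM 0); exact: cabs_ge0.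
  by rewrite !mulr_ge0 ?cabs_ge0 ?expR_ge0.
- move=> s x _ Dx; have x0 : 0 < x by move: Dx; rewrite /= in_itv /= andbT.
  rewrite /df [cabs (- _ * _)]cabsM cabsN ler_pM ?cabs_ge0//.
  rewrite [cabs (_ * cpow _ _)]cabsM cabs_cpow ler_wpM2r ?expR_ge0//.
  rewrite !cabsM ler_wpM2l ?cabs_ge0// !cabs_Cexp ler_expR !Re_mulR !ReN !mulrN lerN2.
  by rewrite ler_wpM2l ?(ltW x0)//= hc.
Qed.

Lemma Re_norm w : Re `|w| = cabs w.
Proof. by rewrite cabsE. Qed.

Lemma Re_Cexp w : Re (Cexp w) = expR (Re w) * cos (Im w). Proof. by []. Qed.
Lemma Re_Clog w : Re (Clog w) = ln (cabs w). Proof. by rewrite -Re_norm. Qed.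

Lemma CexpClog w : w != 0 -> Cexp (Clog w) = w.
Proof.
move=> w0; have c0 : 0 < cabs w by rewrite cabs_gt0.
rewrite /Cexp /Clog /Carg !Re_norm [Re (_ +i* _)]/= [Im (_ +i* _)]/= lnK ?posrE//.
set u := Re w / cabs w.
have u1 : -1 <= u <= 1.
  rewrite -ler_norml normrM normfV (gtr0_norm c0) ler_pdivrMr// mul1r.
  exact: Re_le_cabs.
have cu : cos (acos u) = u by rewrite acosK// in_itv.
have hc : cabs w * u = Re w by rewrite /u mulrC divfK// gt_eqF.
have cw : cabs w ^+ 2 = Re w ^+ 2 + Im w ^+ 2.
  by case: w {w0 c0 u u1 cu hc} => a b /=; rewrite sqr_sqrtr// addr_ge0// sqr_ge0.
have hs : cabs w * sin (acos u) = `|Im w|.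
  rewrite sin_acos// -{1}(ger0_norm (ltW c0)) -sqrtr_sqr -sqrtrM ?sqr_ge0//.
  rewrite mulrBr mulr1 -exprMn hc cw [X in Num.sqrt X](_ : _ = Im w ^+ 2); last by ring.
  by rewrite sqrtr_sqr.
apply: eqc => /=.
  by case: ifP => _; rewrite ?cosN cu.
case: ifPn => [I0|]; first by rewrite hs ger0_norm.
by rewrite -ltNge => I0; rewrite sinN mulrN hs ltr0_norm// opprK.
Qed.

(** The argument of w^s is s times that of w, so for |s| <= 1 its cosine is at least Re w / |w|, and
    |w|^s >= e^(-|ln |w||). A path of such powers stays in a half-plane Re >= c, as [Kw_cderiv]
    requires. *)
Lemma Re_Cexp_scaled_Clog w : 0 < Re w -> exists2 c : R, 0 < c &
  forall s, -1 <= s <= 1 -> c <= Re (Cexp (s%:C * Clog w)).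
Proof.
move=> w0; have wn : w != 0 by apply: contraTneq w0 => ->; rewrite ltxx.
have c0 : 0 < cabs w by rewrite cabs_gt0.
set u := Re w / cabs w; have u0 : 0 < u by rewrite divr_gt0.
have u1 : -1 <= u <= 1.
  rewrite -ler_norml normrM normfV (gtr0_norm c0) ler_pdivrMr// mul1r.
  exact: Re_le_cabs.
have [/andP[a0 a1] cu] := acos_def u1.
exists (expR (- `|ln (cabs w)|) * u); first by rewrite mulr_gt0 ?expR_gt0.
move=> s hs; have s1 : `|s| <= 1 by rewrite ler_norml.
rewrite Re_Cexp Re_mulR Im_mulR Re_Clog ler_pM ?expR_ge0 ?(ltW u0)//.
  rewrite ler_expR lerNl; apply: le_trans (ler_norm _) _.
  by rewrite normrN normrM ler_piMl.
rewrite [Im (Clog w)]/= /Carg Re_norm -/u.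
have -> : cos (s * (if 0 <= Im w then acos u else - acos u)) = cos (`|s| * acos u).
  have e1 : cos (s * acos u) = cos (`|s| * acos u).
    by case: (leP 0 s) => h; rewrite ?(ger0_norm h)// ?(ltr0_norm h)// ?mulNr ?cosN.
  by case: ifP => _ //; rewrite mulrN cosN.
rewrite -[leLHS]cu; have [->|sa] := eqVneq (`|s| * acos u) (acos u); first by [].
have le1 : `|s| * acos u <= acos u by rewrite ler_piMl.
apply: ltW; rewrite ltr_cos ?in_itv /= ?a0 ?a1//; first by rewrite lt_neqAle sa.
by rewrite mulr_ge0//= (le_trans le1).
Qed.

(* Along the path w ^ (sin s), defined for all real s, the derivative of K_z(w) w^z vanishes;
   compare s = 0 with s = pi / 2. *)
Lemma Kw_homogeneous z w : 0 < Re z -> 0 < Re w -> Kw z w = Kw z 1 * Cpower w (- z).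
Proof.
move=> z0 w0; have wn : w != 0 by apply: contraTneq w0 => ->; rewrite ltxx.
pose l := Clog w; pose p (s : R) := (sin s)%:C * l; pose dq (s : R) := (cos s)%:C * l.
have [c c0 hc] := Re_Cexp_scaled_Clog w0.
have hp s : cderiv p s (dq s).
  apply: (@cderiv_eq _ _ _ ((sin s)%:C * 0 + l * (cos s)%:C)); last by rewrite /dq; ring.
  by apply: cderivM; [apply: cderivR; exact: is_derive_sin|exact: cderiv_cst].
have s1 (s : R) : -1 <= sin s <= 1 by rewrite sin_geN1 sin_le1.
pose M := cabs l * expR (cabs l).
have hM s : cabs (dq s * Cexp (p s)) <= M.
  rewrite cabsM /dq cabsM cabsR cabs_Cexp ler_pM ?mulr_ge0 ?cabs_ge0 ?expR_ge0//.
    by rewrite ler_piMl ?cabs_ge0// cos_max.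
  rewrite ler_expR /p Re_mulR; apply: le_trans (ler_norm _) _.
  by rewrite normrM (le_trans _ (Re_le_cabs _))// ler_piMl// sin_max.
have hd s : cderiv (fun s => Kw z (Cexp (p s)) * Cexp (z * p s)) s 0.
  have h1 := @Kw_cderiv z p s c M dq z0 c0 hp (fun s => hc _ (s1 s)) hM.
  have h2 := cderiv_Cexp (cderivZ z (hp s)).
  by apply: cderiv_eq (cderivM h1 h2) _; ring.
have := cderiv0_cst hd (pi / 2) 0.
rewrite /p sin_pihalf sin0 !mul0r !mulr0 Cexp0 mulr1 mul1r CexpClog//.
by move=> <-; rewrite /Cpower -mulrA -CexpD -mulrDl subrr mul0r Cexp0 mulr1.
Qed.

End GammaFunction.

(** * The gamma function *)

Section EulerGamma.
Variable R : realType.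
Local Notation L := (@lebesgue_measure R).
Local Notation D := (`]0, +oo[%classic : set R).
Implicit Types (x : R) (z w : R[i]).

Lemma Clog_pos x : 0 < x -> Clog x%:C = (ln x)%:C.
Proof.
move=> x0; apply: eqc; first by rewrite Re_Clog cabsR gtr0_norm.
by rewrite -[Im (Clog _)]/(Carg x%:C) /Carg Re_norm cabsR gtr0_norm// [Re x%:C]/= [Im x%:C]/=
  lexx divff ?gt_eqF// acos1.
Qed.

Lemma Cpower_pos x z : 0 < x -> Cpower x%:C z = cpow x z.
Proof. by move=> x0; rewrite /Cpower Clog_pos. Qed.

Lemma CpowerD w z1 z2 : Cpower w (z1 + z2) = Cpower w z1 * Cpower w z2.
Proof. by rewrite /Cpower mulrDl CexpD. Qed.

Lemma CpowerN w z : Cpower w (- z) = (Cpower w z)^-1.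
Proof. by rewrite /Cpower mulNr CexpN. Qed.

Lemma Cpower_nat w n : w != 0 -> Cpower w n%:R = w ^+ n.
Proof. by move=> w0; rewrite /Cpower CexpMn CexpClog. Qed.

Lemma Gamma_EulerE z : Gamma_Euler z = Kw z 1.
Proof.
apply: eq_Cintegral => x; rewrite inE /= in_itv /= andbT => x0.
rewrite Cpower_pos// /expw -CexpR rmorphN /= mulrN1 cpowD.
have -> : cpow x (- 1) = (x^-1)%:C.
  by rewrite /cpow mulN1r CexpN CexpR lnK ?posrE// -fmorphV.
ring.
Qed.

Lemma Re1_gt0 : 0 < Re (1 : R[i]). Proof. exact: ltr01. Qed.

Lemma Gamma_Euler_rec z : 0 < Re z -> Gamma_Euler (z + 1) = z * Gamma_Euler z.
Proof. by move=> z0; rewrite !Gamma_EulerE Kw_rec ?Re1_gt0// mul1r. Qed.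

(** [cut_ibp] at w = 1, N = 0 and z = 0, where the first term vanishes and the boundary term is
    -1. *)
Lemma Gamma_Euler1 : Gamma_Euler (1 : R[i]) = 1.
Proof.
have h : - 1%:R < Re (0 : R[i]) by rewrite /= ltrN10.
have := @cut_ibp R 1 0 0 Re1_gt0 h; rewrite mul0r add0r mul1r add0r => /oppr_inj.
rewrite Gamma_EulerE.
have -> : Kw (1 : R[i]) 1 = mellin (cut (expw 1) (expw_coef 1) 0) 1.
  by apply: eq_Cintegral => x _; rewrite /cut /taylor big_ord0 mulr0 subr0.
move=> ->.
by rewrite /exp_sum big_ord_recl big_ord0 /= expr0 fact0 divr1 addr0.
Qed.

Lemma Gamma_Euler_shift z n : 0 < Re z ->
  Gamma_Euler (z + n%:R) = \prod_(i < n) (z + i%:R) * Gamma_Euler z.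
Proof.
move=> z0; elim: n => [|n ih]; first by rewrite addr0 big_ord0 mul1r.
rewrite -natr1 addrA Gamma_Euler_rec ?ih; last by rewrite ReD Re_nat ltr_wpDr.
by rewrite big_ord_recr /= mulrA (mulrC (z + n%:R)).
Qed.

Definition rGam (a : R) : R := \int[L]_(x in D) (x^-1 * expR (- x) * expR (a * ln x)).

Lemma gamma_integrand (a : R) x : (x^-1)%:C * expw 1 x * cpow x a%:C =
  (x^-1 * expR (- x) * expR (a * ln x))%:C.
Proof.
have e1 : x%:C * -1 = (- x)%:C by rewrite mulrN1 rmorphN.
have e2 : a%:C * (ln x)%:C = (a * ln x)%:C by rewrite rmorphM.
by rewrite /expw e1 /cpow e2 !CexpR -!rmorphM.
Qed.

Lemma Gamma_EulerR a : Gamma_Euler a%:C = (rGam a)%:C.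
Proof.
rewrite Gamma_EulerE /Kw /mellin /rGam -(@CintegralR _ _ _ L D (measurable_itv `]0, +oo[)).
by apply: eq_Cintegral => x _; exact: gamma_integrand.
Qed.

Lemma gamma_integrable z : 0 < Re z ->
  Cintegrable L D (fun x => (x^-1)%:C * expw 1 x * cpow x z).
Proof.
by move=> z0; apply: (mellin_integrable (expw0_dominated Re1_gt0)); rewrite oppr0.
Qed.

(** On [1, 2] the integrand is at least e^(-2) / 2, because x^a >= 1 there. *)
Lemma rGam_gt0 a : 1 <= a -> 0 < rGam a.
Proof.
move=> a1; have a0 := lt_le_trans ltr01 a1.
have [ig _] := @gamma_integrable a%:C a0.
have {}ig : rintegrable L D (fun x => x^-1 * expR (- x) * expR (a * ln x)).
  by apply: eq_integrable ig => // x _; rewrite gamma_integrand.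
have i2 : rintegrable L D (fun x => \1_`[1, 2] x * (2^-1 * expR (- 2))).
  apply: (@le_rintegrable _ _ _ L _ (measurable_itv `]0, +oo[) _ _ _ _ ig).
    have m12 : measurable_fun (setT : set R) (\1_`[1, 2] : R -> R).
      by apply: measurable_indic; exact: measurable_itv.
    by apply: measurable_funM => //; apply: measurable_funTS; exact: m12.
  move=> x; rewrite /= in_itv /= andbT => x0; rewrite indicE.
  case: (boolP (x \in _)) => xI; last by rewrite mul0r normr0 !mulr_ge0 ?invr_ge0 ?expR_ge0 ?(ltW
    x0).
  have /andP[x1 x2] : 1 <= x <= 2 by move: xI; rewrite inE /= in_itv.
  rewrite mul1r ger0_norm ?mulr_ge0 ?invr_ge0 ?expR_ge0//.
  rewrite -[leLHS]mulr1 ler_pM ?mulr_ge0 ?invr_ge0 ?expR_ge0//.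
    by rewrite ler_pM ?invr_ge0 ?expR_ge0// ?lef_pV2 ?posrE// ler_expR lerN2.
  by rewrite -expR0 ler_expR mulr_ge0 ?ln_ge0// ltW.
apply: (@lt_le_trans _ _ (\int[L]_(x in D) (\1_`[1, 2] x * (2^-1 * expR (- 2))))).
  under eq_Rintegral do rewrite mulrC.
  have i3 : rintegrable L D (\1_`[1, 2] : R -> R).
    have := @rintegrableZ _ _ _ L _ (measurable_itv `]0, +oo[) (2^-1 * expR (- 2))^-1 _ i2.
    apply: eq_integrable => // x _ /=; congr EFin.
    by rewrite mulrCA mulVf ?mulr1// gt_eqF// mulr_gt0 ?invr_gt0 ?expR_gt0.
  rewrite RintegralZl// mulr_gt0 ?mulr_gt0 ?expR_gt0 ?invr_gt0//.
  rewrite /Rintegral integral_indic//.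
  have -> : `[1, 2]%classic `&` D = `[1, 2]%classic :> set R.
    apply/setIidPl => x /=; rewrite !in_itv /= andbT => /andP[x1 _].
    exact: lt_le_trans x1.
  have := lebesgue_measure_itv (`[1, 2] : interval R); rewrite /= lte_fin ltr1n /= => ->.
  by rewrite -EFinD /=; lra.
apply: le_Rintegral => // x; rewrite /= in_itv /= andbT => x0; rewrite indicE.
case: (boolP (x \in _)) => xI; last by rewrite mul0r !mulr_ge0 ?invr_ge0 ?expR_ge0 ?(ltW x0).
have /andP[x1 x2] : 1 <= x <= 2 by move: xI; rewrite inE /= in_itv.
rewrite mul1r -[leLHS]mulr1 ler_pM ?mulr_ge0 ?invr_ge0 ?expR_ge0//.
  by rewrite ler_pM ?invr_ge0 ?expR_ge0// ?lef_pV2 ?posrE// ler_expR lerN2.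
by rewrite -expR0 ler_expR mulr_ge0 ?ln_ge0// ltW.
Qed.

Lemma rGam_rec a : 0 < a -> rGam (a + 1) = a * rGam a.
Proof.
move=> a0; have := @Gamma_Euler_rec a%:C a0.
by rewrite -[1 in X in X = _]/(1%:C) -rmorphD !Gamma_EulerR -rmorphM => /(congr1 (@Re R)).
Qed.

Lemma exp_sum2 w : exp_sum 2 w = 1 + w.
Proof. by rewrite /exp_sum !big_ord_recl big_ord0 /= expr0 expr1 !divr1 addr0. Qed.

(** The real part of |e^(i y) - 1 - i y| <= 4 y^2, which is [le_exp_rem] for N = 2. *)
Lemma cos_ge_quad (y : R) : 1 - 4 * y ^+ 2 <= cos y.
Proof.
have := le_exp_rem 2 (0 +i* y).
rewrite /= normr0 expR0 mulr1 expr0n add0r sqr_sqrtr ?sqr_ge0// => h.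
have := le_trans (Re_le_cabs _) h.
rewrite /exp_rem exp_sum2 ReB ReD Re_Cexp /= expR0 mul1r addr0 ler_norml => /andP[+ _]; lra.
Qed.

(** From e^|y| - 1 >= |y|. For y = ln (u / a) the right-hand side is a Laurent polynomial in u, so
    it integrates to values of Gamma at integer shifts of a. *)
Lemma sqr_le_exp (y : R) : y ^+ 2 <= (expR y - 1) ^+ 2 + (expR (- y) - 1) ^+ 2.
Proof.
have h1 := expR_ge1Dx y; have h2 := expR_ge1Dx (- y).
have s1 := sqr_ge0 (expR y - 1); have s2 := sqr_ge0 (expR (- y) - 1).
have [y0|y0] := leP 0 y.
  by have := @lerXn2r _ 2 y (expR y - 1); rewrite !nnegrE => /(_ y0); lra.
have := @lerXn2r _ 2 (- y) (expR (- y) - 1); rewrite !nnegrE sqrrN; lra.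
Qed.

(** The bracket is the mean of (u/a - 1)^2 + (a/u - 1)^2 for u distributed according to the gamma
    law of parameter a. It is at most 5 / (a - 2), so it tends to 0 as a grows. *)
Lemma gamma_moments_gt0 (a q : R) : 4 < a -> 0 <= q -> 5 * q < a - 2 ->
  0 < 1 - q * ((a + 1) / a - 2 * a / (a - 1) + a ^+ 2 / ((a - 1) * (a - 2))).
Proof.
move=> a4 q0 q1; have a0 : 0 < a by lra.
have p1 : 0 < a - 1 by lra.
have p2 : 0 < a - 2 by lra.
have B : (a + 1) / a - 2 * a / (a - 1) + a ^+ 2 / ((a - 1) * (a - 2)) <= 5 / (a - 2).
  rewrite -subr_ge0 [X in 0 <= X](_ : _ = (3 * a ^+ 2 - 4 * a - 2) / (a * (a - 1) * (a - 2)));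
    last first.
    by field; rewrite !gt_eqF.
  rewrite divr_ge0 ?mulr_ge0 ?(ltW a0) ?(ltW p1) ?(ltW p2)//.
  rewrite [X in 0 <= X](_ : _ = 3 * (a * (a - 4) + 8 / 3 * (a - 4)) + 30); last by field.
  by rewrite addr_ge0// mulr_ge0// addr_ge0// mulr_ge0//; lra.
have h : q * (5 / (a - 2)) < 1 by rewrite mulrA ltr_pdivrMr// mul1r mulrC.
by rewrite subr_gt0 (le_lt_trans _ h)// ler_wpM2l.
Qed.

Lemma gamma_moments_sum (a q g : R) : a != 0 -> a - 1 != 0 -> a - 2 != 0 ->
  (1 - 2 * q) * 1 * g + (2 * q / a * (a * g) + (- q * a^-1 ^+ 2 * ((a + 1) * (a * g)) +
   (2 * q * a * (g / (a - 1)) + (- q * a ^+ 2 * (g / ((a - 1) * (a - 2))) + 0)))) =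
  g * (1 - q * ((a + 1) / a - 2 * a / (a - 1) + a ^+ 2 / ((a - 1) * (a - 2)))).
Proof. by move=> a0 a1 a2; field; rewrite a0 a1 a2. Qed.

(* If Gamma (a + i t) = 0, the integral of u^(a-1) e^(-u) cos (t ln (u / a)) vanishes. But
   cos (t y) >= 1 - 4 t^2 y^2 >= 1 - 4 t^2 ((e^y - 1)^2 + (e^(-y) - 1)^2), and for
   y = ln (u / a) the right-hand side integrates to a rational multiple of Gamma a, positive
   for large a. *)
Lemma Gamma_Euler_neq0_large (a t : R) : 4 < a -> 20 * t ^+ 2 < a - 2 ->
  Gamma_Euler (a +i* t) != 0.
Proof.
move=> a4 ta; apply/eqP => G0.
have a0 : 0 < a by lra.
pose q := 4 * t ^+ 2; have q0 : 0 <= q by rewrite mulr_ge0// sqr_ge0.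
have q1 : 5 * q < a - 2 by rewrite /q mulrA -natrM.
(* Pairs of a coefficient and an exponent: with v = u / a, 1 - q ((v - 1)^2 + (1/v - 1)^2) is the
   sum of the terms p.1 v^(p.2). *)
pose s : seq (R * R) := [:: (1 - 2 * q, 0); (2 * q, 1); (- q, 2); (2 * q, - 1); (- q, - 2)].
have n1 : a - 1 != 0 by rewrite subr_eq0 gt_eqF//; lra.
have n2 : a - 2 != 0 by rewrite subr_eq0 gt_eqF//; lra.
have a1 : 1 <= a by lra.
have sp p : p \in s -> 0 < a + p.2.
  by rewrite !inE => /or4P[|||/orP[]] /eqP -> /=; lra.
pose F (p : R * R) x := (p.1 * expR (- (p.2 * ln a)))%:C * ((x^-1)%:C * expw 1 x * cpow x
  (a + p.2)%:C).
(* The constant factor a^(-i t) centres the phase, turning t ln u into t ln (u / a). *)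
pose P x := Cexp (- ('i%C * (t * ln a)%:C)) * ((x^-1)%:C * expw 1 x * cpow x (a +i* t)).
have iP : Cintegrable L D P.
  by apply: (@CintegrableZ _ _ _ L _ (measurable_itv `]0, +oo[)); exact: gamma_integrable.
have IP : Cintegral L D P = 0.
  rewrite (@CintegralZ _ _ _ L _ (measurable_itv `]0, +oo[)); last exact: gamma_integrable.
  by rewrite -/(mellin _ _) -/(Kw _ _) -Gamma_EulerE G0 mulr0.
pose Q x := \sum_(p <- s) F p x.
have iF p : p \in s -> Cintegrable L D (F p).
  move=> ps; apply: (@CintegrableZ _ _ _ L _ (measurable_itv `]0, +oo[)); apply: gamma_integrable.
  exact: sp.
have iQ : Cintegrable L D Q by apply: (@Cintegrable_sum _ _ _ L _ (measurable_itv `]0, +oo[)).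
have e1 : rGam (a + 1) = a * rGam a by exact: rGam_rec.
have e2 : rGam (a + 2) = (a + 1) * (a * rGam a).
  have h : 0 < a + 1 by lra.
  by have := rGam_rec h; rewrite e1 -addrA.
have e3 : rGam a = (a - 1) * rGam (a - 1).
  have h : 0 < a - 1 by lra.
  by have := rGam_rec h; rewrite subrK.
have e4 : rGam (a - 1) = (a - 2) * rGam (a - 2).
  have h : 0 < a - 2 by lra.
  by have := rGam_rec h; rewrite (_ : a - 2 + 1 = a - 1)//; lra.
have IQ : Re (Cintegral L D Q) = rGam a *
  (1 - q * ((a + 1) / a - 2 * a / (a - 1) + a ^+ 2 / ((a - 1) * (a - 2)))).
  rewrite (@Cintegral_sum _ _ _ L _ (measurable_itv `]0, +oo[))// Re_sum.
  have -> : \sum_(p <- s) Re (Cintegral L D (F p)) =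
    \sum_(p <- s) p.1 * expR (- (p.2 * ln a)) * rGam (a + p.2).
    apply: eq_big_seq => p ps; rewrite (@CintegralZ _ _ _ L _ (measurable_itv `]0, +oo[));
      last first.
      by apply: gamma_integrable; exact: sp.
    by rewrite -/(mellin _ _) -/(Kw _ _) -Gamma_EulerE Gamma_EulerR -rmorphM.
  have x1 : expR (- (1 * ln a)) = a^-1 by rewrite mul1r expRN lnK.
  have x2 : expR (- (2 * ln a)) = a^-1 ^+ 2.
    by rewrite -mulrN expRM_natl expRN lnK.
  have x3 : expR (- (- 1 * ln a)) = a by rewrite mulN1r opprK lnK.
  have x4 : expR (- (- 2 * ln a)) = a ^+ 2 by rewrite mulNr opprK expRM_natl lnK.
  rewrite /s !big_cons big_nil /= x1 x2 x3 x4 mul0r oppr0 expR0 addr0 e1 e2.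
  have -> : rGam (a - 2) = rGam a / ((a - 1) * (a - 2)).
    by rewrite e3 e4 mulrA mulrC mulKf// mulf_neq0.
  have -> : rGam (a - 1) = rGam a / (a - 1) by rewrite e3 mulrC mulKf.
  exact: gamma_moments_sum (lt0r_neq0 a0) n1 n2.
have leQP : Re (Cintegral L D Q) <= Re (Cintegral L D P).
  case: iQ iP => [iQ _] [iP _]; apply: le_Rintegral => // x Dx.
  have x0 : 0 < x by move: Dx; rewrite /= in_itv /= andbT.
  pose h := x^-1 * expR (- x) * expR (a * ln x).
  pose y := ln x - ln a.
  have -> : Re (P x) = h * cos (t * y).
    have -> : P x = h%:C * Cexp (0 +i* (t * y)).
      rewrite /h -gamma_integrand /P.
      have -> : cpow x (a +i* t) = cpow x a%:C * Cexp ('i%C * (t * ln x)%:C).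
        by rewrite /cpow -CexpD; congr Cexp; apply: eqc; rewrite ?ReD ?ImD ?ReM ?ImM /=; ring.
      rewrite mulrC -!mulrA; congr (_ * (_ * (_ * _))); rewrite -CexpD; congr Cexp.
      by apply: eqc; rewrite ?ReD ?ImD ?ReN ?ImN ?ReM ?ImM /= /y; ring.
    by rewrite Re_mulR Re_Cexp /= expR0 mul1r.
  have -> : Re (Q x) = h * (1 - q * ((expR y - 1) ^+ 2 + (expR (- y) - 1) ^+ 2)).
    have Fe p : Re (F p x) = h * (p.1 * expR (p.2 * y)).
      rewrite /F gamma_integrand -rmorphM /= mulrDl expRD.
      have -> : expR (p.2 * y) = expR (- (p.2 * ln a)) * expR (p.2 * ln x).
        by rewrite -expRD; congr expR; rewrite /y; ring.
      by rewrite /h; ring.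
    rewrite /Q Re_sum /s !big_cons big_nil !Fe /= mul0r expR0 mul1r mulN1r.
    have -> : expR (2 * y) = expR y ^+ 2 by rewrite expRM_natl.
    have -> : expR (- 2 * y) = expR (- y) ^+ 2 by rewrite mulNr -mulrN expRM_natl.
    ring.
  rewrite ler_wpM2l ?mulr_ge0 ?invr_ge0 ?expR_ge0 ?(ltW x0)//.
  apply: le_trans (cos_ge_quad _); rewrite lerD2l lerN2 exprMn mulrA -/q.
  by rewrite ler_wpM2l// sqr_le_exp.
rewrite IP IQ /= in leQP.
have g0 := rGam_gt0 a1.
move: leQP; rewrite pmulr_rle0// => leQP.
by have := gamma_moments_gt0 a4 q0 q1; rewrite ltNge leQP.
Qed.

(** By the functional equation a zero at z would recur at every z + n, whose imaginary part is fixed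
    while the real part grows: there [Gamma_Euler_neq0_large] forbids it. *)
Lemma Gamma_Euler_neq0 z : 0 < Re z -> Gamma_Euler z != 0.
Proof.
move=> z0; apply/eqP => G0.
pose n := Num.bound (20 * Im z ^+ 2 + 4).
have n1 : 20 * Im z ^+ 2 + 4 < n%:R.
  by apply: archi_boundP; rewrite addr_ge0// mulr_ge0// sqr_ge0.
have s0 := sqr_ge0 (Im z).
have : Gamma_Euler ((Re z + n%:R) +i* Im z) != 0 by apply: Gamma_Euler_neq0_large; lra.
have -> : (Re z + n%:R) +i* Im z = z + n%:R.
  by apply: eqc; rewrite ?ReD ?ImD ?Re_nat ?Im_nat ?addr0.
by rewrite Gamma_Euler_shift// G0 mulr0 eqxx.
Qed.

Lemma Gamma_Euler_cdiff z : 0 < Re z -> cdiff (@Gamma_Euler R : (R[i] : numFieldType) -> _) z.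
Proof.
move=> z0; rewrite (_ : @Gamma_Euler R = mellin (expw 1)); last first.
  by apply/funext => w; rewrite Gamma_EulerE.
by apply: (mellin_cdiff (expw0_dominated Re1_gt0)); rewrite oppr0.
Qed.

Lemma prod_neq0_Re z k : 0 < Re z -> \prod_(i < k) (z + i%:R) != 0.
Proof.
move=> z0; apply/prodf_neq0 => i _; apply/eqP => /(congr1 (@Re R)).
by rewrite ReD Re_nat /=; have : 0 <= i%:R :> R by []; lra.
Qed.

(** Any shift into the right half-plane computes [Gamma], not only the least one. A single k
    therefore serves a whole neighbourhood of z. *)
Lemma GammaE k z : 0 < Re (z + k%:R) ->
  Gamma z = Gamma_Euler (z + k%:R) / \prod_(i < k) (z + i%:R).
Proof.
move=> zk; rewrite /Gamma; set k0 := (if _ then _ else _).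
have zk0 : 0 < Re (z + k0%:R).
  rewrite ReD Re_nat /k0; case: (ltP 0 (Re z)) => h; first by rewrite addr0.
  by have := truncnS_gt (- Re z); lra.
have key m n : (m <= n)%N -> 0 < Re (z + m%:R) ->
    Gamma_Euler (z + m%:R) / \prod_(i < m) (z + i%:R) = Gamma_Euler (z + n%:R) / \prod_(i < n)
      (z + i%:R).
  move=> mn zm; rewrite -(subnKC mn) natrD addrA (Gamma_Euler_shift (n - m) zm).
  have -> : \prod_(i < m + (n - m)) (z + i%:R) =
    \prod_(i < m) (z + i%:R) * \prod_(i < n - m) (z + m%:R + i%:R).
    rewrite big_split_ord /=; congr (_ * _); apply: eq_bigr => i _.
    by rewrite natrD addrA.
  by rewrite [X in _ = _ / X]mulrC -mulf_div divff ?mul1r// prod_neq0_Re.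
by case: (leqP k0 k) => h; [exact: key|apply/esym/key => //; exact: ltnW].
Qed.

(** The entire function 1 / Gamma: its zeros 0, -1, -2, ... come out right because [Gamma] takes the
    value 0 at its poles. Its recurrence holds at every z without exception, which makes it more
    convenient than [Gamma]. *)
Definition rGamma z := (Gamma z)^-1.

Lemma rGammaE k z : 0 < Re (z + k%:R) ->
  rGamma z = \prod_(i < k) (z + i%:R) / Gamma_Euler (z + k%:R).
Proof. by move=> zk; rewrite /rGamma (GammaE zk) invf_div. Qed.

Lemma exists_shift z : exists k : nat, 0 < Re (z + k%:R).
Proof.
exists (Num.bound (- Re z)).+1; rewrite ReD Re_nat.
have := archi_boundP (normr_ge0 (Re z)) => _.
have [h|h] := leP 0 (- Re z).
  by have := archi_boundP h; rewrite -natr1; lra.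
by rewrite ltr_wpDr//; lra.
Qed.

Lemma rGamma_rec z : rGamma z = z * rGamma (z + 1).
Proof.
have [k zk] := exists_shift (z + 1).
have zk' : 0 < Re (z + k.+1%:R) by rewrite -addn1 natrD addrCA addrC -addrA addrCA addrA in zk *.
rewrite (rGammaE zk) (rGammaE zk') big_ord_recl /= addr0 mulrA.
have -> : z + 1 + k%:R = z + k.+1%:R by rewrite -addrA nat1r.
by congr (_ * _ / _); apply: eq_bigr => i _; rewrite /bump /= add1n -addrA nat1r.
Qed.

Lemma rGamma_shift k z : rGamma z = \prod_(i < k) (z + i%:R) * rGamma (z + k%:R).
Proof.
elim: k => [|k ih]; first by rewrite big_ord0 mul1r addr0.
by rewrite big_ord_recr /= -mulrA -natr1 addrA -rGamma_rec.
Qed.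

Lemma rGamma1 : rGamma 1 = 1.
Proof.
have h : 0 < Re (1 + 0%:R : R[i]) by rewrite addr0 Re1_gt0.
by rewrite (rGammaE h) big_ord0 addr0 Gamma_Euler1 divr1.
Qed.

Lemma rGamma_neq0 z : (forall n : nat, z != - n%:R) -> rGamma z != 0.
Proof.
move=> zn; have [k zk] := exists_shift z.
rewrite (rGammaE zk) mulf_neq0 ?invr_eq0 ?Gamma_Euler_neq0//.
by apply/prodf_neq0 => i _; rewrite addr_eq0.
Qed.

Lemma rGamma_opp_nat n : rGamma (- n%:R) = 0.
Proof.
by rewrite (rGamma_shift n.+1) big_ord_recr /= addNr mulr0 mul0r.
Qed.

Lemma rGamma_eq0 z : rGamma z = 0 -> exists n : nat, z = - n%:R.
Proof.
move=> z0; apply/not_existsP => h; move/eqP: z0; apply/negP/rGamma_neq0 => n.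
by apply/eqP; exact: h.
Qed.

(** Near z, with one fixed shift k, it is a polynomial divided by the non-vanishing function
    [Gamma_Euler (w + k)]. *)
Lemma rGamma_cdiff z : cdiff (rGamma : (R[i] : numFieldType) -> _) z.
Proof.
have [k zk] := exists_shift z.
pose f (w : (R[i] : numFieldType)) := \prod_(i < k) (w + i%:R) * (Gamma_Euler (w + k%:R))^-1.
apply: (@cdiff_near_eq _ f).
  have : - k%:R < Re z by move: zk; rewrite ReD Re_nat; lra.
  move=> /near_Re_gt; apply: filterS => w hw; rewrite /f (@rGammaE k)// ReD Re_nat; lra.
apply: cdiffM.
  by apply: cdiff_prod => i; apply: cdiffD; [exact: cdiff_id|exact: cdiff_cst].
apply: cdiffV; first exact: Gamma_Euler_neq0.
apply: (@cdiff_shift _ (@Gamma_Euler R : (R[i] : numFieldType) -> _)).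
exact: Gamma_Euler_cdiff.
Qed.

(** Induction on N: [expw_ext_rec] carries z to z + 1, from level N + 1 down to level N, and the
    base case is the homogeneity of [Kw]. *)
Lemma mellin_ext_expw N z w : 0 < Re w -> - N%:R < Re z -> (forall n : nat, z != - n%:R) ->
  mellin_ext (expw w) (expw_coef w) N z = Gamma z * Cpower w (- z).
Proof.
move=> w0; elim: N z => [|N ih] z Nz zn.
  have z0 : 0 < Re z by move: Nz; rewrite oppr0.
  have z0' : 0 < Re (z + 0%:R) by rewrite addr0.
  rewrite mellin_ext0 -/(Kw z w) Kw_homogeneous// -Gamma_EulerE (GammaE z0').
  by rewrite addr0 big_ord0 divr1.
have z0 : z != 0 by have := zn 0; rewrite oppr0.
apply: (mulfI z0); rewrite expw_ext_rec//.
have zn1 (n : nat) : z + 1 != - n%:R.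
  apply: contra (zn n.+1) => /eqP e.
  by rewrite -[z](addrK 1) e -natr1 opprD.
have Nz1 : - N%:R < Re (z + 1) by rewrite ReD Re1; move: Nz; rewrite -natr1; lra.
rewrite ih// opprD CpowerD [Cpower w (- 1)]CpowerN.
have wn : w != 0 by apply: contraTneq w0 => ->; rewrite ltxx.
have -> : Cpower w 1 = w by have := Cpower_nat 1 wn; rewrite expr1.
have G1 : Gamma (z + 1) = z * Gamma z.
  have := rGamma_rec z; rewrite /rGamma => /(congr1 GRing.inv).
  by rewrite invrK invfM invrK => ->; rewrite mulrA mulfV// mul1r.
rewrite G1 [LHS](_ : _ = z * (Gamma z * Cpower w (- z)) * (w * w^-1)); last by ring.
by rewrite mulfV// mulr1.
Qed.

End EulerGamma.

(** * Independence, laws and moments *)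

Section ComplexConvergence.
Variable R : realType.
Implicit Types (u v : nat -> R[i]) (l m : R[i]).

(** Convergence in R[i] through the real sequence of moduli, the form delivered by
    [Cintegral_dominated]. *)
Definition ccvg u l := (fun n => cabs (u n - l)) @ \oo --> (0 : R).

Lemma ccvg_unique u l m : ccvg u l -> ccvg u m -> l = m.
Proof.
move=> hl hm; apply/eqP; rewrite -subr_eq0 -cabs_eq0; apply/eqP.
have h : (fun n => cabs (u n - l) + cabs (u n - m)) @ \oo --> (0 + 0 : R) by exact: cvgD.
rewrite addr0 in h.
have c : (fun _ : nat => cabs (l - m)) @ \oo --> (0 : R).
  apply: squeeze_cvgr (cvg_cst 0) h; apply: nearW => n; rewrite cabs_ge0 /=.
  rewrite (cabsB (u n)) (_ : l - m = (l - u n) + (u n - m)); last by ring.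
  exact: ler_cabsD.
by apply: (cvg_unique _ (cvg_cst (cabs (l - m))) c).
Qed.

Lemma ccvg_cst l : ccvg (fun=> l) l.
Proof. by rewrite /ccvg subrr cabs0; exact: cvg_cst. Qed.

Lemma ccvgM u v l m : ccvg u l -> ccvg v m -> ccvg (fun n => u n * v n) (l * m).
Proof.
move=> hu hv.
have h : (fun n => cabs (u n - l) * (cabs m + cabs (v n - m)) + cabs l * cabs (v n - m)) @ \oo
    --> (0 * (cabs m + 0) + cabs l * 0 : R).
  apply: cvgD; apply: cvgM => //; last exact: cvg_cst.
  by apply: cvgD => //; exact: cvg_cst.
rewrite mul0r mulr0 addr0 in h.
apply: squeeze_cvgr (cvg_cst 0) h; apply: nearW => n; rewrite cabs_ge0 /=.
rewrite (_ : u n * v n - l * m = (u n - l) * (m + (v n - m)) + l * (v n - m)); last by ring.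
apply: le_trans (ler_cabsD _ _) _; rewrite !cabsM lerD2r ler_wpM2l ?cabs_ge0//.
exact: ler_cabsD.
Qed.

Lemma ccvg_prod (I : Type) (r : seq I) (u : I -> nat -> R[i]) (l : I -> R[i]) :
  (forall i, ccvg (u i) (l i)) -> ccvg (fun n => \prod_(i <- r) u i n) (\prod_(i <- r) l i).
Proof.
move=> h; elim: r => [|i r ih].
  by rewrite big_nil; under eq_fun do rewrite big_nil; exact: ccvg_cst.
by rewrite big_cons; under eq_fun do rewrite big_cons; exact: ccvgM.
Qed.

End ComplexConvergence.

Section Discretization.
Variable R : realType.

(** A grid of mesh 1/N counted from -1. The cells being half-open, the value 1 lies in the cell of
    index 2N, hence 2N + 1 indices below. *)
Definition cell (N : nat) (i : nat) : set R := `[i%:R / N%:R - 1, i.+1%:R / N%:R - 1[%classic.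

Lemma cellP N i (y : R) : (0 < N)%N -> -1 <= y ->
  cell N i y <-> i = Num.truncn ((y + 1) * N%:R).
Proof.
move=> N0 y1; have N0' : 0 < N%:R :> R by rewrite ltr0n.
have p0 : 0 <= (y + 1) * N%:R by rewrite mulr_ge0//; lra.
have E : cell N i y <-> i%:R <= (y + 1) * N%:R < i.+1%:R.
  by rewrite /cell /= in_itv /= lerBlDr ltrBrDr ler_pdivrMr// ltr_pdivlMr.
split; first by move/E => h; rewrite (truncn_def h).
by move=> e; apply/E; rewrite e; exact: truncn_itv.
Qed.

Definition discr (N : nat) (p : 'I_N.*2.+1 * 'I_N.*2.+1) : R[i] :=
  (p.1%:R / N%:R - 1) +i* (p.2%:R / N%:R - 1).

Lemma discretize (N : nat) (z : R[i]) : (0 < N)%N -> cabs z <= 1 ->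
  exists p0 : 'I_N.*2.+1 * 'I_N.*2.+1,
  [/\ forall p : 'I_N.*2.+1 * 'I_N.*2.+1, (cell N p.1 (Re z) /\ cell N p.2 (Im z)) <-> p = p0,
     cabs (discr p0 - z) <= 2 / N%:R & cabs (discr p0) <= 2].
Proof.
move=> N0 z1; have N0' : 0 < N%:R :> R by rewrite ltr0n.
have hR := le_trans (Re_le_cabs z) z1; have hI := le_trans (Im_le_cabs z) z1.
rewrite !ler_norml in hR hI.
have bnd (y : R) : -1 <= y <= 1 -> (Num.truncn ((y + 1) * N%:R) < N.*2.+1)%N.
  move=> /andP[y1 y2]; have p0 : 0 <= (y + 1) * N%:R by rewrite mulr_ge0//; lra.
  have /andP[h _] := truncn_itv p0.
  rewrite -(ltr_nat R); apply: le_lt_trans h _; rewrite -natr1 -addnn natrD.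
  have y3 : y + 1 <= 2 by lra.
  by have := ler_wpM2r (ltW N0') y3; lra.
pose p0 : 'I_N.*2.+1 * 'I_N.*2.+1 := (Ordinal (bnd _ hR), Ordinal (bnd _ hI)).
have /andP[R1 R2] := hR; have /andP[I1 I2] := hI.
have cR : cell N p0.1 (Re z) by apply/cellP.
have cI : cell N p0.2 (Im z) by apply/cellP.
have near (y : R) i : cell N i y -> `|i%:R / N%:R - 1 - y| <= N%:R^-1.
  rewrite /cell /= in_itv /= -natr1 mulrDl mul1r => /andP[h1 h2].
  by rewrite ler_norml; apply/andP; split; lra.
exists p0; split.
- move=> [i j] /=; split; last by case=> -> ->.
  by case=> /(cellP _ N0 R1) h1 /(cellP _ N0 I1) h2; congr pair; exact: val_inj.
- apply: le_trans (cabs_le_ReIm _) _; rewrite ReB ImB /=.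
  by apply: le_trans (lerD (near _ _ cR) (near _ _ cI)) _; lra.
- apply: le_trans (cabs_le_ReIm _) _ => /=.
  have b1 (i : 'I_N.*2.+1) : `|i%:R / N%:R - 1| <= 1 :> R.
    rewrite ler_norml; apply/andP; split.
      by rewrite lerBrDr addNr divr_ge0.
    by rewrite lerBlDr ler_pdivrMr// mulrDl mul1r -natrD addnn ler_nat -ltnS.
  by apply: le_trans (lerD (b1 p0.1) (b1 p0.2)) _; lra.
Qed.

End Discretization.

Section Independence.
Context {R : realType} d (T : measurableType d) (P : probability T R).
Context (r : nat) (X : 'I_r -> {RV P >-> R}).

Lemma bounded_rintegrable (M : R) : rintegrable P setT (fun=> M).
Proof. by apply: finite_measure_integrable_cst. Qed.

Lemma CintegralP_indic (A : set T) : measurable A ->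
  Cintegral P setT (fun u => (\1_A u)%:C) = (fine (P A))%:C.
Proof.
by move=> mA; rewrite CintegralR// /Rintegral integral_indic// setIT.
Qed.

Lemma Cintegrable_indic (A : set T) : measurable A ->
  Cintegrable P setT (fun u => (\1_A u)%:C : R[i]).
Proof.
move=> mA; apply: (@Cintegrable_le _ _ _ _ _ measurableT _ _ _ _ (bounded_rintegrable 1)).
  by apply: cmeasR; exact: measurable_indic.
by move=> x _; rewrite cabsR indicE; case: (x \in A); rewrite ?normr1 ?normr0.
Qed.

Hypothesis X_indep : mutually_independent X.

(** Expanding the product of sums runs over all choices [phi] of one event per coordinate; the
    product of the chosen indicators is the indicator of an intersection, whose probability factors
    by independence. *)
Lemma indep_simple (I : finType) (c : 'I_r -> I -> R[i]) (B : 'I_r -> I -> set R) :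
  (forall j i, measurable (B j i)) ->
  Cintegral P setT (fun u => \prod_(j < r) \sum_i c j i * (\1_(B j i) (X j u))%:C) =
  \prod_(j < r) Cintegral P setT (fun u => \sum_i c j i * (\1_(B j i) (X j u))%:C).
Proof.
move=> mB.
have mXB j i : measurable (X j @^-1` B j i).
  by rewrite -[X in measurable X]setTI; exact: measurable_funPT.
have E1 j i : (fun u => (\1_(B j i) (X j u))%:C : R[i]) = (fun u => (\1_(X j @^-1` B j i) u)%:C).
  by apply/funext => u; rewrite !indicE; congr (_%:R%:C); apply/idP/idP; rewrite !inE.
have -> : \prod_(j < r) Cintegral P setT (fun u => \sum_i c j i * (\1_(B j i) (X j u))%:C) =
  \prod_(j < r) \sum_i c j i * (fine (P (X j @^-1` B j i)))%:C.
  apply: eq_bigr => j _; rewrite Cintegral_sum//; last first.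
    by move=> i _; apply: CintegrableZ => //; rewrite E1; exact: Cintegrable_indic.
  apply: eq_bigr => i _; rewrite CintegralZ//; last by rewrite E1; exact: Cintegrable_indic.
  by rewrite E1 CintegralP_indic.
rewrite bigA_distr_bigA.
pose C (phi : {ffun 'I_r -> I}) := \bigcap_(j in [set` [set: 'I_r]%SET]) (X j @^-1` B j (phi j)).
have mC phi : measurable (C phi).
  by apply: fin_bigcap_measurable => // j _; exact: mXB.
transitivity (Cintegral P setT (fun u => \sum_(phi : {ffun 'I_r -> I})
   (\prod_j c j (phi j)) * (\1_(C phi) u)%:C)).
  apply: eq_Cintegral => u _; rewrite bigA_distr_bigA; apply: eq_bigr => phi _.
  rewrite big_split /=; congr (_ * _).
  rewrite indicE; case: (boolP (u \in C phi)) => uC.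
    rewrite big1 ?rmorph1// => j _; rewrite indicE mem_set ?rmorph1//.
    by have := set_mem uC; apply => /=; rewrite inE.
  have [j uj] : exists j, ~ B j (phi j) (X j u).
    apply/not_existsP => h; move/negP: uC; apply; apply/mem_set => j _.
    exact: contrapT (h j).
  have z0 : (false%:R : R)%:C = 0 :> R[i] by [].
  by rewrite (bigD1 j)//= indicE memNset// z0 mul0r.
rewrite Cintegral_sum//; last first.
  by move=> phi _; apply: CintegrableZ => //; exact: Cintegrable_indic.
apply: eq_bigr => phi _; rewrite CintegralZ//; last exact: Cintegrable_indic.
rewrite CintegralP_indic// big_split /= -rmorph_prod; congr (_ * _%:C).
have := @X_indep [set: 'I_r]%SET (fun j => B j (phi j)) (fun j => mB j (phi j)).
rewrite -/(C phi) => ->.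
have -> : (\prod_(j in [set: 'I_r]%SET) P (X j @^-1` B j (phi j)))%E =
  (\prod_j fine (P (X j @^-1` B j (phi j))))%:E.
  rewrite -prodEFin; apply: eq_big => [j|j _]; first by rewrite inE.
  by rewrite fineK// fin_num_measure.
by [].
Qed.

(* Bounded functions are uniform limits of functions with finitely many values, to which the
   product rule for events applies. *)
Lemma indep_prod (f : 'I_r -> R -> R[i]) : (forall j, cmeas setT (f j)) ->
  (forall j x, cabs (f j x) <= 1) ->
  Cintegral P setT (fun u => \prod_(j < r) f j (X j u)) =
  \prod_(j < r) Cintegral P setT (fun u => f j (X j u)).
Proof.
move=> mf f1.
pose I n : finType := ('I_n.+1.*2.+1 * 'I_n.+1.*2.+1)%type.
pose B n j (p : I n) : set R := (fun x => Re (f j x)) @^-1` cell n.+1 p.1 `&`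
   (fun x => Im (f j x)) @^-1` cell n.+1 p.2.
pose g n j x := \sum_(p : I n) discr R p * (\1_(B n j p) x)%:C.
have mB n j p : measurable (B n j p).
  apply: measurableI; rewrite -[X in measurable X]setTI.
    by apply: (mf j).1 => //; exact: measurable_itv.
  by apply: (mf j).2 => //; exact: measurable_itv.
have mX j : measurable_fun setT (X j) by exact: measurable_funPT.
have mg n j : cmeas setT (g n j).
  apply: cmeas_sum => p; apply: cmeasM; first exact: cmeas_cst.
  by apply: cmeasR; exact: measurable_indic.
have gE n j x : exists p0 : I n, [/\ g n j x = discr R p0, cabs (g n j x - f j x) <= 2 /
  n.+1%:R & cabs (g n j x) <= 2].
  have [p0 [h1 h2 h3]] := discretize (ltn0Sn n) (f1 j x).
  have e : g n j x = discr R p0.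
    rewrite /g (bigD1 p0)//= big1 ?addr0.
      by rewrite indicE mem_set ?mulr1//; exact/h1.
    move=> p pp0; rewrite indicE memNset ?mulr0//.
    by move=> /h1 e; rewrite e eqxx in pp0.
  by exists p0; rewrite e.
have c2 : (fun n => 2 * harmonic n : R) @ \oo --> (0 : R).
  by rewrite -(mulr0 2); apply: cvgM; [exact: cvg_cst|exact: cvg_harmonic].
have cg j x : ccvg (fun n => g n j x) (f j x).
  apply: squeeze_cvgr (cvg_cst 0) c2; apply: nearW => n; rewrite cabs_ge0 /=.
  by have [p0 []] := gE n j x.
have L1 : ccvg (fun n => Cintegral P setT (fun u => \prod_(j < r) g n j (X j u)))
    (Cintegral P setT (fun u => \prod_(j < r) f j (X j u))).
  apply: (@Cintegral_dominated _ _ _ P setT measurableT _ _ (fun=> 2 ^+ r)).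
  - by move=> n; apply: cmeas_prod => j; exact: cmeas_comp.
  - by apply: cmeas_prod => j; exact: cmeas_comp.
  - by move=> u _; exact: ccvg_prod.
  - exact: bounded_rintegrable.
  - move=> n u _; rewrite cabs_prod -[leRHS](_ : \prod_(j < r) 2 = _);
    last by rewrite prodr_const card_ord.
    by apply: ler_prod => j _; rewrite cabs_ge0 /=; have [p0 []] := gE n j (X j u).
have L2 : ccvg (fun n => \prod_(j < r) Cintegral P setT (fun u => g n j (X j u)))
    (\prod_(j < r) Cintegral P setT (fun u => f j (X j u))).
  apply: ccvg_prod => j.
  apply: (@Cintegral_dominated _ _ _ P setT measurableT _ _ (fun=> 2)).
  - by move=> n; exact: cmeas_comp.
  - exact: cmeas_comp.
  - by move=> u _; exact: cg.
  - exact: bounded_rintegrable.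
  - by move=> n u _; have [p0 []] := gE n j (X j u).
apply: ccvg_unique L1 _; move: L2; congr ccvg; apply/funext => n.
by rewrite -indep_simple.
Qed.

End Independence.

(** * Transfer of integrals along equality in law *)

Section Law.
Context {R : realType} d (T : measurableType d) (P : {measure set T -> \bar R}).
Context d' (T' : measurableType d') (Q : {measure set T' -> \bar R}).
Context (X : T -> R) (Y : T' -> R).
Hypotheses (mX : measurable_fun setT X) (mY : measurable_fun setT Y).
Hypothesis XY : forall A : set R, measurable A -> P (X @^-1` A) = Q (Y @^-1` A).

(** Both sides are integrals of h against push-forward measures that agree on measurable sets.
    Arbitrary measures are allowed, so that one statement covers X_j against [hatS j] / 2 and Y
    against the identity under dF_Y. *)
Lemma law_integral_ge0 (h : R -> \bar R) : measurable_fun setT h -> (forall x, (0 <= h x)%E) ->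
  (\int[P]_u h (X u) = \int[Q]_u h (Y u))%E.
Proof.
move=> mh h0.
have e1 := @ge0_integral_pushforward _ _ _ _ R _ mX P setT h measurableT mh (fun x _ => h0 x).
have e2 := @ge0_integral_pushforward _ _ _ _ R _ mY Q setT h measurableT mh (fun x _ => h0 x).
rewrite !preimage_setT in e1 e2; rewrite -[LHS]e1 -[RHS]e2.
by apply: eq_measure_integral => A mA _; exact: XY.
Qed.

Lemma law_Rintegral (f : R -> R) : measurable_fun setT f ->
  \int[P]_u f (X u) = \int[Q]_u f (Y u).
Proof.
move=> mf; rewrite /Rintegral integralE [in RHS]integralE.
have mE : measurable_fun setT (EFin \o f) by exact/measurable_EFinP.
have h1 := @law_integral_ge0 ((EFin \o f)^\+)%E (measurable_funepos mE) (fun x => funepos_ge0 _ _).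
have h2 := @law_integral_ge0 ((EFin \o f)^\-)%E (measurable_funeneg mE) (fun x => funeneg_ge0 _ _).
congr fine; congr (_ - _)%E.
- by rewrite (funepos_comp (EFin \o f) X) (funepos_comp (EFin \o f) Y).
- by rewrite (funeneg_comp (EFin \o f) X) (funeneg_comp (EFin \o f) Y).
Qed.

Lemma law_rintegrable (f : R -> R) : measurable_fun setT f ->
  rintegrable Q setT (fun u => f (Y u)) -> rintegrable P setT (fun u => f (X u)).
Proof.
move=> mf /integrableP[_ h]; apply/integrableP; split.
  by apply/measurable_EFinP; exact: measurableT_comp.
have mE : measurable_fun setT (fun x => `|(f x)%:E|%E).
  by apply: measurableT_comp => //; exact/measurable_EFinP.
by have -> := @law_integral_ge0 (fun x => `|(f x)%:E|%E) mE (fun x => abse_ge0 _).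
Qed.

Lemma law_Cintegral (f : R -> R[i]) : cmeas setT f ->
  Cintegral P setT (fun u => f (X u)) = Cintegral Q setT (fun u => f (Y u)).
Proof.
move=> [f1 f2]; rewrite /Cintegral; congr (_ +i* _).
- exact: (@law_Rintegral (fun x => Re (f x))).
- exact: (@law_Rintegral (fun x => Im (f x))).
Qed.

Lemma law_Cintegrable (f : R -> R[i]) : cmeas setT f ->
  Cintegrable Q setT (fun u => f (Y u)) -> Cintegrable P setT (fun u => f (X u)).
Proof.
move=> [f1 f2] [i1 i2]; split.
- exact: (@law_rintegrable (fun x => Re (f x))).
- exact: (@law_rintegrable (fun x => Im (f x))).
Qed.

End Law.

Section StieltjesLaw.
Context {R : realType} d (T : measurableType d) (P : probability T R) (Y : {RV P >-> R}).

(** A Lebesgue-Stieltjes measure is determined by its values on the intervals ]a, b], where both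
    measures give F_Y(b) - F_Y(a). *)
Lemma dF_law (A : set R) : measurable (A : set (measurableTypeR R)) -> dF Y A = P (Y @^-1` A).
Proof.
move=> mA.
have mY : @measurable_fun _ _ T (measurableTypeR R) setT Y.
  by move=> mT B mB; exact: (@measurable_funPT _ _ _ _ Y mT B mB).
pose mu : {measure set (measurableTypeR R) -> \bar R} :=
  @measure_function_pushforward__canonical__measure_function_Measure _ _ _ _ _ P (Y : T ->
    measurableTypeR R) mY.
rewrite -[RHS]/(mu A); apply: lebesgue_stieltjes_measure_unique => // I [[a b]] /= _ <-.
rewrite /lebesgue_stieltjes_measure /measure_extension/=.
rewrite measurable_mu_extE/=; last exact: is_ocitv.
have [ab | ba] := leP a b; last first.
  by rewrite set_itv_ge ?wlength0 ?measure0// bnd_simp -leNgt ltW.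
rewrite wlength_itv_bnd// EFinB !fineK ?fin_num_measure//.
rewrite /cdf /distribution /pushforward.
have -> : Y @^-1` `]a, b] = Y @^-1` `]-oo, b] `\` Y @^-1` `]-oo, a].
  apply/seteqP; split => u /=; rewrite !in_itv /=.
    by move=> /andP[h1 h2]; split => //; apply/negP; rewrite -ltNge.
  by move=> [h1 /negP]; rewrite -ltNge => h2; apply/andP.
have mYi x : measurable (Y @^-1` `]-oo, x]).
  by rewrite -[X in measurable X]setTI; apply: measurable_funPT => //; exact: measurable_itv.
rewrite measureD ?setIidr//; last first.
- by rewrite -ge0_fin_numE// fin_num_measure.
- by apply: preimage_subset; exact: subset_itvl.
Qed.

Let measurable_id_default :
  @measurable_fun _ _ (measurableTypeR R) R setT (fun x => x).
Proof. by move=> mT A mA; rewrite setTI. Qed.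

Let law_dF (A : set R) : measurable A -> P (Y @^-1` A) = dF Y ((fun x => x) @^-1` A).
Proof. by move=> mA; rewrite dF_law. Qed.

Lemma dF_Cintegral (f : R -> R[i]) : cmeas setT f ->
  Cintegral (dF Y) setT f = Cintegral P setT (fun u => f (Y u)).
Proof.
move=> mf; symmetry.
exact: (law_Cintegral (measurable_funPT Y) measurable_id_default law_dF mf).
Qed.

Lemma dF_Cintegrable (f : R -> R[i]) : cmeas setT f ->
  Cintegrable P setT (fun u => f (Y u)) -> Cintegrable (dF Y) setT f.
Proof.
move=> mf; apply: (law_Cintegrable measurable_id_default (measurable_funPT Y) _ mf).
by move=> A mA; symmetry; exact: law_dF.
Qed.

End StieltjesLaw.

Section Moments.
Context {R : realType} d (T : measurableType d) (P : probability T R).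

Definition has_moments (Z : T -> R) := measurable_fun setT Z /\
  forall n, rintegrable P setT (fun u => `|Z u| ^+ n).

Lemma has_moments_cst (c : R) : has_moments (fun=> c).
Proof. by split => // n; exact: bounded_rintegrable. Qed.

Lemma has_momentsZ (c : R) Z : has_moments Z -> has_moments (fun u => c * Z u).
Proof.
move=> [mZ iZ]; split; first exact: measurable_funM.
move=> n; under eq_fun do rewrite normrM exprMn.
exact: rintegrableZ.
Qed.

Lemma le_exprD (x y : R) n : 0 <= x -> 0 <= y -> (x + y) ^+ n <= 2 ^+ n * (x ^+ n + y ^+ n).
Proof.
move=> x0 y0; have [xy|/ltW xy] := leP x y.
  apply: (@le_trans _ _ ((2 * y) ^+ n)).
    by rewrite lerXn2r ?nnegrE ?addr_ge0 ?mulr_ge0//; lra.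
  by rewrite exprMn ler_wpM2l ?exprn_ge0// lerDr exprn_ge0.
apply: (@le_trans _ _ ((2 * x) ^+ n)).
  by rewrite lerXn2r ?nnegrE ?addr_ge0 ?mulr_ge0//; lra.
by rewrite exprMn ler_wpM2l ?exprn_ge0// lerDl exprn_ge0.
Qed.

Lemma has_momentsD Z W : has_moments Z -> has_moments W -> has_moments (fun u => Z u + W u).
Proof.
move=> [mZ iZ] [mW iW]; split; first exact: measurable_funD.
move=> n; apply: (le_rintegrable measurableT _ _
  (rintegrableZ measurableT (2 ^+ n) (rintegrableD measurableT (iZ n) (iW n)))).
  by apply: measurable_funX; apply: measurableT_comp => //; exact: measurable_funD.
move=> u _; rewrite normrX normr_id; apply: le_trans (le_exprD _ _ _) => //.
by rewrite lerXn2r ?nnegrE ?addr_ge0// ler_normD.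
Qed.

Lemma has_moments_sum (I : Type) (r : seq I) (Z : I -> T -> R) :
  (forall i, has_moments (Z i)) -> has_moments (fun u => \sum_(i <- r) Z i u).
Proof.
move=> h; elim: r => [|i r ih].
  by under eq_fun do rewrite big_nil; exact: has_moments_cst.
by under eq_fun do rewrite big_cons; exact: has_momentsD.
Qed.

End Moments.

Section SumVariable.
Context (R : realType) (r : nat) (alpha a : 'I_r -> R).
Context (d d' : measure_display) (Omega : measurableType d) (P : probability Omega R).
Context (Omega' : measurableType d') (Q : probability Omega' R).
Context (hatS : 'I_r -> {RV Q >-> R}) (X : 'I_r -> {RV P >-> R}) (Y : {RV P >-> R}).
Hypothesis hatS_law : forall j, is_hatS (alpha j) (hatS j).
Hypothesis X_law : forall j, eq_in_law P Q (X j) (fun u => 2^-1 * hatS j u).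
Hypothesis X_indep : mutually_independent X.
Hypothesis YE : forall u, Y u = \sum_(j < r) a j * X j u.

Let mX j : measurable_fun setT (X j). Proof. exact: measurable_funPT. Qed.
Let mS j : measurable_fun setT (fun u => 2^-1 * hatS j u).
Proof. by apply: measurable_funM => //; exact: measurable_funPT. Qed.

Lemma cmeas_Cexp_imag (c : R) : cmeas setT (fun x : R => Cexp (0 +i* (c * x))).
Proof.
apply: cmeas_Cexp; apply: cmeas_mk => //; exact: measurable_funM.
Qed.

(** Independence is applied to the factors e^(i x a_j X_j), which have modulus 1; the halved
    argument is due to X_j having the law of [hatS j] / 2. *)
Lemma charfun_sum x : charfun Y x = (\prod_(j < r) hatS_char (alpha j) (x * a j / 2))%:C.
Proof.
rewrite /charfun.
transitivity (Cintegral P setT (fun u => \prod_(j < r) Cexp (0 +i* (x * a j * X j u)))).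
  apply: eq_Cintegral => u _; rewrite -Cexp_sum; congr Cexp; apply: eqc.
    by rewrite Re_sum big1.
  by rewrite Im_sum /= YE mulr_sumr; apply: eq_bigr => j _; rewrite mulrA.
rewrite (indep_prod X_indep (f := fun j t => Cexp (0 +i* (x * a j * t)))); first last.
- by move=> j t; rewrite cabs_Cexp /= expR0.
- by move=> j; exact: cmeas_Cexp_imag.
rewrite rmorph_prod; apply: eq_bigr => j _.
rewrite (law_Cintegral (mX j) (mS j) (@X_law j) (cmeas_Cexp_imag _)).
have [h _] := hatS_law j; transitivity (charfun (hatS j) (x * a j / 2)); last exact: h.
apply: eq_Cintegral => u _; congr (Cexp (_ +i* _)).
by rewrite mulrA.
Qed.

Lemma sum_has_moments : has_moments P Y.
Proof.
have -> : (Y : Omega -> R) = fun u => \sum_(j < r) a j * X j u by apply/funext => u; exact: YE.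
apply: has_moments_sum => j; apply: has_momentsZ; split; first exact: mX.
move=> n; have [_ hm] := hatS_law j.
have mn : measurable_fun setT (fun x : R => `|x| ^+ n) by apply: measurable_funX;
  exact: normr_measurable.
apply: (@law_rintegrable _ _ _ P _ _ Q (X j) _ (mX j) (mS j) (@X_law j) (fun x => `|x| ^+ n) mn).
have := rintegrableZ measurableT (`|2^-1| ^+ n) (integrable_norm (hm n)).
by apply: eq_integrable => // u _ /=; rewrite normrM exprMn normrX.
Qed.

End SumVariable.

(** * The multiple series as a Mellin transform *)

Section BinomialSeries.
Variable R : realType.
Local Notation L := (@lebesgue_measure R).
Local Notation D := (`]0, +oo[%classic : set R).
Implicit Types (alpha u t : R) (n N : nat).

(** Reversing the product turns the falling factorial into the rising one, which shows positivity
    and the quotient Gamma(alpha + n) / Gamma(alpha). *)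
Lemma gbinomE alpha n :
  gbinom (n%:R + alpha - 1) n = \prod_(i < n) (alpha + i%:R) / n`!%:R.
Proof.
rewrite /gbinom (reindex_inj rev_ord_inj) /=; congr (_ / _); apply: eq_bigr => i _.
by rewrite natrB// -natr1; lra.
Qed.

Lemma gbinom_ge0 alpha n : 0 < alpha -> 0 <= gbinom (n%:R + alpha - 1) n.
Proof.
move=> a0; rewrite gbinomE divr_ge0// prodr_ge0// => i _.
by rewrite addr_ge0// ltW.
Qed.

Definition binom_sum alpha N u := \sum_(n < N) gbinom (n%:R + alpha - 1) n * u ^+ n.

Lemma exp_sumR N t : exp_sum N t%:C = (series (exp_coeff t) N)%:C.
Proof.
rewrite /exp_sum /series /= big_mkord rmorph_sum; apply: eq_bigr => i _.
by rewrite /exp_coeff /= natcE rmorphM fmorphV rmorphXn.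
Qed.

Lemma exp_sum_cvg t : ccvg (fun N => exp_sum N t%:C) (expR t)%:C.
Proof.
have h : (fun N => series (exp_coeff t) N - expR t) @ \oo --> (expR t - expR t).
  by apply: cvgB; [exact: is_cvg_series_exp_coeff|exact: cvg_cst].
rewrite subrr in h; have {}h : (fun N => `|series (exp_coeff t) N - expR t|) @ \oo --> (0 : R).
  by apply/norm_cvg0P; exact: h.
by rewrite /ccvg; under eq_fun do rewrite exp_sumR -rmorphB cabsR.
Qed.

Lemma cabs_exp_sum_le N t : 0 <= t -> cabs (exp_sum N t%:C) <= expR t.
Proof.
move=> t0; rewrite exp_sumR cabsR ger0_norm; last first.
  by rewrite /series /= sumr_ge0// => i _; exact: exp_coeff_ge0.
apply: nondecreasing_cvgn_le; last exact: is_cvg_series_exp_coeff.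
by apply: nondecreasing_series => i _ _; exact: exp_coeff_ge0.
Qed.

Lemma binom_integrand alpha n u (x : R) : 0 < x ->
  (u ^+ n / n`!%:R)%:C * ((x^-1)%:C * expw 1 x * cpow x (alpha%:C + n%:R)) =
  (x^-1)%:C * expw 1 x * cpow x alpha%:C * ((x * u)%:C ^+ n / n`!%:R).
Proof.
move=> x0; rewrite cpowD cpow_nat// rmorphM !fmorphV rmorph_nat !rmorphXn rmorphM exprMn /=.
ring.
Qed.

Lemma binom_integrable alpha n u : 0 < alpha ->
  Cintegrable L D (fun x => (x^-1)%:C * expw 1 x * cpow x alpha%:C * ((x * u)%:C ^+ n / n`!%:R)).
Proof.
move=> a0; have mD := measurable_itv `]0, +oo[ : measurable D.
have an : 0 < Re (alpha%:C + n%:R) by rewrite ReD Re_nat /= ltr_wpDr.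
have := @CintegrableZ _ _ _ L _ mD (u ^+ n / n`!%:R)%:C _ (gamma_integrable an).
apply: (@eq_Cintegrable _ _ _ L _ mD) => x; rewrite inE /= in_itv /= andbT.
exact: binom_integrand.
Qed.

Lemma Gamma_Euler_binom alpha n u : 0 < alpha ->
  Gamma_Euler alpha%:C * (gbinom (n%:R + alpha - 1) n * u ^+ n)%:C =
  Cintegral L D (fun x => (x^-1)%:C * expw 1 x * cpow x alpha%:C * ((x * u)%:C ^+ n / n`!%:R)).
Proof.
move=> a0; have mD := measurable_itv `]0, +oo[ : measurable D.
have an : 0 < Re (alpha%:C + n%:R) by rewrite ReD Re_nat /= ltr_wpDr.
transitivity ((u ^+ n / n`!%:R)%:C * Gamma_Euler (alpha%:C + n%:R)).
  rewrite Gamma_Euler_shift// gbinomE.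
  rewrite (_ : \prod_(i < n) (alpha%:C + i%:R) = (\prod_(i < n) (alpha + i%:R))%:C); last first.
    by rewrite rmorph_prod; apply: eq_bigr => i _; rewrite natcE rmorphD.
  by rewrite !rmorphM /=; ring.
rewrite Gamma_EulerE /Kw /mellin -(@CintegralZ _ _ _ L _ mD); last exact: gamma_integrable.
apply: eq_Cintegral => x; rewrite inE /= in_itv /= andbT.
exact: binom_integrand.
Qed.

(** The binomial series is the exponential series of e^(x u) integrated against x^(alpha-1) e^(-x):
    the limit integrand x^(alpha-1) e^(-(1-u) x) has integral Gamma(alpha) (1 - u)^(-alpha) by
    [Kw_homogeneous]. For u >= 0 the partial sums increase, so the limit itself dominates. *)
Lemma binom_sum_cvg alpha u : 0 < alpha -> 0 <= u < 1 ->
  (fun N => binom_sum alpha N u) @ \oo --> expR (- alpha * ln (1 - u)).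
Proof.
move=> a0 /andP[u0 u1]; have mD := measurable_itv `]0, +oo[ : measurable D.
have v0 : 0 < 1 - u by rewrite subr_gt0.
have v0' : 0 < Re (1 - u)%:C by [].
have a0' : 0 < Re alpha%:C by [].
pose f x := (x^-1)%:C * expw (1 - u)%:C x * cpow x alpha%:C.
have fi : Cintegrable L D f.
  by apply: (mellin_integrable (expw0_dominated v0')); rewrite oppr0.
pose h x := x^-1 * expR (- ((1 - u) * x)) * expR (alpha * ln x).
have fE x : f x = (h x)%:C.
  rewrite /f /h /expw /cpow -rmorphN -!rmorphM !CexpR -!rmorphM /=.
  by rewrite mulrN [x * _]mulrC.
pose g x : R[i] := (x^-1)%:C * expw 1 x * cpow x alpha%:C.
have hc : ccvg (fun N => Gamma_Euler alpha%:C * (binom_sum alpha N u)%:C) (Cintegral L D f).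
  have -> : (fun N => Gamma_Euler alpha%:C * (binom_sum alpha N u)%:C) =
      fun N => Cintegral L D (fun x => g x * exp_sum N (x * u)%:C).
    apply/funext => N; rewrite rmorph_sum mulr_sumr.
    rewrite (eq_bigr _ (fun (i : 'I_N) _ => Gamma_Euler_binom i u a0)).
    rewrite -(@Cintegral_sum _ _ _ L _ mD _ _
      (fun (i : 'I_N) x => g x * ((x * u)%:C ^+ i / i`!%:R))); last first.
      by move=> i _; exact: binom_integrable.
    by apply: eq_Cintegral => x _; rewrite -mulr_sumr.
  have gf x : 0 < x -> g x * (expR (x * u))%:C = f x.
    move=> x0; rewrite /g /f /expw mulrAC; congr (_ * _); rewrite -mulrA; congr (_ * _).
    by rewrite -CexpR -CexpD; congr Cexp; rewrite rmorphM rmorphB rmorph1; ring.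
  have mg : cmeas D g by exact: Cintegrable_cmeas (gamma_integrable a0').
  apply: (@Cintegral_dominated _ _ _ L _ mD _ _ h).
  - move=> N; apply: cmeasM => //; apply: cmeas_exp_sum; apply: cmeasR.
    exact: measurable_funM.
  - exact: Cintegrable_cmeas fi.
  - move=> x; rewrite /= in_itv /= andbT => x0.
    rewrite -(gf _ x0); apply: ccvgM; first exact: ccvg_cst.
    exact: exp_sum_cvg.
  - by case: fi => [fi _]; apply: eq_integrable fi => // x _; rewrite fE.
  - move=> N x; rewrite /= in_itv /= andbT => x0.
    have -> : h x = cabs (f x).
      by rewrite fE cabsR ger0_norm// /h !mulr_ge0 ?expR_ge0// invr_ge0 ltW.
    rewrite -(gf _ x0) !cabsM ler_wpM2l ?mulr_ge0 ?cabs_ge0//.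
    rewrite cabsR (ger0_norm (expR_ge0 _)); apply: cabs_exp_sum_le.
    by rewrite mulr_ge0// ltW.
have G0 : Gamma_Euler alpha%:C != 0 by exact: Gamma_Euler_neq0.
have E : Cintegral L D f = Gamma_Euler alpha%:C * (expR (- alpha * ln (1 - u)))%:C.
  rewrite -[LHS]/(Kw _ _) (Kw_homogeneous a0' v0') -Gamma_EulerE Cpower_pos//.
  by rewrite /cpow -rmorphN -rmorphM CexpR.
have {hc} := ccvgM (ccvg_cst (Gamma_Euler alpha%:C)^-1) hc.
rewrite E mulKf// /ccvg; under eq_fun do rewrite mulKf// -rmorphB cabsR.
move=> h0; have {}h0 : (fun N => binom_sum alpha N u - expR (- alpha * ln (1 - u))) @ \oo -->
  (0 : R).
  by apply/norm_cvg0P; exact: h0.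
have -> : (fun N => binom_sum alpha N u) =
  (fun N => (binom_sum alpha N u - expR (- alpha * ln (1 - u))) + expR (- alpha * ln (1 - u))).
  by apply/funext => N; rewrite subrK.
have h1 := cvgD h0 (cvg_cst (expR (- alpha * ln (1 - u)))).
by rewrite add0r in h1; exact: h1.
Qed.

Lemma binom_sum_nd alpha u : 0 < alpha -> 0 <= u ->
  nondecreasing_seq (fun N => binom_sum alpha N u).
Proof.
move=> a0 u0; apply/nondecreasing_seqP => N; rewrite /binom_sum big_ord_recr /= lerDl.
by rewrite mulr_ge0 ?gbinom_ge0 ?exprn_ge0.
Qed.

Lemma binom_sum_le alpha u N : 0 < alpha -> 0 <= u < 1 ->
  binom_sum alpha N u <= expR (- alpha * ln (1 - u)).
Proof.
move=> a0 u01; have c := binom_sum_cvg a0 u01.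
rewrite -(cvg_lim _ c)//; apply: (@nondecreasing_cvgn_le _ (fun N => binom_sum alpha N u)).
  by apply: binom_sum_nd => //; case/andP: u01.
by apply/cvg_ex; eexists; exact: c.
Qed.

End BinomialSeries.

Section UnorderedSum.
Variable R : realType.

Lemma unordered_sumP (I : choiceType) (x : I -> (R[i] : numFieldType)) (l : R[i]) :
  (forall e : R, 0 < e -> exists A0 : {fset I}, forall A : {fset I}, (A0 `<=` A)%fset ->
    cabs (\sum_(i <- A) x i - l) <= e) -> unordered_summable x /\ unordered_sum x = l.
Proof.
move=> h; have PF := @summability.totally_filter I.
have c : (summability.partial_sum x @ summability.totally --> (l : (R[i] : numFieldType))).
  apply/cvgrPdistC_le => e e0.
  have e0' : 0 < Re e by move: e0; rewrite ltcE => /andP[].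
  have eE : e = (Re e)%:C by apply: eqc => //=; move: e0; rewrite ltcE => /andP[/eqP /= ->].
  have [A0 hA] := h _ e0'; exists A0 => // A /hA.
  by rewrite big_seq_fsetE /= -lecR -eE -cabsE.
split; first by apply/cvg_ex; exists l.
exact: cvg_lim.
Qed.

End UnorderedSum.

Lemma cvg_prod_seq (R : realType) (J : Type) (s : seq J) (u : J -> nat -> R) (l : J -> R) :
  (forall j, u j @ \oo --> l j) ->
  (fun N => \prod_(j <- s) u j N) @ \oo --> \prod_(j <- s) l j.
Proof.
move=> h; elim: s => [|j s ih].
  by rewrite big_nil; under eq_fun do rewrite big_nil; exact: cvg_cst.
by rewrite big_cons; under eq_fun do rewrite big_cons; exact: cvgM.
Qed.

Section SinhSeries.
Variable R : realType.
Local Notation L := (@lebesgue_measure R).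
Local Notation D := (`]0, +oo[%classic : set R).
Variables (r : nat) (alpha a : 'I_r -> R) (b : R).
Hypotheses (alpha_gt0 : forall j, 0 < alpha j) (a_gt0 : forall j, 0 < a j) (b_gt0 : 0 < b).
Local Notation I := {ffun 'I_r -> nat}.
Local Notation beta := (\sum_(j < r) alpha j).
Implicit Types (n : I) (N : nat) (x : R) (A : {fset I}).

Let mD : measurable D. Proof. exact: measurable_itv. Qed.

Definition smoment_coef n : R := \prod_(j < r) gbinom ((n j)%:R + alpha j - 1) (n j).
Definition smoment_freq n : R := \sum_(j < r) a j * (n j)%:R + b.
Definition smoment_exp A x : R := \sum_(n <- A) smoment_coef n * expR (- (x * smoment_freq n)).
(** The sum of the exponential series of which [smoment_exp] is a finite part, namely e^(-b x) times
    the product of the (1 - e^(-a_j x))^(-alpha_j); its Mellin transform is Gamma(s) S(s). *)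
Definition sinh_kernel x : R :=
  expR (- (b * x)) * \prod_(j < r) expR (- alpha j * ln (1 - expR (- (a j * x)))).

(* A cofinal family of index sets over which the partial sums factor. *)
Definition box_point N (f : {ffun 'I_r -> 'I_N}) : I := [ffun j => val (f j)].
Definition box N : {fset I} := [fset box_point f | f in {ffun 'I_r -> 'I_N}]%fset.

Lemma box_cover A : exists N, (A `<=` box N)%fset.
Proof.
(* One more than the sum of all coordinates of all points of A, hence above each coordinate. *)
pose N := (\sum_(n <- A) \sum_(j < r) n j).+1.
exists N; apply/fsubsetP => n nA; have nN j : (n j < N)%N.
  rewrite ltnS (big_fsetD1 n)//= (bigD1 j)//= -addnA leq_addr//.
apply/imfsetP; exists [ffun j => Ordinal (nN j)] => //.
by apply/ffunP => j; rewrite !ffunE.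
Qed.

Lemma box_sum N (F : I -> R) : \sum_(n <- box N) F n = \sum_(f : {ffun 'I_r -> 'I_N}) F
  (box_point f).
Proof.
rewrite big_imfset /=; last first.
  move=> f g _ _ /ffunP fg; apply/ffunP => j; have := fg j; rewrite !ffunE.
  exact: val_inj.
by rewrite big_enum.
Qed.

Lemma smoment_exp_box N x : smoment_exp (box N) x =
  expR (- (b * x)) * \prod_(j < r) binom_sum (alpha j) N (expR (- (a j * x))).
Proof.
rewrite /smoment_exp box_sum bigA_distr_bigA mulr_sumr; apply: eq_bigr => f _.
rewrite /smoment_coef /smoment_freq mulrDr opprD expRD [x * b]mulrC [X in _ * X]mulrC [LHS]mulrCA;
  congr (_ * _).
have -> : expR (- (x * \sum_(j < r) a j * (box_point f j)%:R)) =
    \prod_(j < r) expR (- (x * (a j * (box_point f j)%:R))).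
  by rewrite mulr_sumr -sumrN expR_sum.
transitivity (\prod_(j < r) (gbinom ((box_point f j)%:R + alpha j - 1) (box_point f j) *
  expR (- (x * (a j * (box_point f j)%:R)))));
  first exact: (esym (@big_split R 1 *%R _ (index_enum _) xpredT _ _)).
apply: eq_bigr => j _; rewrite ffunE; congr (_ * _).
by rewrite -expRM_natl; congr expR; ring.
Qed.

Lemma smoment_coef_ge0 n : 0 <= smoment_coef n.
Proof. by apply: prodr_ge0 => j _; exact: gbinom_ge0. Qed.

Lemma le_smoment_exp A B x : (A `<=` B)%fset -> smoment_exp A x <= smoment_exp B x.
Proof.
move=> /fsetIidPr AB; rewrite /smoment_exp.
rewrite [leRHS](@big_fsetID _ _ _ _ (mem A))/= (_ : [fset n in B | n \in A]%fset = A).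
  by rewrite lerDl sumr_ge0// => n _; rewrite mulr_ge0 ?smoment_coef_ge0 ?expR_ge0.
by apply/fsetP => n; rewrite !inE; move/fsetP: AB => /(_ n); rewrite !inE.
Qed.

Lemma smoment_exp_ge0 A x : 0 <= smoment_exp A x.
Proof. by apply: sumr_ge0 => n _; rewrite mulr_ge0 ?smoment_coef_ge0 ?expR_ge0. Qed.

Let u01 j x : 0 < x -> 0 <= expR (- (a j * x)) < 1.
Proof. by move=> x0; rewrite expR_ge0 expR_lt1 oppr_lt0 mulr_gt0. Qed.

Lemma smoment_exp_le_kernel A x : 0 < x -> smoment_exp A x <= sinh_kernel x.
Proof.
move=> x0; have [N AN] := box_cover A.
rewrite (le_trans (le_smoment_exp x AN))// smoment_exp_box ler_wpM2l ?expR_ge0//.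
apply: ler_prod => j _; rewrite binom_sum_le ?u01// andbT.
by apply: sumr_ge0 => n _; rewrite mulr_ge0 ?gbinom_ge0 ?exprn_ge0 ?expR_ge0.
Qed.

Lemma smoment_exp_box_cvg x : 0 < x -> (fun N => smoment_exp (box N) x) @ \oo --> sinh_kernel x.
Proof.
move=> x0; under eq_fun do rewrite smoment_exp_box.
apply: (@cvgM _ _ eventually _ (fun=> _)); first exact: cvg_cst.
by apply: cvg_prod_seq => j; exact: (binom_sum_cvg (alpha_gt0 j) (u01 j x0)).
Qed.

Lemma kernel_bound (e al y : R) : 0 < e -> e <= y -> 0 < al -> expR (- al * ln y) <= expR
  (- al * ln e).
Proof.
move=> e0 ey al0; rewrite ler_expR !mulNr lerN2 ler_pM2l// ler_ln ?posrE//.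
exact: lt_le_trans ey.
Qed.

(** For x <= 1, 1 - e^(-a x) >= a x / (1 + a x) >= x a / (1 + a), whence the order x^(-beta) at 0
    and the constant [C1]. For x > 1, 1 - e^(-a x) >= 1 - e^(-a) gives [C2], and the decay is that
    of e^(-b x). *)
Lemma sinh_kernel_dominated : mellin_dominated (fun x => (sinh_kernel x)%:C) (- beta).
Proof.
split.
  apply: cmeasR; apply: measurable_funM; first by apply: measurableT_comp => //;
    apply: measurable_funN; exact: measurable_funM.
  apply: measurable_prod => j _; apply: measurableT_comp => //; apply: measurable_funM => //.
  apply: measurableT_comp => //; apply: measurable_funB => //.
  by apply: measurableT_comp => //; apply: measurable_funN; exact: measurable_funM.
pose C1 := \prod_(j < r) expR (- alpha j * ln (a j / (1 + a j))).
pose C2 := \prod_(j < r) expR (- alpha j * ln (1 - expR (- a j))).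
exists C1, C2, b; split=> // x.
  move=> /andP[x0 x1]; rewrite cabsR ger0_norm; last first.
    by rewrite mulr_ge0 ?expR_ge0// prodr_ge0// => j _; exact: expR_ge0.
  have -> : C1 * expR (- beta * ln x) = \prod_(j < r) expR (- alpha j * ln (x * (a j / (1 + a j)))).
    rewrite mulNr mulr_suml -sumrN expR_sum /C1 -big_split /=; apply: eq_bigr => j _.
    have aj := a_gt0 j.
    rewrite (@lnM _ x) ?posrE ?divr_gt0 ?addr_gt0// mulrDr expRD mulrC !mulNr//.
  rewrite -[leRHS]mul1r ler_pM ?expR_ge0//.
  - by rewrite prodr_ge0// => j _; exact: expR_ge0.
  - by rewrite expR_le1 oppr_le0 mulr_ge0 ?ltW.
  apply: ler_prod => j _; rewrite expR_ge0 /=; apply: kernel_bound => //.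
    by rewrite mulr_gt0 ?divr_gt0 ?addr_gt0.
  have aj := a_gt0 j; have axp : 0 < a j * x by rewrite mulr_gt0.
  rewrite expRN; apply: (@le_trans _ _ (1 - (1 + a j * x)^-1)).
    rewrite (_ : 1 - _ = x * (a j / (1 + a j * x))); last by field; lra.
    rewrite ler_pM2l// ler_pM2l// lef_pV2 ?posrE ?addr_gt0// lerD2l.
    by rewrite ger_pMr.
  rewrite lerD2l lerN2 lef_pV2 ?posrE ?expR_gt0 ?addr_gt0//.
  exact: expR_ge1Dx.
move=> x1; have x0 := lt_trans ltr01 x1; rewrite cabsR ger0_norm; last first.
  by rewrite mulr_ge0 ?expR_ge0// prodr_ge0// => j _; exact: expR_ge0.
rewrite /sinh_kernel [leLHS]mulrC; apply: ler_wpM2r; first exact: expR_ge0.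
apply: ler_prod => j _; rewrite expR_ge0 /=.
apply: kernel_bound => //; first by rewrite subr_gt0 expR_lt1 oppr_lt0.
by rewrite lerD2l lerN2 ler_expR lerN2 ler_peMr ?ltW.
Qed.

Lemma sinh_kernel_ge0 x : 0 <= sinh_kernel x.
Proof. by rewrite mulr_ge0 ?expR_ge0// prodr_ge0// => j _; exact: expR_ge0. Qed.

Lemma smoment_freq_gt0 n : 0 < smoment_freq n.
Proof. by rewrite ltr_wpDl// sumr_ge0// => j _; rewrite mulr_ge0// ltW. Qed.

Lemma beta_ge0 : 0 <= beta.
Proof. by apply: sumr_ge0 => j _; exact: ltW. Qed.

Lemma Smoment_term_mellin n (s : R[i]) : 0 < Re s ->
  Gamma_Euler s * Smoment_term alpha a b s n = (smoment_coef n)%:C * mellin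
    (expw (smoment_freq n)%:C) s.
Proof.
move=> s0; rewrite /Smoment_term -/(smoment_coef n) -/(smoment_freq n).
rewrite -[mellin _ _]/(Kw _ _) Kw_homogeneous ?smoment_freq_gt0// -Gamma_EulerE CpowerN.
by rewrite mulrCA.
Qed.

Lemma Smoment_partial_mellin A (s : R[i]) : 0 < Re s ->
  Gamma_Euler s * \sum_(n <- A) Smoment_term alpha a b s n =
    mellin (fun x => (smoment_exp A x)%:C) s /\
  Cintegrable L D (fun x => (x^-1)%:C * (smoment_exp A x)%:C * cpow x s).
Proof.
move=> s0; pose f n x : R[i] := (smoment_coef n)%:C * ((x^-1)%:C * expw (smoment_freq n)%:C x *
  cpow x s).
have fi n : Cintegrable L D (fun x => (x^-1)%:C * expw (smoment_freq n)%:C x * cpow x s).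
  have h : 0 < Re (smoment_freq n)%:C by exact: smoment_freq_gt0.
  by apply: (mellin_integrable (expw0_dominated h)); rewrite oppr0.
have E x : \sum_(n <- A) f n x = (x^-1)%:C * (smoment_exp A x)%:C * cpow x s.
  rewrite /smoment_exp rmorph_sum mulr_sumr mulr_suml; apply: eq_bigr => n _.
  by rewrite /f /expw -rmorphN -rmorphM CexpR mulrN rmorphM; ring.
split.
  rewrite mulr_sumr (eq_bigr _ (fun n _ => Smoment_term_mellin n s0)).
  transitivity (Cintegral L D (fun x => \sum_(n <- A) f n x)); last first.
    by apply: eq_Cintegral => x _; exact: E.
  rewrite (@Cintegral_sum _ _ _ L _ mD); last by move=> n _; exact: (@CintegrableZ _ _ _ L _ mD).
  by apply: eq_bigr => n _; rewrite (@CintegralZ _ _ _ L _ mD).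
apply: (@eq_Cintegrable _ _ _ L _ mD _ _ (fun x _ => E x)).
by apply: (@Cintegrable_sum _ _ _ L _ mD) => n _; exact: (@CintegrableZ _ _ _ L _ mD).
Qed.

(** The exponential series has non-negative terms and |x^s| = x^(Re s). So for every finite A
    containing a box, the error is controlled by the real integral of the kernel minus its partial
    sum over that box, which tends to 0 by dominated convergence. This yields unordered convergence
    for complex s. *)
Lemma Smoment_mellin (s : R[i]) : beta < Re s ->
  unordered_summable (Smoment_term alpha a b s) /\
  Smoment alpha a b s = rGamma s * mellin (fun x => (sinh_kernel x)%:C) s.
Proof.
move=> bs; have s0 : 0 < Re s by exact: le_lt_trans beta_ge0 bs.
have G0 : Gamma_Euler s != 0 by exact: Gamma_Euler_neq0.
have bs' : - - beta < Re s by rewrite opprK.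
have iH := mellin_dominated_integrable sinh_kernel_dominated bs'.
have iHc := mellin_integrable sinh_kernel_dominated bs'.
pose w x := x^-1 * expR (Re s * ln x).
have w0 x : 0 < x -> 0 <= w x by move=> x0; rewrite mulr_ge0 ?expR_ge0 ?invr_ge0 ?ltW.
have {}iH : rintegrable L D (fun x => sinh_kernel x * w x).
  apply: eq_integrable iH => // x; rewrite inE => Dx.
  have x0 : 0 < x by move: Dx; rewrite /= in_itv /= andbT.
  rewrite [LHS](_ : _ = (cabs ((x^-1)%:C * (sinh_kernel x)%:C) * expR (Re s * ln x))%:E)//.
  rewrite cabsM !cabsR (ger0_norm (sinh_kernel_ge0 x)) ger0_norm ?invr_ge0 ?ltW// /w /comp;
    congr EFin; ring.
have mexp A : measurable_fun D (smoment_exp A).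
  apply: measurable_sum => n; apply: measurable_funM => //; apply: measurableT_comp => //.
  by apply: measurable_funN; apply: measurable_funM.
have mw : measurable_fun D w.
  apply: measurable_funM; first exact: measurable_inv.
  apply: measurableT_comp => //; apply: measurable_funM => //.
  by apply: (@measurable_funTS _ _ _ _ D); exact: measurable_ln.
have ihA A : rintegrable L D (fun x => smoment_exp A x * w x).
  apply: (@le_rintegrable _ _ _ L _ mD _ _ _ _ iH).
    by apply: measurable_funM => //; exact: mexp.
  move=> x; rewrite /= in_itv /= andbT => x0.
  rewrite ger0_norm; last by apply: mulr_ge0; [exact: smoment_exp_ge0|exact: w0].
  by apply: ler_wpM2r; [exact: w0|exact: smoment_exp_le_kernel].
pose u N := \int[L]_(x in D) ((sinh_kernel x - smoment_exp (box N) x) * w x).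
have u0 : u @ \oo --> (0 : R).
  rewrite (_ : (0 : R) = \int[L]_(x in D) 0); last first.
    by rewrite /Rintegral integral0.
  apply: (@Rintegral_dominated _ _ _ L _ mD _ _ (fun x => sinh_kernel x * w x)) => //.
  - move=> N; apply: measurable_funM => //; apply: measurable_funB => //.
    have [[mk _] _] := sinh_kernel_dominated.
    + exact: (@measurable_funTS _ _ _ _ D).
    + exact: mexp.
  - move=> y; rewrite /= in_itv /= andbT => y0.
    rewrite -(mul0r (w y)) -(subrr (sinh_kernel y)).
    apply: (@cvgM _ _ eventually _ _ (fun=> _)); last exact: cvg_cst.
    apply: (@cvgB _ _ _ eventually _ (fun=> _)); first exact: cvg_cst.
    exact: smoment_exp_box_cvg.
  - move=> N y; rewrite /= in_itv /= andbT => y0.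
    rewrite ger0_norm; last by apply: mulr_ge0; [rewrite subr_ge0 smoment_exp_le_kernel|exact: w0].
    by apply: ler_wpM2r; [exact: w0|rewrite gerBl smoment_exp_ge0].
suff h : forall e : R, 0 < e -> exists A0 : {fset I}, forall A, (A0 `<=` A)%fset ->
    cabs (\sum_(n <- A) Smoment_term alpha a b s n -
          rGamma s * mellin (fun x => (sinh_kernel x)%:C) s) <= e.
  by have := @unordered_sumP R I (Smoment_term alpha a b s) _ h.
move=> e e0; have c0 : 0 < cabs (Gamma_Euler s) by rewrite cabs_gt0.
(* The factor 2 anticipates [le_Cintegral], and the error is measured after multiplication by
   Gamma(s). *)
have [N uN] : exists N, 2 * u N <= e * cabs (Gamma_Euler s).
  have e2 : 0 < e * cabs (Gamma_Euler s) / 2 by rewrite divr_gt0 ?mulr_gt0.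
  have [N _ hN] := (@cvgrPdist_le _ _ _ _ _ _ _).1 u0 _ e2.
  exists N; have := hN N (leqnn N); rewrite sub0r normrN => h.
  have := le_trans (ler_norm _) h; rewrite ler_pdivlMr// mulrC//.
exists (box N) => A NA.
rewrite -(ler_pM2r c0) -cabsM mulrC mulrBr.
have [-> iA] := Smoment_partial_mellin A s0.
have s0' : 0 < Re (s + 0%:R) by rewrite addr0.
rewrite (rGammaE s0') big_ord0 addr0 div1r mulVKf//.
rewrite /mellin -(@CintegralB _ _ _ L _ mD)//.
apply: le_trans uN; rewrite /u.
apply: (@le_Cintegral _ _ _ L _ mD).
- exact: (@CintegrableB _ _ _ L _ mD).
- have := @rintegrableD _ _ _ L _ mD _ _ iH (@rintegrableZ _ _ _ L _ mD (-1) _ (ihA (box N))).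
  by apply: eq_integrable => // x _; congr EFin; ring.
- move=> x Dx; have x0 : 0 < x by move: Dx; rewrite /= in_itv /= andbT.
  rewrite [X in cabs X](_ : _ = (x^-1)%:C * (smoment_exp A x - sinh_kernel x)%:C * cpow x s);
    last by rewrite rmorphB; ring.
  rewrite cabsM cabs_cpow cabsM !cabsR.
  rewrite [X in X * _ * _]ger0_norm ?invr_ge0 ?(ltW x0)// distrC.
  rewrite ger0_norm ?subr_ge0 ?smoment_exp_le_kernel//.
  have -> : (sinh_kernel x - smoment_exp (box N) x) * w x =
    x^-1 * (sinh_kernel x - smoment_exp (box N) x) * expR (Re s * ln x) by rewrite /w; ring.
  apply: ler_wpM2r; first exact: expR_ge0.
  apply: ler_wpM2l; first by rewrite invr_ge0 ltW.
  by rewrite lerD2l lerN2 le_smoment_exp.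
Qed.

End SinhSeries.

(** * Continuation and poles *)

Section Holomorphic.
Variable K : numFieldType.
Implicit Types (f g h : K -> K) (z : K).

Lemma holo_cdiff f z : holomorphic_at f z -> cdiff f z.
Proof. exact: nbhs_singleton. Qed.

Lemma holo_everywhere f z : (forall w, cdiff f w) -> holomorphic_at f z.
Proof. by move=> h; apply: filterE => w; exact: h. Qed.

Lemma holoD f g z : holomorphic_at f z -> holomorphic_at g z ->
  holomorphic_at (fun w => f w + g w) z.
Proof. by move=> hf hg; apply: filterS2 hf hg => w; exact: cdiffD. Qed.

Lemma holoM f g z : holomorphic_at f z -> holomorphic_at g z ->
  holomorphic_at (fun w => f w * g w) z.
Proof. by move=> hf hg; apply: filterS2 hf hg => w; exact: cdiffM. Qed.

Lemma holo_sum I (r : seq I) (f : I -> K -> K) z :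
  (forall i, holomorphic_at (f i) z) -> holomorphic_at (fun w => \sum_(i <- r) f i w) z.
Proof.
move=> h; elim: r => [|i r ih].
  by under eq_fun do rewrite big_nil; apply: holo_everywhere => w; exact: cdiff_cst.
by under eq_fun do rewrite big_cons; exact: holoD.
Qed.

Lemma holo_near_eq f g z : (\forall w \near z, f w = g w) -> holomorphic_at f z ->
  holomorphic_at g z.
Proof.
move=> fg hf; have := nbhs_interior fg; move: hf; apply: filterS2 => w hw fw.
exact: cdiff_near_eq hw.
Qed.

(* At a removable or simple singularity f is P / (w - z) ^+ m with m <= 1. *)
Lemma pole_of_order_le f (P : K -> K) z (m k : nat) : P w @[w --> z] --> P z ->
  (\forall w \near z^', f w = P w / (w - z) ^+ m) -> pole_of_order f z k -> (k <= m)%N.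
Proof.
move=> cP fP [k0 [h [hh hz fh]]]; rewrite leqNgt; apply/negP => mk.
have ch := cdiff_continuous (holo_cdiff hh).
have e : \forall w \near z^', P w * (w - z) ^+ (k - m) = h w.
  near=> w; have wz : w - z != 0 by rewrite subr_eq0; near: w; exact: nbhs_dnbhs_neq.
  have e1 : f w = P w / (w - z) ^+ m by near: w.
  have e2 : f w = h w / (w - z) ^+ k by near: w.
  have -> : h w = f w * (w - z) ^+ k by rewrite e2 divfK// expf_neq0.
  rewrite e1 -[in RHS](subnK (ltnW mk)) exprD; set u := (w - z) ^+ m; set v := (w - z) ^+ _.
  have u0 : u != 0 by rewrite expf_neq0.
  by field.
have l1 : P w * (w - z) ^+ (k - m) @[w --> z^'] --> P z * (z - z) ^+ (k - m).
  apply: cvgM; first by apply: cvg_within_filter; exact: cP.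
  apply: cvg_within_filter; apply: cdiff_continuous.
  elim: (k - m)%N => [|n ih]; first by under eq_fun do rewrite expr0; exact: cdiff_cst.
  under eq_fun do rewrite exprS; apply: cdiffM => //.
  by apply: cdiffB; [exact: cdiff_id|exact: cdiff_cst].
have l2 : h w @[w --> z^'] --> h z by apply: cvg_within_filter; exact: ch.
have l3 : P w * (w - z) ^+ (k - m) @[w --> z^'] --> h z.
  by apply: cvg_trans l2; apply: near_eq_cvg; apply: filterS e => w ->.
have := cvg_unique _ l1 l3; rewrite subrr expr0n subn_eq0 leqNgt mk mulr0 => h0.
by move: hz; rewrite -h0 ?eqxx//; exact: norm_hausdorff.
Unshelve. all: by end_near. Qed.

End Holomorphic.

Section Continuation.
Variable R : realType.
Local Notation C := (R[i] : numFieldType).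
Implicit Types (q s w : R[i]).

(* rGamma s / (s - q), with its removable singularity at s = q filled in when rGamma q = 0. *)
Definition rGamma_div q s : R[i] :=
  if rGamma q == 0
  then rGamma (s - q + 1) * \prod_(i < Num.truncn (- Re q)) (s + i%:R)
  else rGamma s / (s - q).

Lemma rGamma_divE q s : s != q -> rGamma_div q s = rGamma s / (s - q).
Proof.
move=> sq; rewrite /rGamma_div; case: eqP => // /rGamma_eq0[k qk].
rewrite {}qk in sq *.
have -> : Num.truncn (- Re (- k%:R : R[i])) = k by rewrite ReN Re_nat opprK natrK.
rewrite opprK (rGamma_shift k s) (rGamma_rec (s + k%:R)).
have sk : s + k%:R != 0 by move: sq; rewrite -subr_eq0 opprK.
by field.
Qed.

(** The derivative of 1 / Gamma at its zero - k. *)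
Lemma rGamma_div_opp_nat k : rGamma_div (- k%:R) (- k%:R) = (-1) ^+ k * k`!%:R.
Proof.
rewrite /rGamma_div rGamma_opp_nat eqxx subrr add0r rGamma1 mul1r.
have -> : Num.truncn (- Re (- k%:R : R[i])) = k by rewrite ReN Re_nat opprK natrK.
rewrite (reindex_inj rev_ord_inj) /=.
rewrite (eq_bigr (fun i : 'I_k => - 1 * (i.+1)%:R)) => [|i _]; last first.
  by rewrite natrB//; ring.
rewrite big_split /= prodr_const card_ord; congr (_ * _).
by rewrite -natr_prod fact_prod big_add1 big_mkord.
Qed.

Lemma rGamma_div_cdiff q s : s != q \/ rGamma q = 0 -> cdiff (rGamma_div q : C -> C) s.
Proof.
rewrite /rGamma_div => h.
have [q0|q0] := eqVneq (rGamma q) 0.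
  apply: cdiffM.
    have := @cdiff_shift C (@rGamma R : C -> C) (- q + 1) s; rewrite /=.
    under eq_fun do rewrite addrA.
    by apply; exact: rGamma_cdiff.
  apply: cdiff_prod => i; apply: cdiffD; [exact: cdiff_id|exact: cdiff_cst].
apply: cdiffM; first exact: rGamma_cdiff.
apply: cdiffV; last by apply: cdiffB; [exact: cdiff_id|exact: cdiff_cst].
by rewrite subr_eq0; case: h => // h; move: q0; rewrite h eqxx.
Qed.

Lemma near_neq (s q : C) : s != q -> \forall w \near s, w != q.
Proof.
move=> sq; have e0 : 0 < cabs (s - q) by rewrite cabs_gt0 subr_eq0.
by apply: filterS (near_cabs s e0) => w; apply: contraTneq => ->; rewrite ltxx.
Qed.

Lemma rGamma_div_holo q s : s != q \/ rGamma q = 0 -> holomorphic_at (rGamma_div q : C -> C) s.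
Proof.
move=> h; have [q0|q0] := eqVneq (rGamma q) 0.
  by apply: holo_everywhere => w; apply: rGamma_div_cdiff; right.
case: h => [sq|/eqP]; last by rewrite (negbTE q0).
by apply: filterS (near_neq sq) => w wq; apply: rGamma_div_cdiff; left.
Qed.

Variables (G : R -> R[i]) (g : nat -> R[i]) (c : R[i]) (beta : R).
Hypothesis G_dominated : forall N, mellin_dominated (cut G g N) N%:R.

(** This is c / Gamma(s) times [mellin_ext] at s - beta, with the factor 1 / Gamma(s) moved into
    each term of the finite sum, where [rGamma_div] cancels a zero of 1 / Gamma against the pole
    beta - n. *)
Definition cont_at N s : R[i] := c *
  (rGamma s * mellin (cut G g N) (s - beta%:C) +
   \sum_(n < N) g n * rGamma_div (beta%:C - n%:R) s).

Definition continuation s : R[i] := cont_at (Num.truncn (beta - Re s)).+1 s.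

Lemma cont_atS N s : - N%:R < Re (s - beta%:C) -> cont_at N.+1 s = cont_at N s.
Proof.
move=> hN; have := mellin_extS (G_dominated N) hN.
rewrite /mellin_ext big_ord_recr /= => e.
have {}e : mellin (cut G g N.+1) (s - beta%:C) =
  mellin (cut G g N) (s - beta%:C) - g N / (s - beta%:C + N%:R).
  by apply/eqP; rewrite -subr_eq0; move/eqP: e; rewrite -subr_eq0 => /eqP <-; apply/eqP; ring.
rewrite /cont_at big_ord_recr /= e rGamma_divE; last first.
  apply: contraTneq hN => ->; rewrite !ReB Re_nat /=; rewrite -leNgt; lra.
have -> : s - (beta%:C - N%:R) = s - beta%:C + N%:R by ring.
by set u := (_ + N%:R)^-1; ring.
Qed.

(** The level in the definition of [continuation] jumps with Re s. Any admissible level gives the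
    same value, so near a point the function can be read off one fixed N. *)
Lemma continuationE N s : - N%:R < Re (s - beta%:C) -> continuation s = cont_at N s.
Proof.
have le M N' : - N'%:R < Re (s - beta%:C) -> (N' <= M)%N -> cont_at M s = cont_at N' s.
  move=> h; elim: M => [|M ih]; first by rewrite leqn0 => /eqP->.
  rewrite leq_eqVlt => /predU1P[<-//|]; rewrite ltnS => NM.
  by rewrite cont_atS ?ih// (le_lt_trans _ h)// lerN2 ler_nat.
move=> hN; rewrite /continuation; set M := _.+1.
have hM : - M%:R < Re (s - beta%:C).
  rewrite ReB /= ltrNl opprB; exact: truncnS_gt.
by have [MN|/ltnW NM] := leqP M N; [rewrite (le N M)|rewrite (le M N)].
Qed.

Lemma exists_level s k : exists2 N, (k <= N)%N & - N%:R < Re (s - beta%:C).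
Proof.
exists (maxn k (Num.truncn (beta - Re s)).+1); first exact: leq_maxl.
rewrite ReB /= ltrNl opprB; apply: lt_le_trans (truncnS_gt _) _.
by rewrite ler_nat leq_maxr.
Qed.

Lemma continuation_near N (s : C) : - N%:R < Re (s - beta%:C) ->
  \forall w \near s, continuation w = cont_at N w.
Proof.
rewrite ReB ltrBrDr => h; apply: filterS (near_Re_gt h) => w hw.
by apply: continuationE; rewrite ReB ltrBrDr.
Qed.

Lemma mellin_cut_holo N (s : C) : - N%:R < Re (s - beta%:C) ->
  holomorphic_at (fun w : C => mellin (cut G g N) (w - beta%:C) : C) s.
Proof.
rewrite ReB ltrBrDr => h; apply: filterS (near_Re_gt h) => w hw.
apply: (@cdiff_shift C (mellin (cut G g N)) (- beta%:C) w).
by apply: (mellin_cdiff (G_dominated N)); rewrite ReB ltrBrDr.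
Qed.

Lemma continuation_ext N s : - N%:R < Re (s - beta%:C) -> (forall n : nat, s != beta%:C - n%:R) ->
  continuation s = c * rGamma s * mellin_ext G g N (s - beta%:C).
Proof.
move=> hN sn; rewrite (continuationE hN) /cont_at /mellin_ext -mulrA; congr (_ * _).
rewrite mulrDr mulr_sumr; congr (_ + _); apply: eq_bigr => n _.
by rewrite rGamma_divE// opprB addrA addrAC mulrCA.
Qed.

Lemma continuation_holo s :
  (forall n, s = beta%:C - n%:R -> g n = 0 \/ rGamma s = 0) ->
  holomorphic_at (continuation : C -> C) s.
Proof.
move=> h; have [N _ hN] := exists_level s 0.
apply: (@holo_near_eq _ (cont_at N)).
  by apply: filterS (continuation_near hN) => w ->.
apply: holoM; first by apply: holo_everywhere => w; exact: cdiff_cst.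
apply: holoD.
  by apply: holoM; [apply: holo_everywhere => w; exact: rGamma_cdiff|exact: mellin_cut_holo].
apply: (@holo_sum C _ _ (fun (n : 'I_N) (w : C) => g n * rGamma_div (beta%:C - n%:R) w)) => n.
have [sn|sn] := eqVneq s (beta%:C - n%:R).
  case: (h n sn) => [->|r0].
    by under eq_fun do rewrite mul0r; apply: holo_everywhere => w; exact: cdiff_cst.
  apply: holoM; first by apply: holo_everywhere => w; exact: cdiff_cst.
  by apply: rGamma_div_holo; right; rewrite -sn.
apply: holoM; first by apply: holo_everywhere => w; exact: cdiff_cst.
by apply: rGamma_div_holo; left.
Qed.

(** At a level above n only the n-th term of the finite sum is singular at beta - n; the rest, [A],
    is analytic there. The factorization is on a punctured neighbourhood, so it also covers the case
    where 1 / Gamma vanishes at s. *)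
Lemma continuation_pole n (s : C) : s = beta%:C - n%:R ->
  exists P : C -> C, [/\ holomorphic_at P s, P s = c * g n * rGamma s &
   \forall w \near s^', (continuation w : C) = P w / (w - s) ^+ 1].
Proof.
move=> sE; have [N nN hN] := exists_level s n.+1.
pose A (w : C) : C := rGamma w * mellin (cut G g N) (w - beta%:C) +
  \sum_(i < N | i != Ordinal nN) g i * rGamma_div (beta%:C - i%:R) w.
have hA : holomorphic_at A s.
  apply: holoD.
    by apply: holoM; [apply: holo_everywhere => w; exact: rGamma_cdiff|exact: mellin_cut_holo].
  rewrite (_ : (fun w => _) = fun w : C => \sum_(i < N)
      (if i != Ordinal nN then g i * rGamma_div (beta%:C - i%:R) w else 0)); last first.
    by apply/funext => w; rewrite big_mkcond.
  apply: holo_sum => i; case: eqVneq => [_|ni] /=; first by apply: holo_everywhere => w;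
    exact: cdiff_cst.
  apply: holoM; first by apply: holo_everywhere => w; exact: cdiff_cst.
  apply: rGamma_div_holo; left; rewrite sE (inj_eq (addrI _)) eqr_opp eqr_nat eq_sym.
  by apply: contra ni => /eqP ni; apply/eqP/val_inj.
exists (fun w => (w - s) * (c * A w) + c * g n * rGamma w); split.
- have hc (a : C) : holomorphic_at (fun=> a) s by apply: holo_everywhere => w; exact: cdiff_cst.
  have h1 : holomorphic_at (fun w : C => w - s) s.
    by apply: holo_everywhere => w; apply: cdiffB; [exact: cdiff_id|exact: cdiff_cst].
  have h2 : holomorphic_at (@rGamma R : C -> C) s by apply: holo_everywhere => w;
    exact: rGamma_cdiff.
  exact: holoD (holoM h1 (holoM (hc c) hA)) (holoM (hc (c * g n)) h2).
- by rewrite subrr mul0r add0r.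
near=> w; have ws : w - s != 0 by rewrite subr_eq0; near: w; exact: (@nbhs_dnbhs_neq C).
have -> : continuation w = cont_at N w.
  by near: w; apply: cvg_within; exact: continuation_near hN.
rewrite /cont_at (bigD1 (Ordinal nN)) //= -sE rGamma_divE ?expr1; last by rewrite -subr_eq0.
by rewrite /A; set u := \sum_(_ < _ | _) _; field.
Unshelve. all: by end_near. Qed.

Lemma continuation_residue n : c != 0 ->
  is_simple_pole_with_residue (continuation : C -> C) (beta%:C - n%:R)
    (c * g n * rGamma (beta%:C - n%:R)).
Proof.
move=> c0; have [P [hP Ps PE]] := @continuation_pole n _ erefl.
split; last first.
  by rewrite -Ps => p0; split=> //; exists P.
rewrite -Ps; have : P w @[w --> (beta%:C - n%:R : C)^'] --> P (beta%:C - n%:R).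
  by apply: cvg_within_filter; apply: cdiff_continuous; exact: holo_cdiff.
apply: cvg_trans; apply: near_eq_cvg; near=> w.
have ws : w - (beta%:C - n%:R) != 0 by rewrite subr_eq0; near: w; exact: (@nbhs_dnbhs_neq C).
have -> : continuation w = P w / (w - (beta%:C - n%:R)) ^+ 1 by near: w.
by rewrite expr1 mulrC divfK.
Unshelve. all: by end_near. Qed.

Lemma continuation_dichotomy s : c != 0 ->
  holomorphic_at (continuation : C -> C) s \/ pole_of_order (continuation : C -> C) s 1.
Proof.
move=> c0; have [[n [sn gn rn]]|h] :=
  pselect (exists n, [/\ s = beta%:C - n%:R, g n != 0 & rGamma s != 0]).
  by right; rewrite sn; apply: (continuation_residue n c0).2; rewrite -sn !mulf_neq0.
left; apply: continuation_holo => n sn; apply: contrapT => /not_orP[/eqP gn /eqP rn].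
by apply: h; exists n.
Qed.

Lemma continuation_meromorphic : c != 0 -> meromorphic (continuation : C -> C).
Proof.
by move=> c0 s; case: (continuation_dichotomy s c0) => h; [left|right; exists 1%N].
Qed.

Lemma continuation_simple s k : c != 0 -> pole_of_order (continuation : C -> C) s k -> k = 1%N.
Proof.
move=> c0 h; apply/eqP; rewrite eqn_leq (h.1) andbT.
case: (continuation_dichotomy s c0) => [hs|[_ [P [hP _ PE]]]].
  apply: leq_trans (leqnSn 0); apply: (pole_of_order_le _ _ h);
    first exact: cdiff_continuous (holo_cdiff hs).
  by apply: filterE => w; rewrite expr0 divr1.
exact: (pole_of_order_le (cdiff_continuous (holo_cdiff hP)) PE h).
Qed.

End Continuation.

(** * Laplace transforms of random variables *)

Section PowerOfVerticalLine.
Variable R : realType.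
Implicit Types (c y : R) (z : R[i]).

(** In the right half-plane the argument is an arctangent, a single formula without the case
    distinction of [Carg], from which measurability in y and boundedness follow. *)
Lemma Clog_line c y : 0 < c -> Clog (c +i* y) = ln (Num.sqrt (c ^+ 2 + y ^+ 2)) +i* atan (y / c).
Proof.
move=> c0; apply: eqc; first by rewrite Re_Clog.
rewrite -[Im (Clog _)]/(Carg (c +i* y)) /Carg Re_norm [Re (_ +i* _)]/= [Im (_ +i* _)]/=.
have sE : c / Num.sqrt (c ^+ 2 + y ^+ 2) = cos (atan (y / c)).
  rewrite cos_atan (_ : c ^+ 2 + y ^+ 2 = c ^+ 2 * (1 + (y / c) ^+ 2)); last by field;
    rewrite gt_eqF.
  by rewrite sqrtrM ?sqr_ge0// sqrtr_sqr gtr0_norm// invfM mulrA divff ?gt_eqF// mul1r.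
rewrite -[cabs (c +i* y)]/(Num.sqrt (c ^+ 2 + y ^+ 2)) sE.
have := atan_gtNpi2 (y / c); have := atan_ltpi2 (y / c); have pp := pi_gt0 R => h1 h2.
case: ifPn => y0.
  have l : 0 <= atan (y / c) by rewrite -[X in X <= _]atan0 le_atan// divr_ge0// ltW.
  by rewrite cosK// in_itv /= l /=; lra.
rewrite -ltNge in y0.
have l : atan (y / c) <= 0.
  by rewrite -[X in _ <= X]atan0 le_atan// pmulr_lle0 ?invr_gt0// ltW.
by rewrite cosKN ?opprK// l andbT; lra.
Qed.

Lemma cmeas_Cpower_line c z : 0 < c -> cmeas setT (fun y => Cpower (c +i* y) z).
Proof.
move=> c0; apply: cmeas_Cexp; apply: cmeasM; first exact: cmeas_cst.
under eq_fun do rewrite Clog_line//.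
apply: cmeas_mk.
  apply: measurableT_comp; first exact: measurable_ln.
  apply: measurableT_comp; first by apply: continuous_measurable_fun; exact: sqrt_continuous.
  by apply: measurable_funD => //; exact: measurable_funX.
apply: measurableT_comp; last exact: measurable_funM.
by apply: continuous_measurable_fun => x; exact: continuous_atan.
Qed.

(** A real power of either sign is traded for a constant plus an integer power, whose expectation is
    a moment: x^s <= e^s if s < 0 and x <= 1, x^s <= 1 if s >= 0 and x <= 1, and x^s <= x^n if x >
    1, where e^s means the s-th power of the lower bound [e]. *)
Lemma ler_exp_ln (e s x : R) n : 0 < e -> e <= x -> s <= n%:R ->
  expR (s * ln x) <= expR (s * ln e) + 1 + x ^+ n.
Proof.
move=> e0 ex sn; have x0 := lt_le_trans e0 ex.
have xn : 0 <= x ^+ n by rewrite exprn_ge0 ?ltW.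
have p := expR_ge0 (s * ln e).
have [x1|/ltW x1] := leP x 1.
  have l0 : ln x <= 0 by rewrite ln_le0.
  have [s0|/ltW s0] := leP 0 s.
    apply: (@le_trans _ _ 1); last lra.
    by rewrite expR_le1 mulr_ge0_le0.
  apply: (@le_trans _ _ (expR (s * ln e))); last lra.
  by rewrite ler_expR ler_wnM2l// ler_ln ?posrE.
have l0 : 0 <= ln x by rewrite ln_ge0.
apply: (@le_trans _ _ (x ^+ n)); last lra.
have -> : x ^+ n = expR (n%:R * ln x) by rewrite mulr_natl -lnXn// lnK// posrE exprn_gt0.
by rewrite ler_expR ler_wpM2r.
Qed.

(** The modulus of w^z is |w|^(Re z) e^(-Im z arg w), where |arg w| < pi and |w| >= c. *)
Lemma cabs_Cpower_line c y z n : 0 < c -> Re z <= n%:R ->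
  cabs (Cpower (c +i* y) z) <=
  expR (`|Im z| * pi) * (expR (Re z * ln c) + 1 + cabs (c +i* y) ^+ n).
Proof.
move=> c0 zn; rewrite /Cpower cabs_Cexp ReM addrC expRD Re_Clog.
apply: ler_pM; rewrite ?expR_ge0//.
  rewrite ler_expR (le_trans (ler_norm _))// normrN normrM ler_wpM2l// Clog_line// [Im _]/=.
  have := atan_gtNpi2 (y / c); have := atan_ltpi2 (y / c); have pp := pi_gt0 R => h1 h2.
  by rewrite ler_norml; apply/andP; split; lra.
apply: ler_exp_ln => //.
by have := Re_le_cabs (c +i* y); rewrite [Re _]/= gtr0_norm.
Qed.

End PowerOfVerticalLine.

Section LaplaceTransform.
Context {R : realType} d (T : measurableType d) (P : probability T R) (Y : T -> R).
Hypothesis Y_moments : has_moments P Y.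
Variable c : R.
Local Notation w u := (c +i* Y u).
Local Notation L := (@lebesgue_measure R).
Local Notation D := (`]0, +oo[%classic : set R).
Let mD : measurable D. Proof. exact: measurable_itv. Qed.
Let mY : measurable_fun setT Y. Proof. by case: Y_moments. Qed.

Definition moment_bound n u : R := 2 ^+ n * (`|c| ^+ n + `|Y u| ^+ n).

Lemma moment_bound_ge0 n u : 0 <= moment_bound n u.
Proof. by rewrite mulr_ge0 ?exprn_ge0// addr_ge0 ?exprn_ge0. Qed.

Lemma moment_bound_integrable n : rintegrable P setT (moment_bound n).
Proof.
apply: rintegrableZ => //; apply: rintegrableD => //; first exact: bounded_rintegrable.
by case: Y_moments.
Qed.

Lemma cabs_moment n u : cabs (w u) ^+ n <= moment_bound n u.
Proof.
apply: le_trans (le_exprD _ _ _) => //; apply: lerXn2r; rewrite ?nnegrE ?cabs_ge0 ?addr_ge0//.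
exact: cabs_le_ReIm.
Qed.

Lemma cmeas_line : cmeas setT (fun u => w u).
Proof. exact: cmeas_mk. Qed.

Lemma Cintegrable_moment n : Cintegrable P setT (fun u => w u ^+ n).
Proof.
apply: (Cintegrable_le measurableT _ _ (moment_bound_integrable n)).
  by apply: cmeasX; exact: cmeas_line.
by move=> u _; rewrite cabsX; exact: cabs_moment.
Qed.

Definition cmoment n : R[i] := Cintegral P setT (fun u => w u ^+ n).
Definition laplace x : R[i] := Cintegral P setT (fun u => expw (w u) x).
Definition laplace_coef n : R[i] := (-1) ^+ n * cmoment n / n`!%:R.

Lemma Cintegrable_coef n : Cintegrable P setT (fun u => expw_coef (w u) n).
Proof.
apply: eq_Cintegrable (CintegrableZ measurableT ((-1) ^+ n / n`!%:R) (Cintegrable_moment n)) =>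
  // u _.
by rewrite /expw_coef (exprNn (w u)) mulrAC.
Qed.

Lemma Cintegrable_coefZ n (k : R[i]) : Cintegrable P setT (fun u => expw_coef (w u) n * k).
Proof.
by under eq_fun do rewrite mulrC; apply: CintegrableZ => //; exact: Cintegrable_coef.
Qed.

Lemma laplace_coefE n : laplace_coef n = Cintegral P setT (fun u => expw_coef (w u) n).
Proof.
rewrite /laplace_coef /cmoment mulrAC -CintegralZ//; last exact: Cintegrable_moment.
by apply: eq_Cintegral => u _; rewrite /expw_coef (exprNn (w u)) mulrAC.
Qed.

(** The modulus e^(-c x) of e^(-x w) is the same for all outcomes, so the expectation exists at
    every real x and for either sign of c. *)
Lemma Cintegrable_expw x : Cintegrable P setT (fun u => expw (w u) x).
Proof.
apply: (Cintegrable_le measurableT _ _ (bounded_rintegrable P (expR (- (x * c))))).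
  apply: cmeas_Cexp; apply: cmeasM; first exact: cmeas_cst.
  by apply: cmeasN; exact: cmeas_line.
by move=> u _; rewrite cabs_Cexp Re_mulR ReN mulrN.
Qed.

Lemma laplace_taylor N x :
  laplace x - taylor laplace_coef N x = Cintegral P setT (fun u => exp_rem N (x%:C * - w u)).
Proof.
rewrite /taylor (eq_bigr (fun n : 'I_N => Cintegral P setT (fun u => (x ^+ n)%:C * expw_coef
  (w u) n))); last first.
  by move=> n _; rewrite laplace_coefE mulrC CintegralZ//; exact: Cintegrable_coef.
rewrite -Cintegral_sum//; last by move=> n _; apply: CintegrableZ => //; exact: Cintegrable_coef.
rewrite -CintegralB//; last 2 first.
- exact: Cintegrable_expw.
- apply: (@Cintegrable_sum _ _ _ P _ measurableT _ _ (fun (n : 'I_N) u => (x ^+ n)%:C * expw_coef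
  (w u) n)).
  by move=> n _; apply: CintegrableZ => //; exact: Cintegrable_coef.
apply: eq_Cintegral => u _; rewrite /exp_rem -taylor_expw; congr (_ - _).
by apply: eq_bigr => n _; rewrite mulrC.
Qed.

(** The expectation of the bound on [exp_rem N] (- x w): a finite moment of order N yields the
    asymptotic expansion at 0 to that order. *)
Lemma laplace_cut01 N : exists2 C, 0 <= C &
  forall x, 0 < x <= 1 -> cabs (cut laplace laplace_coef N x) <= C * expR (N%:R * ln x).
Proof.
pose B u := 2 ^+ N * expR `|c| * moment_bound N u.
have B0 u : 0 <= B u by rewrite mulr_ge0 ?moment_bound_ge0// mulr_ge0 ?expR_ge0 ?exprn_ge0.
have iB : rintegrable P setT B by apply: rintegrableZ => //; exact: moment_bound_integrable.
exists (2 * \int[P]_(u in setT) B u); first by rewrite mulr_ge0// Rintegral_ge0.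
move=> x hx; have /andP[x0 x1] := hx; rewrite cut01// laplace_taylor.
have -> : expR (N%:R * ln x) = x ^+ N by rewrite mulr_natl -lnXn// lnK// posrE exprn_gt0.
rewrite -mulrA -RintegralZr//.
have h u : cabs (exp_rem N (x%:C * - w u)) <= B u * x ^+ N.
  apply: le_trans (le_exp_rem _ _) _; rewrite Re_mulR ReN cabsM cabsN cabsR gtr0_norm// exprMn.
  rewrite normrM normrN gtr0_norm// [Re _]/= /B.
  rewrite [leRHS](_ : _ = 2 ^+ N * (x ^+ N * moment_bound N u) * expR `|c|); last by ring.
  have xN : 0 <= x ^+ N by rewrite exprn_ge0// ltW.
  have tN : 0 <= 2 ^+ N :> R by rewrite exprn_ge0.
  have cN : 0 <= cabs (w u) ^+ N by rewrite exprn_ge0// cabs_ge0.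
  apply: ler_pM; [by rewrite !mulr_ge0|exact: expR_ge0| |].
    by apply: ler_wpM2l => //; apply: ler_wpM2l => //; exact: cabs_moment.
  by rewrite ler_expR ler_piMl.
have iBx : rintegrable P setT (fun u => B u * x ^+ N).
  by under eq_fun do rewrite mulrC; exact: rintegrableZ.
apply: le_Cintegral => // .
apply: (Cintegrable_le measurableT _ _ iBx) => [|u _]; last exact: h.
apply: cmeas_exp_rem; apply: cmeasM; first exact: cmeas_cst.
by apply: cmeasN; exact: cmeas_line.
Qed.

Lemma Cintegrable_Cpower z : 0 < c -> Cintegrable P setT (fun u => Cpower (w u) z).
Proof.
move=> c0; pose n := (Num.truncn (Re z)).+1.
pose h u := expR (`|Im z| * pi) * (expR (Re z * ln c) + 1 + moment_bound n u).
have ih : rintegrable P setT h.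
  apply: rintegrableZ => //; apply: rintegrableD => //;
    [exact: bounded_rintegrable|exact: moment_bound_integrable].
apply: (Cintegrable_le measurableT _ _ ih).
  by apply: (@cmeas_comp _ _ _ _ _ (fun y => Cpower (c +i* y) z) _ mY); exact: cmeas_Cpower_line.
move=> u _; apply: le_trans (cabs_Cpower_line _ c0 (ltW (truncnS_gt _))) _.
by rewrite ler_wpM2l ?expR_ge0// lerD2l cabs_moment.
Qed.

Hypothesis c_gt0 : 0 < c.

Let Re_line u : 0 < Re (w u). Proof. exact: c_gt0. Qed.

(** A single product bound on the whole half-line, as [Cfubini] demands. On ]0, 1] the factor e^(2c)
    compensates e^(c x) against e^(-c x); beyond 1 all factors besides e^(-c x) are at least 1. *)
Lemma cut_expw_bound N x u : 0 < x ->
  cabs (cut (expw (w u)) (expw_coef (w u)) N x) <=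
  2 ^+ N * expR (2 * c) * (expR (N%:R * ln x) * expR (- (c * x))) * (1 + moment_bound N u).
Proof.
move=> x0; have -> : expR (N%:R * ln x) = x ^+ N by rewrite mulr_natl -lnXn// lnK// posrE exprn_gt0.
have xN : 0 <= x ^+ N by rewrite exprn_ge0// ltW.
have tN : 1 <= 2 ^+ N :> R by rewrite exprn_ege1// ler1n.
have mb := moment_bound_ge0 N u; have e0 := expR_ge0 (- (c * x)).
have [x1|x1] := leP x 1.
  rewrite cut_expw01 ?x0// (le_trans (le_exp_rem _ _))// Re_mulR cabsM cabsN cabsR gtr0_norm//
    exprMn.
  rewrite ReN normrM normrN [Re _]/= (gtr0_norm x0) (gtr0_norm c_gt0).
  rewrite [leLHS](_ : _ = 2 ^+ N * x ^+ N * (expR (x * c) * cabs (w u) ^+ N)); last by ring.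
  rewrite [leRHS](_ : _ = 2 ^+ N * x ^+ N * (expR (2 * c - c * x) * (1 + moment_bound N u)));
    last first.
    by rewrite expRD; ring.
  apply: ler_wpM2l; first by rewrite mulr_ge0// exprn_ge0.
  apply: ler_pM; rewrite ?expR_ge0 ?exprn_ge0 ?cabs_ge0//.
    by rewrite ler_expR; have : c * x <= c by [rewrite ler_piMr// ltW]; lra.
  by apply: le_trans (cabs_moment _ _) _; rewrite lerDr.
rewrite cut1y// cabs_Cexp Re_mulR ReN [Re _]/= mulrN [x * c]mulrC.
rewrite [leRHS](_ : _ = expR (- (c * x)) *
  (2 ^+ N * (expR (2 * c) * (x ^+ N * (1 + moment_bound N u))))); last by ring.
rewrite ler_peMr// !mulr_ege1//; first by rewrite -expR0 ler_expR mulr_ge0// ltW.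
  by rewrite exprn_ege1// ltW.
by rewrite lerDl.
Qed.

(** Fubini reduces the cut transform to [mellin_ext_expw] for each outcome. The terms
    [expw_coef (w u) n] / (z + n) subtracted there have expectation [laplace_coef n] / (z + n), and
    are restored by the finite sum. *)
Lemma laplace_mellin_ext N z : - N%:R < Re z -> (forall n : nat, z != - n%:R) ->
  mellin_ext laplace laplace_coef N z = Gamma z * Cintegral P setT (fun u => Cpower (w u) (- z)).
Proof.
move=> Nz zn.
pose f x u := (x^-1)%:C * cut (expw (w u)) (expw_coef (w u)) N x * cpow x z.
(* Integrable because the order N of the cut raises the exponent to Re z + N > 0. *)
pose gx x := 2 ^+ N * expR (2 * c) * (cabs ((x^-1)%:C * expw c%:C x) * expR ((Re z + N%:R) * ln x)).
have c0 : 0 < Re c%:C by exact: c_gt0.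
have zN : 0 < Re z + N%:R by rewrite -ltrBlDr sub0r.
have ig : rintegrable L D gx.
  apply: (@rintegrableZ _ _ _ L _ mD).
  by apply: (mellin_dominated_integrable (expw0_dominated c0)); rewrite oppr0.
have ih : rintegrable P setT (fun u => 1 + moment_bound N u).
  by apply: rintegrableD => //; [exact: bounded_rintegrable|exact: moment_bound_integrable].
have mw : cmeas setT (fun p : R * T => w p.2).
  by apply: cmeas_mk => //; apply: (measurableT_comp mY); exact: measurable_snd.
have mf : cmeas setT (fun p : R * T => f p.1 p.2).
  apply: cmeasM; last first.
    apply: (@cmeas_comp _ _ _ _ _ (fun x : R => cpow x z) fst); first exact: measurable_fst.
    exact: cmeas_cpow.
  apply: cmeasM.
    apply: (@cmeas_comp _ _ _ _ _ (fun x : R => (x^-1)%:C) fst); first exact: measurable_fst.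
    by apply: cmeasR; exact: measurable_inv.
  have mx : cmeas setT (fun p : R * T => p.1%:C : R[i]) by apply: cmeasR; exact: measurable_fst.
  apply: cmeasB; first by apply: cmeas_Cexp; apply: cmeasM => //; exact: cmeasN.
  apply: cmeasM.
    apply: (@cmeas_comp _ _ _ _ _ (fun x : R => (\1_(`]0, 1]%classic : set R) x)%:C) fst);
      first exact: measurable_fst.
    exact: cmeas_indic.
  apply: cmeas_sum => n; apply: cmeasM.
    by apply: cmeasM; [apply: cmeasX; exact: cmeasN|exact: cmeas_cst].
  by apply: cmeasR; apply: measurable_funX; exact: measurable_fst.
have fb x u : D x -> cabs (f x u) <= gx x * (1 + moment_bound N u).
  move=> Dx; have x0 : 0 < x by move: Dx; rewrite /= in_itv /= andbT.
  rewrite /f /gx cabsM cabsM cabs_cpow cabsM cabs_Cexp Re_mulR ReN [Re c%:C]/=.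
  rewrite (mulrDl (Re z) N%:R) (expRD (Re z * ln x)).
  have i0 : 0 <= cabs (x^-1)%:C by exact: cabs_ge0.
  rewrite [leRHS](_ : _ = cabs (x^-1)%:C * (2 ^+ N * expR (2 * c) * (expR (N%:R * ln x) *
    expR (- (c * x))) * (1 + moment_bound N u)) * expR (Re z * ln x)); last first.
    by rewrite mulrN [x * c]mulrC; ring.
  apply: ler_wpM2r; first exact: expR_ge0.
  by apply: ler_wpM2l => //; exact: cut_expw_bound.
have gx0 x : D x -> 0 <= gx x.
  by move=> Dx; rewrite !mulr_ge0 ?expR_ge0 ?exprn_ge0 ?cabs_ge0.
have h0 u : 0 <= 1 + moment_bound N u by rewrite addr_ge0 ?moment_bound_ge0.
have E1 : mellin (cut laplace laplace_coef N) z = Cintegral L D (fun x => Cintegral P setT (f x)).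
  apply: eq_Cintegral => x _.
  have cutI : Cintegrable P setT (fun u => cut (expw (w u)) (expw_coef (w u)) N x) /\
      cut laplace laplace_coef N x = Cintegral P setT
        (fun u => cut (expw (w u)) (expw_coef (w u)) N x).
    have iT : Cintegrable P setT (fun u => (\1_(`]0, 1]%classic : set R) x)%:C * taylor
      (expw_coef (w u)) N x).
      apply: CintegrableZ => //.
      apply: (@Cintegrable_sum _ _ _ P _ measurableT _ _ (fun (n : 'I_N) u => expw_coef (w u) n *
        (x ^+ n)%:C)).
      by move=> n _; exact: Cintegrable_coefZ.
    split; first by apply: CintegrableB => //; exact: Cintegrable_expw.
    rewrite CintegralB//; last exact: Cintegrable_expw.
    congr (_ - _); rewrite CintegralZ//; last first.
      apply: (@Cintegrable_sum _ _ _ P _ measurableT _ _ (fun (n : 'I_N) u => expw_coef (w u) n *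
        (x ^+ n)%:C)).
      by move=> n _; exact: Cintegrable_coefZ.
    congr (_ * _); rewrite (@Cintegral_sum _ _ _ P _ measurableT _ _
      (fun (n : 'I_N) u => expw_coef (w u) n * (x ^+ n)%:C)).
      apply: eq_bigr => n _; rewrite laplace_coefE mulrC -CintegralZ//;
        last exact: Cintegrable_coef.
      by apply: eq_Cintegral => u _; rewrite mulrC.
    by move=> n _; exact: Cintegrable_coefZ.
  have [iC ->] := cutI.
  transitivity (((x^-1)%:C * cpow x z) * Cintegral P setT
    (fun u => cut (expw (w u)) (expw_coef (w u)) N x)).
    by rewrite mulrAC.
  by rewrite -CintegralZ//; apply: eq_Cintegral => u _; rewrite /f mulrAC.
have E2 u : Cintegral L D (f^~ u) =
    Gamma z * Cpower (w u) (- z) - \sum_(n < N) expw_coef (w u) n / (z + n%:R).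
  by rewrite -(mellin_ext_expw (Re_line u) Nz zn) /mellin_ext addrK.
have iS : Cintegrable P setT (fun u => \sum_(n < N) expw_coef (w u) n / (z + n%:R)).
  apply: (@Cintegrable_sum _ _ _ P _ measurableT _ _ (fun (n : 'I_N) u => expw_coef (w u) n /
    (z + n%:R))).
  by move=> n _; exact: Cintegrable_coefZ.
have iG : Cintegrable P setT (fun u => Gamma z * Cpower (w u) (- z)).
  by apply: CintegrableZ => //; exact: Cintegrable_Cpower.
rewrite /mellin_ext E1 (@Cfubini _ _ _ _ _ L P D f gx (fun u => 1 + moment_bound N u) mD mf fb
  gx0 h0 ig ih).
transitivity (Cintegral P setT (fun u => Gamma z * Cpower (w u) (- z) - \sum_(n < N) expw_coef
  (w u) n / (z + n%:R))
   + \sum_(n < N) laplace_coef n / (z + n%:R)).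
  by congr (_ + _); apply: eq_Cintegral => u _; exact: E2.
rewrite CintegralB// CintegralZ//; last exact: Cintegrable_Cpower.
rewrite (@Cintegral_sum _ _ _ P _ measurableT _ _ (fun (n : 'I_N) u => expw_coef (w u) n /
  (z + n%:R))); last first.
  by move=> n _; exact: Cintegrable_coefZ.
rewrite [X in _ - X](_ : _ = \sum_(n < N) laplace_coef n / (z + n%:R)) ?subrK//.
apply: eq_bigr => n _; rewrite laplace_coefE mulrC -CintegralZ//; last exact: Cintegrable_coef.
by apply: eq_Cintegral => u _; rewrite mulrC.
Qed.

End LaplaceTransform.

(** * The sinh-moment function *)

Lemma sinhN (R : realType) (x : R) : sinh (- x) = - sinh x.
Proof. by rewrite /sinh opprK -mulNr opprB. Qed.

Lemma hatS_charN (R : realType) (t x : R) : hatS_char t (- x) = hatS_char t x.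
Proof. by rewrite /hatS_char oppr_eq0 sinhN invrN mulrNN. Qed.

(** With y = x a / 2, y / sinh y = 2 y e^(-y) / (1 - e^(-2 y)), and 2 y = a x. *)
Lemma hatS_char_pos (R : realType) (t x a : R) : 0 < x -> 0 < a ->
  hatS_char t (x * a / 2) =
  expR (t * (ln a + ln x - x * a / 2 - ln (1 - expR (- (a * x))))).
Proof.
move=> x0 a0; have y0 : 0 < x * a / 2 by rewrite divr_gt0 ?mulr_gt0.
have e1 : 0 < 1 - expR (- (a * x)) by rewrite subr_gt0 expR_lt1 oppr_lt0 mulr_gt0.
rewrite /hatS_char gt_eqF//; set y := x * a / 2 in y0 *.
have -> : y / sinh y = expR (ln a + ln x - y - ln (1 - expR (- (a * x)))).
  rewrite !expRD !expRN !lnK ?posrE -?(expRN (a * x))// /sinh.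
  have -> : expR (- (a * x)) = (expR y)^-1 ^+ 2 by rewrite -expRN -expRM_natl /y; congr expR; field.
  rewrite expRN /y; have ey := expR_gt0 (x * a / 2); have ex : 1 < expR (x * a / 2).
    by rewrite expR_gt1.
  field; apply/andP; split; first by rewrite gt_eqF.
  by rewrite gt_eqF// subr_gt0 exprn_egt1.
by rewrite -expRM mulrC.
Qed.

Lemma eq_mellin_ext (R : realType) (G1 G2 : R -> R[i]) (g : nat -> R[i]) N z :
  (forall x, 0 < x -> G1 x = G2 x) -> mellin_ext G1 g N z = mellin_ext G2 g N z.
Proof.
move=> h; congr (_ + _); apply: eq_Cintegral => x; rewrite inE /= in_itv /= andbT => x0.
by rewrite /cut h.
Qed.

Section SinhMomentContinuation.
Context (R : realType) (r : nat) (alpha a : 'I_r -> R) (b c : R).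
Context (d : measure_display) (T : measurableType d) (P : probability T R) (Y : {RV P >-> R}).
Hypotheses (alpha_gt0 : forall j, 0 < alpha j) (a_gt0 : forall j, 0 < a j) (b_gt0 : 0 < b).
Hypothesis cE : c = b - 2^-1 * \sum_(j < r) a j * alpha j.
Hypothesis Y_moments : has_moments P Y.
Hypothesis Y_charfun : forall x,
  charfun Y x = (\prod_(j < r) hatS_char (alpha j) (x * a j / 2))%:C.
Local Notation beta := (\sum_(j < r) alpha j).
Local Notation weight := (\prod_(j < r) a j `^ alpha j).
Local Notation cr := weight^-1.
Local Notation C := (R[i] : numFieldType).
Local Notation L := (@lebesgue_measure R).
Local Notation D := (`]0, +oo[%classic : set R).
Local Notation g := (laplace_coef P Y c).
Let mD : measurable D. Proof. exact: measurable_itv. Qed.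

(** e^(-x (c + i Y)) = e^(-c x) e^(-i x Y), and the characteristic function of Y is even. *)
Lemma laplaceE x : laplace P Y c x =
  (expR (- (c * x)) * \prod_(j < r) hatS_char (alpha j) (x * a j / 2))%:C.
Proof.
have -> : \prod_(j < r) hatS_char (alpha j) (x * a j / 2) =
    \prod_(j < r) hatS_char (alpha j) (- x * a j / 2).
  by apply: eq_bigr => j _; rewrite !mulNr hatS_charN.
transitivity ((expR (- (c * x)))%:C * charfun Y (- x)); last by rewrite Y_charfun -rmorphM.
rewrite /charfun -CintegralZ//; last first.
  apply: (Cintegrable_le measurableT _ _ (bounded_rintegrable P 1)).
    apply: (@cmeas_comp _ _ _ _ _ (fun y : R => Cexp (0 +i* (- x * y))) Y) => //.
    exact: cmeas_Cexp_imag.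
  by move=> u _; rewrite cabs_Cexp [Re _]/= expR0.
apply: eq_Cintegral => u _; rewrite /expw -CexpR -CexpD; congr Cexp.
by apply: eqc; [rewrite Re_mulR ReN ReD|rewrite Im_mulR ImN ImD] => /=; ring.
Qed.

(** The closed form of [laplace] on x > 0, visibly measurable and decaying at infinity for either
    sign of c. The two functions are compared only on x > 0, which is all that the Mellin transform
    sees. *)
Definition half_laplace x : R[i] := (weight * expR (beta * ln x) * sinh_kernel alpha a b x)%:C.

(** The value of c is exactly what makes the factors e^(-x a_j alpha_j / 2) cancel, leaving e^(-b
    x). *)
Lemma half_laplaceE x : 0 < x -> laplace P Y c x = half_laplace x.
Proof.
move=> x0; rewrite laplaceE /half_laplace; congr _%:C.
rewrite (eq_bigr _ (fun j _ => hatS_char_pos (alpha j) x0 (a_gt0 j))) -expR_sum -expRD.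
have -> : weight = expR (\sum_(j < r) alpha j * ln (a j)).
  by rewrite expR_sum; apply: eq_bigr => j _; rewrite /powR gt_eqF.
rewrite /sinh_kernel -expR_sum -!expRD; congr expR.
rewrite cE mulr_suml.
have -> : \sum_(j < r) alpha j * (ln (a j) + ln x - x * a j / 2 - ln (1 - expR (- (a j * x)))) =
  \sum_(j < r) alpha j * ln (a j) + \sum_(j < r) alpha j * ln x - x / 2 * \sum_(j < r) a j * alpha j
  + \sum_(j < r) - alpha j * ln (1 - expR (- (a j * x))).
  rewrite mulr_sumr -sumrN -!big_split /=; by apply: eq_bigr => j _; field.
by field.
Qed.

Let beta_ge0 : 0 <= beta. Proof. by apply: sumr_ge0 => j _; exact: ltW. Qed.
Let weight_gt0 : 0 < weight.
Proof. by apply: prodr_gt0 => j _; exact: powR_gt0. Qed.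

(** Two sources: near 0 the moments of Y, through [laplace_cut01]; at infinity the decay of
    [sinh_kernel], half of whose rate absorbs x^beta. *)
Lemma half_laplace_dominated N : mellin_dominated (cut half_laplace g N) N%:R.
Proof.
have [mk [C1 [C2 [e [e0 _ h2]]]]] := sinh_kernel_dominated alpha_gt0 a_gt0 b_gt0.
split.
  apply: cmeas_cut; apply: cmeasR; apply: measurable_funM; last by case: mk.
  apply: measurable_funM => //; apply: measurableT_comp => //; exact: measurable_funM.
have [C0 C00 h0] := laplace_cut01 Y_moments c N.
have e2 : 0 < e / 2 by rewrite divr_gt0.
have [C3 C30 h3] := lnpow_le_exp beta e2.
exists C0, (weight * C3 * C2), (e / 2); split=> // x hx.
  by have := h0 _ hx; rewrite /cut half_laplaceE//; case/andP: hx.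
rewrite cut1y// cabsR ger0_norm; last first.
  apply: mulr_ge0; last exact: sinh_kernel_ge0.
  by apply: mulr_ge0; [exact: ltW|exact: expR_ge0].
have := h2 _ hx; rewrite cabsR ger0_norm ?sinh_kernel_ge0// => h.
have -> : weight * C3 * C2 * expR (- (e / 2 * x)) =
   (weight * (C3 * expR (e / 2 * x))) * (C2 * expR (- (e * x))).
  have -> : - (e / 2 * x) = e / 2 * x - e * x by field.
  by rewrite expRD; ring.
apply: ler_pM => //; first by rewrite mulr_ge0 ?expR_ge0// ltW.
  exact: sinh_kernel_ge0.
by apply: ler_wpM2l; [exact: ltW|exact/h3/ltW].
Qed.

Definition smoment_ext : R[i] -> R[i] := continuation half_laplace g cr%:C beta.

(** Here level 0 is admissible, so nothing is cut; x^(s - beta) x^beta = x^s, and the constant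
    [weight] cancels [cr]. *)
Lemma smoment_extE s : beta < Re s -> smoment_ext s = Smoment alpha a b s.
Proof.
move=> bs; have s0 : - 0%:R < Re (s - beta%:C) by rewrite oppr0 ReB subr_gt0.
rewrite /smoment_ext (continuationE _ half_laplace_dominated s0) /cont_at big_ord0 addr0.
rewrite (Smoment_mellin alpha_gt0 a_gt0 b_gt0 bs).2 mulrCA; congr (_ * _).
have bs' : - - beta < Re s by rewrite opprK.
rewrite /mellin -(@CintegralZ _ _ _ L _ mD); last first.
  apply: (mellin_integrable (half_laplace_dominated 0) s0).
apply: eq_Cintegral => x; rewrite inE /= in_itv /= andbT => x0.
rewrite /cut /taylor big_ord0 mulr0 subr0 /half_laplace.
rewrite -[in RHS](subrK beta%:C s) (cpowD x (s - _)).
have -> : cpow x beta%:C = (expR (beta * ln x))%:C by rewrite /cpow -rmorphM CexpR.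
rewrite !rmorphM fmorphV /=; field.
by rewrite !fmorph_eq0 !gt_eqF.
Qed.

Lemma cr_neq0 : cr%:C != 0 :> R[i].
Proof. by rewrite (inj_eq (@complexI R)) invr_eq0 gt_eqF. Qed.

(** One formula for all n: where [Gamma] has a pole its value is 0, so the quotient is 0, the
    correct residue at a removable singularity. *)
Lemma smoment_ext_residue n : is_simple_pole_with_residue (smoment_ext : C -> C) (beta%:C - n%:R)
  ((-1) ^+ n * cr%:C * cmoment P Y c n / (n`!%:R * Gamma (beta%:C - n%:R))).
Proof.
have -> : (-1) ^+ n * cr%:C * cmoment P Y c n / (n`!%:R * Gamma (beta%:C - n%:R)) =
    cr%:C * g n * rGamma (beta%:C - n%:R).
  by rewrite /laplace_coef /rGamma (invfM n`!%:R); set u := (Gamma _)^-1; ring.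
exact: continuation_residue beta half_laplace_dominated n cr_neq0.
Qed.

Lemma smoment_ext_representation s : 0 < c -> (forall n : nat, s != beta%:C - n%:R) ->
  smoment_ext s = cr%:C * (Gamma (s - beta%:C) / Gamma s) *
    Cintegral P setT (fun u => Cpower (c +i* Y u) (- s + beta%:C)).
Proof.
move=> c0 sn; have [N _ hN] := exists_level beta s 0.
rewrite /smoment_ext (continuation_ext _ half_laplace_dominated hN sn).
rewrite -(eq_mellin_ext _ _ _ half_laplaceE) laplace_mellin_ext//; last first.
  by move=> n; apply: contra_neq (sn n) => h; rewrite -h; ring.
by rewrite opprB [beta%:C - s]addrC /rGamma; ring.
Qed.

(** For non-integral beta, - m is none of the points beta - n, so the continued Mellin transform is
    finite there and the zero of 1 / Gamma(s) survives. *)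
Lemma smoment_ext_opp_nat m : beta \isn't a Num.int ->
  holomorphic_at (smoment_ext : C -> C) (- m%:R) /\ smoment_ext (- m%:R) = 0.
Proof.
move=> bZ; have mb n : (- m%:R : R[i]) != beta%:C - n%:R.
  apply: contra bZ => /eqP /(congr1 (@Re R)); rewrite ReN ReB !Re_nat [Re _]/= => h.
  have -> : beta = n%:R - m%:R by rewrite h; ring.
  by apply: rpredB; exact: natr_int.
split.
  by apply: (continuation_holo _ half_laplace_dominated) => n h; move: (mb n); rewrite h eqxx.
have [N _ hN] := exists_level beta (- m%:R) 0.
rewrite /smoment_ext (continuation_ext _ half_laplace_dominated hN mb).
by rewrite rGamma_opp_nat mulr0 mul0r.
Qed.

End SinhMomentContinuation.

(** * Integral beta, and the constant d of the residues beyond beta *)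

Section IntegerSum.
Context (R : realType) (r : nat) (alpha a : 'I_r -> R) (b c : R).
Context (d : measure_display) (T : measurableType d) (P : probability T R) (Y : {RV P >-> R}).
Hypotheses (alpha_gt0 : forall j, 0 < alpha j) (a_gt0 : forall j, 0 < a j) (b_gt0 : 0 < b).
Hypothesis cE : c = b - 2^-1 * \sum_(j < r) a j * alpha j.
Hypothesis Y_moments : has_moments P Y.
Hypothesis Y_charfun : forall x,
  charfun Y x = (\prod_(j < r) hatS_char (alpha j) (x * a j / 2))%:C.
Local Notation beta := (\sum_(j < r) alpha j).
Local Notation cr := ((\prod_(j < r) a j `^ alpha j)^-1).
Local Notation C := (R[i] : numFieldType).
Local Notation F := (smoment_ext alpha a b c Y).

(** Of the possible poles m - n only 1, ..., m are positive; all others are zeros of 1 / Gamma and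
    hence removable. *)
Lemma nat_level (m n : nat) (s : R[i]) : (forall k : 'I_m, s != k.+1%:R) ->
  s = m%:R - n%:R -> exists2 k, n = (m + k)%N & s = - k%:R.
Proof.
move=> sk sE; have [nm|mn] := ltnP n m; last first.
  by exists (n - m)%N; rewrite ?subnKC// sE natrB// opprB.
have h : ((m - n).-1 < m)%N by rewrite prednK ?subn_gt0// leq_subr.
have := sk (Ordinal h); rewrite /= prednK ?subn_gt0// natrB 1?ltnW// sE eqxx.
by [].
Qed.

Lemma smoment_ext_nat (m : nat) (s : R[i]) : beta = m%:R -> (forall k : 'I_m, s != k.+1%:R) ->
  holomorphic_at (F : C -> C) s /\
  (0 < c -> F s = cr%:C / (\prod_(k < m) (s - k.+1%:R)) *
    Cintegral P setT (fun u => Cpower (c +i* Y u) (- s + beta%:C))).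
Proof.
move=> bm sk; have bE : beta%:C = m%:R by rewrite bm natcE.
have dom := half_laplace_dominated alpha_gt0 a_gt0 b_gt0 cE Y_moments Y_charfun.
split.
  apply: (continuation_holo _ dom) => n; rewrite bE => /(nat_level sk)[k _ ->].
  by right; exact: rGamma_opp_nat.
move=> c0; have [[n sn]|sn] := pselect (exists n : nat, s = beta%:C - n%:R); last first.
  have {}sn n : s != beta%:C - n%:R by apply/eqP => h; apply: sn; exists n.
  rewrite (smoment_ext_representation alpha_gt0 a_gt0 b_gt0 cE Y_moments Y_charfun c0 sn);
    congr (_ * _ * _).
  have Gs : rGamma (s - m%:R) != 0.
    by apply: rGamma_neq0 => n; apply: contra_neq (sn n); rewrite bE => h; rewrite -h; ring.
  have E : rGamma (s - m%:R) = \prod_(k < m) (s - k.+1%:R) * rGamma s.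
    rewrite (rGamma_shift m) subrK; congr (_ * _); rewrite (reindex_inj rev_ord_inj) /=.
    by apply: eq_bigr => k _; rewrite natrB//; ring.
  have G1 : Gamma (s - m%:R) = (rGamma (s - m%:R))^-1 by rewrite /rGamma invrK.
  rewrite bE G1 -/(rGamma s) E invfM -mulrA mulVf ?mulr1//.
  by move: Gs; rewrite E mulf_eq0 negb_or => /andP[].
(* Here s - beta is a pole of Gamma; only the n-th term of the continuation survives. *)
rewrite bE in sn; have [k nE sE] := nat_level sk sn.
have [N nN hN] := exists_level beta s n.+1.
have wn u : c +i* Y u != 0 by rewrite eq_complex negb_and /= gt_eqF.
have -> : Cintegral P setT (fun u => Cpower (c +i* Y u) (- s + beta%:C)) = cmoment P Y c n.
  apply: eq_Cintegral => u _; rewrite -(Cpower_nat _ (wn u)); congr Cpower.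
  by rewrite bE sE opprK nE natrD addrC.
rewrite /smoment_ext (continuationE _ dom hN) /cont_at {1}sE rGamma_opp_nat mul0r add0r.
pose f i : R[i] := laplace_coef P Y c i * rGamma_div (beta%:C - i%:R) s.
have -> : \sum_(i < N) laplace_coef P Y c i * rGamma_div (beta%:C - i%:R) s = f n.
  rewrite -[LHS]/(\sum_(i < N) f i) (bigD1 (Ordinal nN))//= big1 ?addr0// => i ni.
  rewrite /f rGamma_divE; first by rewrite sE rGamma_opp_nat mul0r mulr0.
  rewrite sn bE (inj_eq (addrI _)) eqr_opp eqr_nat eq_sym.
  by apply: contra ni => /eqP ni; apply/eqP/val_inj.
rewrite /f.
rewrite bE (_ : m%:R - n%:R = - k%:R) -?sn// sE rGamma_div_opp_nat /laplace_coef.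
have f0 j : (j`!%:R : R[i]) != 0 by rewrite pnatr_eq0 -lt0n fact_gt0.
(* Up to sign the product is (k + 1) ... (k + m), and n = m + k. *)
have -> : \prod_(j < m) (- k%:R - j.+1%:R) = (-1) ^+ m * (n`!%:R / k`!%:R) :> R[i].
  rewrite (eq_bigr (fun j : 'I_m => -1 * (k + j.+1)%:R)) => [|j _]; last by rewrite natrD; ring.
  rewrite big_split /= prodr_const card_ord; congr (_ * _).
  rewrite nE addnC; elim: (m) => [|j ih]; first by rewrite big_ord0 addn0 divff.
  by rewrite big_ord_recr /= ih addnS factS natrM; ring.
rewrite nE exprD -nE; have -> : (-1) ^+ m * (n`!%:R / k`!%:R) =
  ((-1) ^+ m * n`!%:R) / k`!%:R :> R[i] by rewrite mulrA.
have s1 j : (-1) ^+ j * (-1) ^+ j = 1 :> R[i] by rewrite -exprD addnn -signr_odd odd_double expr0.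
have sj j : (-1) ^+ j != 0 :> R[i] by rewrite signr_eq0.
have e1 := s1 m; have e2 := s1 k.
set u := (-1) ^+ m in e1 *; set v := (-1) ^+ k in e2 *.
move: (cr%:C) (cmoment P Y c n) => q w.
rewrite [LHS](_ : _ = (v * v) * u * (q * w * k`!%:R / n`!%:R)); last by field.
rewrite [RHS](_ : _ = u^-1 * (q * w * k`!%:R / n`!%:R)); last first.
  by field; rewrite !f0 /u sj.
by congr (_ * _); rewrite e2 mul1r; apply: (mulfI (sj m)); rewrite -/u e1 mulfV// /u sj.
Qed.

(** The shift of [Gamma] by m + 1 = [n - beta] + 1, the first to make beta - n positive. Each factor
    beta - n + i is - (n - beta - i), whence the sign (-1)^(m+1); non-integrality keeps all of them
    non-zero. *)
Lemma d_coefE (beta' : R) n : beta' \isn't a Num.int -> beta' < n%:R ->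
  d_coef beta' n = Gamma (beta'%:C - n%:R).
Proof.
move=> bZ bn; rewrite /d_coef; set m := `|_|%N.
have fl : 0 <= Num.floor (n%:R - beta') by rewrite floor_ge0 subr_ge0 ltW.
have mE : m%:R = (Num.floor (n%:R - beta'))%:~R :> R by rewrite -[in RHS](gez0_abs fl).
have zE i : (beta'%:C - n%:R + i%:R : R[i]) = - (n%:R - beta' - i%:R)%:C.
  by rewrite !natcE -!rmorphB -rmorphD -rmorphN; congr _%:C; ring.
have zn i : (beta'%:C - n%:R + i%:R : R[i]) != 0.
  rewrite zE oppr_eq0 fmorph_eq0; apply: contra bZ; rewrite subr_eq0 => /eqP h.
  have -> : beta' = n%:R - i%:R by rewrite -h; ring.
  by apply: rpredB; exact: natr_int.
rewrite -[RHS]invrK -/(rGamma _) (rGamma_shift m.+1) invfM.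
have -> : rGamma (beta'%:C - n%:R + m.+1%:R) = (Gamma (beta' - n%:R + 1 + m%:R)%:C)^-1.
  by rewrite /rGamma; congr (Gamma _)^-1; rewrite !natcE -rmorphB -rmorphD -natr1; congr _%:C; ring.
rewrite invrK mulrC mulrA; congr (_ * _).
have -> : \prod_(i < m.+1) (beta'%:C - n%:R + i%:R) =
    (-1) ^+ m.+1 * (\prod_(i < m.+1) (n%:R - beta' - i%:R))%:C.
  rewrite rmorph_prod (eq_bigr (fun i : 'I_m.+1 => -1 * (n%:R - beta' - i%:R)%:C)) => [|i _].
    by rewrite big_split /= prodr_const card_ord.
  by rewrite zE mulN1r.
by rewrite invfM invr_sign mulrC.
Qed.

End IntegerSum.

Theorem theorem1 (R : realType) (r : nat) (alpha a : 'I_r -> R)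
  (b beta c cr : R)
  (d d' : measure_display)
  (Omega : measurableType d) (P : probability Omega R)
  (Omega' : measurableType d') (Q : probability Omega' R)
  (hatS : 'I_r -> {RV Q >-> R}) (X : 'I_r -> {RV P >-> R}) (Y : {RV P >-> R})
  (r_ge1 : (1 <= r)%N)
  (alpha_gt0 : forall j, 0 < alpha j)
  (a_gt0 : forall j, 0 < a j)
  (b_gt0 : 0 < b)
  (betaE : beta = \sum_(j < r) alpha j)
  (cE : c = b - 2^-1 * \sum_(j < r) a j * alpha j)
  (crE : cr = (\prod_(j < r) a j `^ alpha j)^-1)
  (c_neq0 : c != 0)
  (hatS_law : forall j, is_hatS (alpha j) (hatS j))
  (X_law : forall j, eq_in_law P Q (X j) (fun u => 2^-1 * hatS j u))
  (X_indep : mutually_independent X)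
  (YE : forall u, Y u = \sum_(j < r) a j * X j u) :
  let S := Smoment alpha a b in
  (* integral of 1 / (c + i y) ^ (s - beta) with respect to dF_Y *)
  let I (s : R[i]) : R[i] :=
    Cintegral (dF Y) setT (fun y : R => (Cpower (c +i* y) (s - beta%:C))^-1) in
  (* E ((c + i Y) ^ (- s + beta)) *)
  let E (s : R[i]) : R[i] :=
    Cintegral P setT (fun u => Cpower (c +i* Y u) (- s + beta%:C)) in
  (* E ((c + i Y) ^ n) *)
  let M (n : nat) : R[i] :=
    Cintegral P setT (fun u => (c +i* Y u) ^+ n) in
  [/\ (* the series, the integrals and the expectations make sense *)
      forall s, beta < Re s -> unordered_summable (Smoment_term alpha a b s),
      0 < c -> forall s : R[i],
        Cintegrable (dF Y) setT
          (fun y : R => (Cpower (c +i* y) (s - beta%:C))^-1) /\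
        Cintegrable P setT (fun u => Cpower (c +i* Y u) (- s + beta%:C)),
      forall n : nat, Cintegrable P setT (fun u => (c +i* Y u) ^+ n),
      (* the integral representation *)
      0 < c -> forall s, beta < Re s ->
        S s = cr%:C * (Gamma (s - beta%:C) / Gamma s) * I s /\
        S s = cr%:C * (Gamma (s - beta%:C) / Gamma s) * E s
    & (* the continuation F of S *)
      exists F : R[i] -> R[i],
      [/\ forall s, beta < Re s -> F s = S s,
          (* (a) *)
          [/\ meromorphic F,
              forall s k, pole_of_order F s k -> k = 1%N
            & 0 < c -> forall s, (forall n : nat, s != beta%:C - n%:R) ->
                F s = cr%:C * (Gamma (s - beta%:C) / Gamma s) * I s /\
                F s = cr%:C * (Gamma (s - beta%:C) / Gamma s) * E s],
          (* (b) *)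
          forall m : nat, (0 < m)%N -> beta = m%:R ->
            forall s, (forall k : 'I_m, s != k.+1%:R) ->
              holomorphic_at F s /\
              (0 < c -> F s = cr%:C / (\prod_(k < m) (s - k.+1%:R)) * I s)
        & (* (c) *)
          beta \isn't a Num.int ->
          [/\ forall m : nat, holomorphic_at F (- m%:R) /\ F (- m%:R) = 0,
              forall n : nat, n%:R < beta ->
                is_simple_pole_with_residue F (beta%:C - n%:R)
                  ((-1) ^+ n * cr%:C * M n
                   / (n`!%:R * Gamma (beta%:C - n%:R)))
            & forall n : nat, (0 < n)%N -> beta < n%:R ->
                is_simple_pole_with_residue F (beta%:C - n%:R)
                  ((-1) ^+ n * cr%:C * M n / (n`!%:R * d_coef beta n))]]].
Proof.
have Y_charfun := charfun_sum hatS_law X_law X_indep YE.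
have Y_moments := sum_has_moments hatS_law X_law YE.
subst beta cr.
have repr := smoment_ext_representation alpha_gt0 a_gt0 b_gt0 cE Y_moments Y_charfun.
have dom := half_laplace_dominated alpha_gt0 a_gt0 b_gt0 cE Y_moments Y_charfun.
have extE := smoment_extE alpha_gt0 a_gt0 b_gt0 cE Y_moments Y_charfun.
have cr0 := cr_neq0 alpha a_gt0.
move=> S I E M.
have mI (s : R[i]) : 0 < c ->
    cmeas setT (fun y : R => (Cpower (c +i* y) (s - (\sum_(j < r) alpha j)%:C))^-1).
  by move=> c0; under eq_fun do rewrite -CpowerN; exact: cmeas_Cpower_line.
have powE s (y : R) : (Cpower (c +i* y) (s - (\sum_(j < r) alpha j)%:C))^-1 =
    Cpower (c +i* y) (- s + (\sum_(j < r) alpha j)%:C).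
  by rewrite -CpowerN opprB addrC.
(* dF_Y is the law of Y, so the Stieltjes integral is the expectation; both versions of the
   representation are one statement. *)
have IE s : 0 < c -> I s = E s.
  move=> c0; rewrite /I dF_Cintegral; last exact: mI.
  by apply: eq_Cintegral => u _; rewrite powE.
have EI s : 0 < c -> Cintegrable P setT
  (fun u => Cpower (c +i* Y u) (- s + (\sum_(j < r) alpha j)%:C)).
  by move=> c0; exact: Cintegrable_Cpower.
(* The points beta - n, excluded from the representation, lie outside the half-plane of
   convergence. *)
have far s : \sum_(j < r) alpha j < Re s -> forall n : nat, s != (\sum_(j < r) alpha j)%:C - n%:R.
  move=> bs n; apply: contraTneq bs => ->.
  by rewrite ReB Re_nat [Re _]/= -leNgt gerBl.
split.
- by move=> s bs; exact: (Smoment_mellin alpha_gt0 a_gt0 b_gt0 bs).1.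
- move=> c0 s; split; last exact: EI.
  apply: dF_Cintegrable; first exact: mI.
  by apply: eq_Cintegrable (EI s c0) => // u _; rewrite powE.
- by move=> n; exact: Cintegrable_moment.
- move=> c0 s bs; have eS : S s = smoment_ext alpha a b c Y s by rewrite extE.
  by rewrite IE// eS repr//; exact: far.
(* Built from the closed form of the Laplace transform, this witness serves both signs of c. *)
exists (smoment_ext alpha a b c Y); split.
- exact: extE.
- split.
  + exact: continuation_meromorphic.
  + by move=> s k; exact: continuation_simple.
  + by move=> c0 s sn; rewrite IE// repr.
- move=> m m0 bm s sk.
  have [h1 h2] := smoment_ext_nat alpha_gt0 a_gt0 b_gt0 cE Y_moments Y_charfun bm sk.
  by split=> // c0; rewrite IE// h2.
- move=> bZ; split.
  + by move=> m; exact: smoment_ext_opp_nat.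
  + by move=> n _; exact: smoment_ext_residue.
  + by move=> n _ bn; rewrite d_coefE//; exact: smoment_ext_residue.
Qed.
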